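(* Let $\Omega\subset\mathbb{R}^n$ be a (possibly unbounded) domain, let $\mathcal{L}u=-\nabla\cdot(A\nabla u)-B\cdot\nabla u-cu$, and let $\mathcal{B}$ be either the Dirichlet or the indefinite Robin boundary operator, all satisfying the standing assumptions stated in the context. Assume that there exists a function $\eta:\Omega\to\mathbb{R}$, $\eta\in C^1\cap L^\infty$, such that $\nabla\eta=-A^{-1}B$ in $\Omega$, that the Lebesgue measure of $\Omega\cap\{|x|\le R\}$ satisfies $|\Omega\cap\{|x|\le R\}|=O(R^2)$ as $R\to+\infty$, and that there exists a bounded principal eigenfunction of $(\mathcal{L},\mathcal{B})$. Then the generalized principal eigenvalue $\lambda_1$ is simple, i.e. the solution $\varphi$ of $$\mathcal{L}\varphi=\lambda_1\varphi\ \text{ in }\Omega,\qquad \mathcal{B}\varphi=0\ \text{ on }\partial\Omega,$$ is unique up to a multiplicative constant.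
   Context: Operators. $\mathcal{L}u(x)=-\nabla\cdot(A(x)\nabla u(x))-B(x)\cdot\nabla u(x)-c(x)u(x)$ for $x\in\Omega$, with $A:\Omega\to\mathbb{R}^{n\times n}$, $B:\Omega\to\mathbb{R}^n$, $c:\Omega\to\mathbb{R}$. The boundary operator $\mathcal{B}$ on $\partial\Omega$ is either of Dirichlet type, $\mathcal{B}u(x)=u(x)$, or of indefinite Robin type, $\mathcal{B}u(x)=\nu(x)\cdot A(x)\nabla u(x)+\gamma(x)u(x)$, where $\nu(x)$ is the outer normal direction at $x\in\partial\Omega$ and $\gamma:\partial\Omega\to\mathbb{R}$ has no sign restriction (Neumann is $\gamma\equiv0$). Standing assumptions. For some $\alpha\in(0,1)$: $A\in C^{1,\alpha}_{loc}\cap L^\infty(\overline\Omega)$, $B,c\in C^{0,\alpha}_{loc}\cap L^\infty(\overline\Omega)$, $\gamma\in C^{1,\alpha}_{loc}\cap L^\infty(\partial\Omega)$; the domain $\Omega$ is of class $C^n_{loc}$, or $C^{2,\alpha}_{loc}$ if $n=2$; $A$ is symmetric positive definite, not necessarily uniformly, i.e. $A(x)\ge\underline a(x)I_n$ for some function $\underline a:\Omega\to(0,+\infty)$. Definitions. A function $u\in C^{2,\alpha}_{loc}(\overline\Omega)$ is a supersolution of $(\mathcal{L},\mathcal{B})$ in $\Omega$ if $\mathcal{L}u\ge0$ in $\Omega$ and $\mathcal{B}u\ge0$ on $\partial\Omega$. The generalized principal eigenvalue is $$\lambda_1:=\sup\{\lambda\in\mathbb{R}:(\mathcal{L}-\lambda,\mathcal{B})\text{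 admits a positive supersolution}\}.$$ A principal eigenfunction is any function $\varphi$ which is positive on $\Omega$ and satisfies $\mathcal{L}\varphi=\lambda_1\varphi$ in $\Omega$, $\mathcal{B}\varphi=0$ on $\partial\Omega$.
   Formalization: Uniqueness is stated for solutions that are positive or bounded; for all solutions it fails: in the plane with the operator minus Laplacian, the eigenvalue is 0 and both 1 and x_1 are solutions. *)

(* Defs.v *)
(* Points of R^n are row vectors over an arbitrary R : realType. *)
From mathcomp Require Export all_boot all_order all_algebra.
From mathcomp Require Export all_classical all_reals all_analysis.
Set Implicit Arguments.
Unset Strict Implicit.
Unset Printing Implicit Defensive.
Export Order.TTheory GRing.Theory Num.Theory.
Export numFieldNormedType.Exports.
Local Open Scope classical_set_scope.
Local Open Scope ring_scope.

Section Euclidean.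
Context {R : realType} {n : nat}.
Implicit Types (x v w : 'rV[R]_n) (E : set 'rV[R]_n).

Definition dot v w : R := \sum_i v 0 i * w 0 i.

(* The library norm `|v| on 'rV is the max norm. *)
Definition enorm v : R := Num.sqrt (dot v v).

Definition ebasis (i : 'I_n) : 'rV[R]_n := delta_mx 0 i.

(* The product M v, with v and M v written as rows. *)
Definition mxact (M : 'M[R]_n) v : 'rV[R]_n := v *m M^T.

Definition boundary E := closure E `\` E°.

Definition box (a b : 'rV[R]_n) : set 'rV[R]_n :=
  [set x | forall i, a 0 i <= x 0 i < b 0 i].

(* n-dimensional Lebesgue (outer) measure; it is only applied to Borel sets. *)
Definition lebesgue_n E : \bar R :=
  ereal_inf [set m | exists a b : nat -> 'rV[R]_n,
    [/\ forall k i, a k 0 i <= b k 0 i,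
        E `<=` \bigcup_k box (a k) (b k) &
        m = (\sum_(0 <= k <oo) (\prod_i (b k 0 i - a k 0 i))%:E)%E]].

End Euclidean.

Section Regularity.
Context {R : realType} {n : nat}.
Implicit Types (D : set 'rV[R]_n) (f : 'rV[R]_n -> R).

Definition partial (i : 'I_n) f : 'rV[R]_n -> R := fun x => 'D_(ebasis i) f x.

Definition grad f (x : 'rV[R]_n) : 'rV[R]_n := \row_i partial i f x.

Definition divergence (F : 'rV[R]_n -> 'rV[R]_n) (x : 'rV[R]_n) : R :=
  \sum_i partial i (fun y => F y 0 i) x.

(* C^k on an open set D, without control up to the boundary. *)
Fixpoint Ck (k : nat) D f : Prop :=
  (forall x, D x -> {for x, continuous f}) /\
  match k with
  | 0 => True
  | k'.+1 => forall i, (forall x, D x -> derivable f x (ebasis i)) /\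
                       Ck k' D (partial i f)
  end.

Definition holder_loc (a : R) D f : Prop :=
  forall r : R, exists C : R, forall x y, D x -> D y ->
    enorm x <= r -> enorm y <= r -> `|f x - f y| <= C * enorm (x - y) `^ a.

(* C^{k,a}_loc of the closure of the open set D, for a function on D: since the
   Hölder bounds hold on all bounded parts of D (and not just on compact
   subsets of D), f and its derivatives up to order k extend uniquely to
   functions that are a-Hölder on the compact subsets of the closure. *)
Fixpoint Cka (k : nat) (a : R) D f : Prop :=
  holder_loc a D f /\
  match k with
  | 0 => True
  | k'.+1 => forall i, (forall x, D x -> derivable f x (ebasis i)) /\
                       Cka k' a D (partial i f)
  end.

(* Value at a boundary point of the continuous extension of F : D -> T. *)
Definition bval {T : ptopologicalType} D (F : 'rV[R]_n -> T) (x : 'rV[R]_n) : T :=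
  lim (F @ within D (nbhs x)).

(* C^{1,a}_loc on the boundary of D: locally the restriction of a C^{1,a}
   function defined on a neighbourhood in R^n. *)
Definition C1a_boundary (a : R) D (g : 'rV[R]_n -> R) : Prop :=
  forall x, boundary D x -> exists (r : R) (G : 'rV[R]_n -> R),
    [/\ 0 < r, Cka 1 a (ball x r) G &
        forall y, boundary D y -> ball x r y -> g y = G y].

End Regularity.

Section Domains.
Context {R : realType} {n : nat}.
Implicit Types (Omega : set 'rV[R]_n) (h : 'rV[R]_n -> R).

(* Near x0, Omega is the strict epigraph, in the direction (-1)^b e_i, of h,
   a function of the other n - 1 coordinates. *)
Definition local_epigraph Omega (x0 : 'rV[R]_n) (i : 'I_n) (b : bool) h : Prop :=
  (forall y (t : R), h (y + t *: ebasis i) = h y) /\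
  (\forall y \near x0, Omega y <-> h y < (-1) ^+ b * y 0 i).

Definition boundary_of_class (P : ('rV[R]_n -> R) -> Prop) Omega : Prop :=
  forall x0, boundary Omega x0 ->
    exists i b h, P h /\ local_epigraph Omega x0 i b h.

Definition smooth_domain (a : R) Omega : Prop :=
  [/\ open Omega, connected Omega, Omega !=set0 &
      boundary_of_class (if n == 2%N then Cka 2 a setT else Ck n setT) Omega].

(* Omega is locally {h - (-1)^b x_i < 0}, so the normalized gradient of this
   defining function is the outer unit normal; it does not depend on the
   choice of the local epigraph. *)
Definition is_outer_normal Omega (x v : 'rV[R]_n) : Prop :=
  exists i b h, [/\ Ck 1 setT h, local_epigraph Omega x i b h &
    let w := grad h x - (-1) ^+ b *: ebasis i in v = (enorm w)^-1 *: w].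

Definition outer_normal Omega (x : 'rV[R]_n) : 'rV[R]_n :=
  xget 0 [set v | is_outer_normal Omega x v].

End Domains.

Section Operators.
Context {R : realType} {n : nat}.
Implicit Types (Omega : set 'rV[R]_n) (u : 'rV[R]_n -> R).

Inductive boundary_condition : Type :=
  | Dirichlet
  | Robin of ('rV[R]_n -> R).

Definition elliptic_op (A : 'rV[R]_n -> 'M[R]_n) (B : 'rV[R]_n -> 'rV[R]_n)
    (c : 'rV[R]_n -> R) u (x : 'rV[R]_n) : R :=
  - divergence (fun y => mxact (A y) (grad u y)) x
  - dot (B x) (grad u x) - c x * u x.

Definition boundary_op Omega (A : 'rV[R]_n -> 'M[R]_n)
    (bc : boundary_condition) u (x : 'rV[R]_n) : R :=
  match bc with
  | Dirichlet => bval Omega u x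
  | Robin gamma =>
      dot (outer_normal Omega x)
          (bval Omega (fun y => mxact (A y) (grad u y)) x)
      + gamma x * bval Omega u x
  end.

Record standing_assumptions (a : R) Omega (A : 'rV[R]_n -> 'M[R]_n)
    (B : 'rV[R]_n -> 'rV[R]_n) (c : 'rV[R]_n -> R)
    (bc : boundary_condition) : Prop := StandingAssumptions {
  sa_exponent : 0 < a < 1;
  sa_domain : smooth_domain a Omega;
  sa_A_reg : forall i j, Cka 1 a Omega (fun x => A x i j);
  sa_A_bnd : [bounded A x | x in Omega];
  sa_A_sym : forall x, Omega x -> (A x)^T = A x;
  sa_A_pos : exists lb : 'rV[R]_n -> R,
    forall x, Omega x -> 0 < lb x /\
      forall v, lb x * dot v v <= dot v (mxact (A x) v);
  sa_B_reg : forall i, Cka 0 a Omega (fun x => B x 0 i);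
  sa_B_bnd : [bounded B x | x in Omega];
  sa_c_reg : Cka 0 a Omega c;
  sa_c_bnd : [bounded c x | x in Omega];
  sa_bc : match bc with
          | Dirichlet => True
          | Robin gamma => C1a_boundary a Omega gamma /\
                           [bounded gamma x | x in boundary Omega]
          end }.

Definition positive_on Omega u : Prop := forall x, Omega x -> 0 < u x.

(* L and Bd are the interior and the boundary operator. *)
Definition supersolution (a : R) Omega
    (L Bd : ('rV[R]_n -> R) -> 'rV[R]_n -> R) u : Prop :=
  [/\ Cka 2 a Omega u, forall x, Omega x -> 0 <= L u x &
      forall x, boundary Omega x -> 0 <= Bd u x].

Definition lambda1 (a : R) Omega
    (L Bd : ('rV[R]_n -> R) -> 'rV[R]_n -> R) : \bar R :=
  ereal_sup [set l%:E | l in [set l : R | exists u,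
    positive_on Omega u /\
    supersolution a Omega (fun v x => L v x - l * v x) Bd u]].

(* The classical solutions of L u = lambda1 u, Bd u = 0; the equation makes
   sense only if lambda1 is finite. *)
Definition lambda1_solution (a : R) Omega
    (L Bd : ('rV[R]_n -> R) -> 'rV[R]_n -> R) u : Prop :=
  exists l : R, [/\ lambda1 a Omega L Bd = l%:E, Cka 2 a Omega u,
    forall x, Omega x -> L u x = l * u x &
    forall x, boundary Omega x -> Bd u x = 0].

Definition principal_eigenfunction (a : R) Omega
    (L Bd : ('rV[R]_n -> R) -> 'rV[R]_n -> R) u : Prop :=
  positive_on Omega u /\ lambda1_solution a Omega L Bd u.

End Operators.

Arguments boundary_condition : clear implicits.

(* Main.v *)
Require Import Defs.
From mathcomp Require Import finmap.
From mathcomp Require Import ring lra.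
Set Implicit Arguments.
Unset Strict Implicit.
Unset Printing Implicit Defensive.
Local Open Scope classical_set_scope.
Local Open Scope ring_scope.

(** The heart of the matter is bounded_solution_proportional: if phi is a
    positive and psi a bounded solution for the same eigenvalue, then psi is a
    multiple of phi. Apply it first to phi and the given bounded eigenfunction
    phi0, which is therefore a multiple of phi. A bounded psi is a multiple
    of phi directly; a positive psi can take the place of phi, so that phi0 is a
    multiple of psi as well, and not by zero.

    Why bounded solutions are proportional. Since A grad eta = - B, the weight
    exp(- eta) puts the operator in divergence form (wflux_divergence). Test the
    equation of psi with zeta^2 psi and that of phi with zeta^2 psi^2 / phi, for
    a cut-off zeta. The zeroth order terms cancel (picone_divergence), and if
    boundary terms could be ignored, with X = grad psi - (psi / phi) grad phi,

      int exp(- eta) zeta^2 (X . A X)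
         <= 4 int exp(- eta) psi^2 (grad zeta . A grad zeta).

    As psi, A and eta are bounded, the right side is at most a constant times
    the Dirichlet energy of zeta, and quadratic volume growth is exactly what
    makes this energy small for logarithmic cut-offs (log_cutoff_energy). Hence
    X = 0, that is, psi / phi has zero gradient on a connected set.

    The boundary needs care, because phi may vanish there and A may degenerate.
    Let rho be a defining function of the domain and p = exp(- K rho). Replace phi
    by u = phi + eps p in the quotient, and multiply zeta^2 by a cut-off that
    vanishes where rho <= d. Its gradient is of size 1/d on a strip of measure
    of order d (strip_bound), so it contributes a quantity of the size of the
    flux of psi A X along grad rho. With s = psi / u this is the sum of s times the
    flux of phi A grad psi - psi A grad phi, which tends to zero at the boundary
    by either boundary condition and whatever the Robin coefficient
    (boundary_flux_vanishes), and of a term in which the steep p absorbs all of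
    the conormal derivative of psi but a fraction of order 1/K
    (picone_boundary_lower). The price is a defect of order eps in the equation
    of u; relative to u it is bounded near the boundary, hence harmless on a
    thin strip, and of order eps elsewhere.

    Integrals are limits of sums over finer and finer grids. The argument only
    uses that such sums are linear and monotone, that they measure boxes up to
    the mesh (gsum_box_le, gsum_box_ge), that those of the divergence
    of a compactly supported C^1 field tend to zero (gsum_divergence), and that
    those of the indicator of a compact set are asymptotically bounded by the
    outer measure (gsum_compact_le). *)

(** * Partial derivatives and functions of class C^k *)
Section DirectionalCalculus.
Context {R : realType} {n : nat}.
Implicit Types (f g : 'rV[R]_n -> R) (x v : 'rV[R]_n) (D : set 'rV[R]_n).

Lemma derive_line f x v :
  'D_v f x = 'D_1 (fun t : R => f (t *: v + x)) 0.
Proof.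
rewrite /derive; set g1 := fun h => h^-1 *: _; set g2 := fun h => h^-1 *: _.
suff -> : g1 = g2 by [].
rewrite /g1 /g2; by rewrite funeqE => h /=; rewrite addr0 scale0r add0r [_%:A]mulr1.
Qed.

Lemma is_derive_lineP f x v d :
  is_derive x v f d <-> is_derive (0 : R) (1 : R) (fun t : R => f (t *: v + x)) d.
Proof.
split=> -[df <-].
  split; first exact: ((derivable1P f x v).1 df).
  exact/esym/derive_line.
split; first exact: ((derivable1P f x v).2 df).
exact: derive_line.
Qed.

Lemma is_derive_compR f (G : R -> R) x v df dg :
  is_derive x v f df -> is_derive (f x) (1 : R) G dg ->
  is_derive x v (fun y => G (f y)) (dg * df).
Proof.
move=> /is_derive_lineP [l1 l2] [g1 g2]; apply/is_derive_lineP.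
pose l := fun t : R => f (t *: v + x).
have l0 : l 0 = f x by rewrite /l scale0r add0r.
have dl : differentiable l 0 by exact: ((derivable1_diffP l 0).1 l1).
have dG : differentiable G (l 0).
  by rewrite l0; exact: ((derivable1_diffP G (f x)).1 g1).
have dGl : differentiable (G \o l) 0 by apply: differentiable_comp.
split; first exact: ((derivable1_diffP (G \o l) 0).2 dGl).
rewrite -[LHS]/('D_1 (G \o l) 0) -derive1E derive1_comp; last 2 first.
- exact: l1.
- by rewrite l0.
by rewrite !derive1E l0 g2 -l2.
Qed.

Lemma is_derive_line_at f x v (t : R) d :
  is_derive (t *: v + x) v f d ->
  is_derive t (1 : R) (fun s : R => f (s *: v + x)) d.
Proof.
move=> /is_derive_lineP h.
have -> : (fun s : R => f (s *: v + x)) =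
    (fun s : R => f (s *: v + (t *: v + x))) \o (fun s : R => s - t).
  by apply/funext => s /=; rewrite addrA -scalerDl subrK.
have h2 : is_derive t (1:R) (fun s : R => s - t) (1 : R).
  exact: is_derive_shift.
have := @is_derive1_comp R (fun s : R => f (s *: v + (t *: v + x))) (fun s : R => s - t) t d 1.
by rewrite subrr mulr1; apply.
Qed.

Lemma partialD i f g x : derivable f x (ebasis i) -> derivable g x (ebasis i) ->
  partial i (fun y => f y + g y) x = partial i f x + partial i g x.
Proof. by move=> df dg; rewrite /partial -deriveD. Qed.

Lemma partialM i f g x : derivable f x (ebasis i) -> derivable g x (ebasis i) ->
  partial i (fun y => f y * g y) x = f x * partial i g x + g x * partial i f x.
Proof.
by move=> df dg; rewrite /partial; have := deriveM df dg; rewrite /GRing.scale.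
Qed.

Lemma partial_comp i f (G : R -> R) x dg : derivable f x (ebasis i) ->
  is_derive (f x) (1 : R) G dg ->
  derivable (fun y => G (f y)) x (ebasis i) /\
  partial i (fun y => G (f y)) x = dg * partial i f x.
Proof.
move=> df dG; have [h1 h2] := is_derive_compR (derivableP df) dG.
by split.
Qed.

Lemma near_open D x : open D -> D x -> \forall y \near x, D y.
Proof. by move=> oD Dx; apply: open_nbhs_nbhs. Qed.

Lemma continuous_eq_near f g x : (\forall y \near x, f y = g y) ->
  {for x, continuous f} -> {for x, continuous g}.
Proof.
move=> fg cf; suff : g @ x --> g x by [].
have {}cf : f @ x --> f x by [].
rewrite -(nbhs_singleton fg : f x = g x); apply: cvg_trans cf.
exact: near_eq_cvg fg.
Qed.

Lemma Ck_eq k D f g : open D -> (forall x, D x -> f x = g x) ->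
  Ck k D f -> Ck k D g.
Proof.
move=> oD; elim: k f g => [|k IH] f g fg.
  move=> [cf _]; split => // x Dx; apply: continuous_eq_near (cf x Dx).
  by near=> y; apply: fg; near: y; exact: near_open.
move=> [cf df]; split => [x Dx|i].
  apply: continuous_eq_near (cf x Dx).
  by near=> y; apply: fg; near: y; exact: near_open.
have [d1 d2] := df i; split=> [x Dx|].
  apply: near_eq_derivable (d1 x Dx).
  by near=> y; apply: fg; near: y; exact: near_open.
apply: IH d2 => x Dx; apply: near_eq_derive.
by near=> y; apply: fg; near: y; exact: near_open.
Unshelve. all: by end_near. Qed.

Lemma Ck_pred k D f : Ck k.+1 D f -> Ck k D f.
Proof.
elim: k f => [|k IH] f [cf df]; first by split.
by split => // i; have [d1 d2] := df i; split => //; exact: IH.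
Qed.

Lemma Ck_le k l D f : (k <= l)%N -> Ck l D f -> Ck k D f.
Proof.
move=> /subnK <-; elim: (l - k)%N => // m IH; rewrite addSn => /Ck_pred.
exact: IH.
Qed.

Lemma Ck_continuous k D f x : Ck k D f -> D x -> {for x, continuous f}.
Proof. by case: k => [|k] [cf _]; exact: cf. Qed.

Lemma Ck_derivable k D f x i : Ck k.+1 D f -> D x -> derivable f x (ebasis i).
Proof. by move=> [_ /(_ i)[+ _]]; apply. Qed.
Arguments Ck_derivable {k D f x} i _ _.

Lemma Ck_partial k D f i : Ck k.+1 D f -> Ck k D (partial i f).
Proof. by move=> [_ /(_ i)[]]. Qed.
Arguments Ck_partial {k D f} i _.

Lemma Ck_sub k D D' f : D' `<=` D -> Ck k D f -> Ck k D' f.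
Proof.
move=> sD; elim: k f => [|k IH] f [cf df].
  by split => // x /sD; exact: cf.
split => [x /sD|i]; first exact: cf.
have [d1 d2] := df i; split=> [x /sD|]; [exact: d1|exact: IH].
Qed.

Lemma Ck_cst k D (a : R) : Ck k D (fun=> a).
Proof.
elim: k a => [|k IH] a; first by split => // x _; exact: cst_continuous.
split=> [x _|i]; first exact: cst_continuous.
split=> [x _|]; first exact: derivable_cst.
rewrite (_ : partial i _ = fun=> 0) //.
by apply/funext => x; rewrite /partial; exact: derive_cst.
Qed.

Lemma Ck_add k D f g : open D -> Ck k D f -> Ck k D g ->
  Ck k D (fun x => f x + g x).
Proof.
move=> oD; elim: k f g => [|k IH] f g [cf df] [cg dg].
  by split => // x Dx; apply: continuousD; [exact: cf|exact: cg].
split=> [x Dx|i]; first by apply: continuousD; [exact: cf|exact: cg].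
have [f1 f2] := df i; have [g1 g2] := dg i.
split=> [x Dx|]; first by apply: derivableD; [exact: f1|exact: g1].
apply: Ck_eq oD _ (IH _ _ f2 g2) => x Dx.
by rewrite partialD; [|exact: f1|exact: g1].
Qed.

Lemma Ck_mul k D f g : open D -> Ck k D f -> Ck k D g ->
  Ck k D (fun x => f x * g x).
Proof.
move=> oD; elim: k f g => [|k IH] f g Cf Cg.
  split => // x Dx; apply: continuousM.
    exact: Ck_continuous Cf Dx.
  exact: Ck_continuous Cg Dx.
split=> [x Dx|i].
  apply: continuousM; first exact: Ck_continuous Cf Dx.
  exact: Ck_continuous Cg Dx.
have f1 x (Dx : D x) := Ck_derivable i Cf Dx.
have g1 x (Dx : D x) := Ck_derivable i Cg Dx.
split=> [x Dx|]; first by apply: derivableM; [exact: f1|exact: g1].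
have H := Ck_add oD (IH _ _ (Ck_pred Cf) (Ck_partial i Cg))
  (IH _ _ (Ck_pred Cg) (Ck_partial i Cf)).
apply: Ck_eq oD _ H => x Dx.
by rewrite partialM; [|exact: f1|exact: g1].
Qed.

Lemma Ck_scale k D f (a : R) : open D -> Ck k D f -> Ck k D (fun x => a * f x).
Proof. by move=> oD; apply: Ck_mul => //; exact: Ck_cst. Qed.

Lemma Ck_opp k D f : open D -> Ck k D f -> Ck k D (fun x => - f x).
Proof.
move=> oD Cf; apply: Ck_eq oD _ (Ck_scale (-1) oD Cf) => x _.
by rewrite mulN1r.
Qed.

Lemma Ck_sub_fun k D f g : open D -> Ck k D f -> Ck k D g ->
  Ck k D (fun x => f x - g x).
Proof. by move=> oD Cf Cg; apply: Ck_add => //; exact: Ck_opp. Qed.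

Lemma Ck_sum k D (I : Type) (r : seq I) (F : I -> 'rV[R]_n -> R) : open D ->
  (forall i, Ck k D (F i)) -> Ck k D (fun x => \sum_(i <- r) F i x).
Proof.
move=> oD CF; elim: r => [|i r IH].
  by apply: (Ck_eq oD _ (Ck_cst k D 0)) => x _; rewrite big_nil.
apply: (Ck_eq oD _ (Ck_add oD (CF i) IH)) => x _.
by rewrite big_cons.
Qed.

(** The successive derivatives of the outer function are given as a sequence,
    so that one induction serves exponentials, logarithms and piecewise
    polynomials alike. *)
Lemma Ck_comp k D f (G : nat -> R -> R) : open D ->
  (forall j x, D x -> (j < k)%N -> is_derive (f x) (1 : R) (G j) (G j.+1 (f x))) ->
  (forall j x, D x -> (j <= k)%N -> {for f x, continuous (G j)}) ->
  Ck k D f -> Ck k D (fun x => G 0 (f x)).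
Proof.
move=> oD; elim: k G => [|k IH] G dG cG Cf.
  split => // x Dx; apply: continuous_comp.
    exact: Ck_continuous Cf Dx.
  exact: cG.
split=> [x Dx|i].
  apply: continuous_comp; first exact: Ck_continuous Cf Dx.
  exact: cG.
have H x (Dx : D x) := partial_comp (Ck_derivable i Cf Dx) (dG 0 x Dx (ltn0Sn _)).
split=> [x Dx|]; first by case: (H x Dx).
have C1 : Ck k D (fun x => G 1 (f x)).
  apply: (IH (fun j => G j.+1)).
  - by move=> j x Dx jk; apply: dG.
  - by move=> j x Dx jk; apply: cG.
  - exact: Ck_pred.
apply: Ck_eq oD _ (Ck_mul oD C1 (Ck_partial i Cf)) => x Dx.
by case: (H x Dx) => _ ->.
Qed.

Lemma is_derive_coord j x v : is_derive x v (fun y => y 0 j) (v 0 j).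
Proof.
apply/is_derive_lineP.
rewrite (_ : (fun t : R => _) = (v 0 j \*: (id : R -> R)) + cst (x 0 j)).
  apply: is_derive_eq.
  by rewrite addr0 /GRing.scale /= mulr1.
by apply/funext => t; rewrite !mxE /= mulrC.
Qed.

Lemma partial_coord i j x : partial i (fun y => y 0 j) x = (i == j)%:R.
Proof.
have [_] := is_derive_coord j x (ebasis i); rewrite /partial => ->.
by rewrite /ebasis mxE eqxx eq_sym.
Qed.

Lemma Ck_coord k D j : Ck k D (fun x => x 0 j).
Proof.
have cc x : D x -> {for x, continuous (fun y : 'rV[R]_n => y 0 j)}.
  by move=> _; exact: coord_continuous.
case: k => [|k]; first by split.
split=> // i; split=> [x _|]; first by case: (is_derive_coord j x (ebasis i)).
rewrite (_ : partial i _ = fun=> (i == j)%:R); first exact: Ck_cst.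
by apply/funext => x; exact: partial_coord.
Qed.

End DirectionalCalculus.
Arguments Ck_derivable {R n k D f x} i _ _.
Arguments Ck_partial {R n k D f} i _.
#[global] Arguments Ck {R n} k D f : simpl never.

(** * Mean value estimates *)
Section TotalDerivative.
Context {R : realType} {n : nat}.
Implicit Types (f g : 'rV[R]_n -> R) (x v w : 'rV[R]_n) (D : set 'rV[R]_n).

Lemma normv_le w (M : R) : 0 <= M ->
  (forall i, `|w 0 i| <= M) -> `|w| <= M.
Proof.
move=> M0 H; rewrite /Num.norm /= mx_normrE; apply/bigmax_leP; split=> // -[i j] _.
by rewrite [i]ord1; exact: H.
Qed.

Lemma entry_le_norm w i : `|w 0 i| <= `|w|.
Proof.
rewrite [leRHS]/Num.norm /= mx_normrE.
by apply/bigmax_geP; right => /=; exists (0, i).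
Qed.

Lemma norm_ebasis (i : 'I_n) : `|ebasis i : 'rV[R]_n| <= 1.
Proof.
apply: normv_le => // j; rewrite /ebasis mxE.
by case: (_ && _); rewrite ?normr1 ?normr0.
Qed.

Lemma near_forall_ord m (P : 'I_m -> 'rV[R]_n -> Prop) x :
  (forall i, \forall y \near x, P i y) -> \forall y \near x, forall i, P i y.
Proof. by move=> H; exact: (@filter_forall _ _ P (nbhs x) _ H). Qed.

Lemma MVT_dir_pos f x v (h : R) : 0 <= h ->
  (forall t, 0 <= t <= h -> derivable f (t *: v + x) v) ->
  exists t, 0 <= t <= h /\ f (h *: v + x) - f x = h * 'D_v f (t *: v + x).
Proof.
move=> h0 df.
pose l := fun t : R => f (t *: v + x).
have dl t : 0 <= t <= h -> is_derive t (1 : R) l ('D_v f (t *: v + x)).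
  by move=> /df dft; apply: is_derive_line_at; exact: derivableP.
have [||t ht] := @MVT_segment R l (fun t => 'D_v f (t *: v + x)) 0 h h0.
- by move=> t; rewrite in_itv /= => /andP[t0 th]; apply: dl; rewrite !ltW.
- apply: derivable_within_continuous => t; rewrite in_itv /= => ht.
  by case: (dl t ht).
rewrite /l scale0r add0r subr0 mulrC => E.
by exists t; split => //; move: ht; rewrite in_itv.
Qed.

Lemma MVT_dir f x v (h : R) :
  (forall t, `|t| <= `|h| -> derivable f (t *: v + x) v) ->
  exists t, `|t| <= `|h| /\ f (h *: v + x) - f x = h * 'D_v f (t *: v + x).
Proof.
move=> df; have [h0|h0] := lerP 0 h.
  have [t /andP[t0 th]|t [/andP[t0 th] E]] := @MVT_dir_pos f x v h h0.
    by apply: df; rewrite !ger0_norm.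
  by exists t; rewrite !ger0_norm.
have hN : 0 <= - h by lra.
have [t /andP[t0 th]|t [/andP[t0 th] E]] := @MVT_dir_pos f (h *: v + x) v (- h) hN.
  by rewrite addrA -scalerDl; apply: df; rewrite ler0_norm ?ler0_norm; lra.
exists (t + h); split; first by rewrite ler0_norm ?ler0_norm; lra.
move: E; rewrite !addrA -!scalerDl addNr scale0r add0r => E.
by rewrite -opprB E mulNr opprK.
Qed.

(** Changing the coordinates one at a time reduces a variation of f to its
    partial derivatives, all taken inside one ball of the max norm. *)
Lemma coordinate_increments f x (a : 'I_n -> R) (d e : R) :
  (forall y i, `|y - x| < d -> derivable f y (ebasis i)) ->
  (forall y i, `|y - x| < d -> `|partial i f y - a i| <= e) ->
  forall w, `|w| < d ->
  `|f (x + w) - f x - \sum_i a i * w 0 i| <= n%:R * e * `|w|.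
Proof.
move=> df H w wd.
have [->|w0] := eqVneq w 0.
  rewrite addr0 subrr normr0 mulr0 big1 ?subrr ?normr0 // => i _.
  by rewrite mxE mulr0.
pose tr (k : nat) : 'rV[R]_n := \row_j (if (j < k)%N then w 0 j else 0).
have trw k : `|tr k| <= `|w|.
  apply: normv_le => // i; rewrite mxE; case: ifP => _; last by rewrite normr0.
  exact: entry_le_norm.
suff K k : (k <= n)%N ->
  `|f (x + tr k) - f x - \sum_(i < n | (i < k)%N) a i * w 0 i| <= k%:R * e * `|w|.
  have := K n (leqnn n).
  have -> : tr n = w by apply/rowP => j; rewrite mxE ltn_ord.
  by rewrite (eq_bigl predT) // => i; rewrite ltn_ord.
elim: k => [|k IH] kn.
  have -> : tr 0 = 0 by apply/rowP => j; rewrite !mxE ltn0.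
  by rewrite addr0 subrr !mul0r big_pred0 ?subrr ?normr0 // => i; rewrite ltn0.
pose K := Ordinal kn.
have trS : tr k.+1 = w 0 K *: ebasis K + tr k.
  apply/rowP => j; rewrite !mxE ltnS leq_eqVlt eqxx /=.
  have -> : (j == K) = (j == k :> nat) by [].
  case: (eqVneq (j : nat) k) => [jk|jk] /=.
    rewrite jk ltnn addr0 mulr1; congr (w 0 _); exact: val_inj.
  by rewrite mulr0 add0r.
have inb t : `|t| <= `|w 0 K| -> `|t *: ebasis K + (x + tr k) - x| < d.
  move=> tw; rewrite (addrC x) addrA addrK.
  apply: le_lt_trans wd; apply: normv_le => // j; rewrite !mxE.
  have -> : (j == K) = (j == k :> nat) by [].
  case: (eqVneq (j : nat) k) => [jk|jk] /=.
    rewrite jk ltnn addr0 mulr1; apply: le_trans tw _; exact: entry_le_norm.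
  rewrite mulr0 add0r; case: ifP => _; last by rewrite normr0.
  exact: entry_le_norm.
have [t /inb /df //|t [tw E]] := @MVT_dir f (x + tr k) (ebasis K) (w 0 K).
have -> : \sum_(i < n | (i < k.+1)%N) a i * w 0 i =
    a K * w 0 K + \sum_(i < n | (i < k)%N) a i * w 0 i.
  rewrite (bigD1 K) /=; last by rewrite ltnS.
  congr (_ + _); apply: eq_bigl => i.
  rewrite ltnS leq_eqVlt.
  have -> : (i == K) = (i == k :> nat) by [].
  by case: eqVneq => //= [->|_]; rewrite ?ltnn ?andbT ?andbF.
have E2 : f (x + tr k.+1) = f (x + tr k) +
    w 0 K * 'D_(ebasis K) f (t *: ebasis K + (x + tr k)).
  by rewrite -E trS addrCA [RHS]addrC subrK.
rewrite E2.
set A := f (x + tr k) in IH *; set S := \sum_(i < n | (i < k)%N) _ in IH *.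
set P := 'D_ _ _ _.
have -> : A + w 0 K * P - f x - (a K * w 0 K + S) =
   (A - f x - S) + w 0 K * (P - a K) by ring.
apply: le_trans (ler_normD _ _) _.
rewrite -natr1 !mulrDl mul1r; apply: lerD; first exact: IH (ltnW kn).
rewrite normrM mulrC; apply: ler_pM => //; last exact: entry_le_norm.
by apply: H; exact: inb.
Qed.

Lemma ball_rowP x y (d : R) : ball x d y <-> `|y - x| < d.
Proof. by rewrite -ball_normE /ball_ /= distrC. Qed.

(** Near x the partial derivatives stay close to their values at x, so the
    mean value theorem along coordinate paths controls the remainder. *)
Lemma C1_expansion D f x (e : R) : open D -> Ck 1 D f -> D x -> 0 < e ->
  exists2 d : R, 0 < d & forall w, `|w| < d ->
    `|f (x + w) - f x - dot (grad f x) w| <= e * `|w|.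
Proof.
move=> oD Cf Dx e0.
have e'0 : 0 < e / n.+1%:R by rewrite divr_gt0.
have : \forall y \near x, D y /\ forall i, `|partial i f y - partial i f x| <= e / n.+1%:R.
  apply: filterS2 (near_open oD Dx) _; first by move=> y Dy H; split; [|exact: H].
  apply: near_forall_ord => i.
  have := Ck_continuous (Ck_partial i Cf) Dx.
  move=> /cvgrPdist_le /(_ _ e'0); apply: filterS => y /=.
  by rewrite distrC.
move=> /nbhs_ballP[d /= d0 H]; exists d => // w wd.
have := @coordinate_increments f x (fun i => partial i f x) d (e / n.+1%:R) _ _ w wd.
set S := \sum_i _; have -> : S = dot (grad f x) w.
  by apply: eq_bigr => i _; rewrite mxE.
have Hy y : `|y - x| < d -> ball x d y by move=> /ball_rowP.
move=> /(_ _ _)/le_trans; apply.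
- by move=> y i /Hy/H[Dy _]; exact: (Ck_derivable i Cf Dy).
- by move=> y i /Hy/H[_]; exact.
- apply: ler_wpM2r => //.
  rewrite mulrC -mulrA ler_piMr ?ltW //.
  rewrite mulrC ltr_pdivrMr ?mul1r ?ltr_nat //.
Qed.

(** A vanishing gradient makes f locally constant, and its level sets in D
    are then both open and closed in D. *)
Lemma connected_constant D f : open D -> connected D -> Ck 1 D f ->
  (forall x i, D x -> partial i f x = 0) ->
  forall x y, D x -> D y -> f x = f y.
Proof.
move=> oD cD Cf f0 x y Dx Dy.
have loc z : D z -> \forall w \near z, D w /\ f w = f z.
  move=> Dz; have /nbhs_ballP[d /= d0 H] := near_open oD Dz.
  apply/nbhs_ballP; exists d => // w wd; split; first exact: H.
  have Hy u : `|u - z| < d -> D u by move=> /ball_rowP /H.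
  have K : `|f (z + (w - z)) - f z - \sum_i 0 * (w - z) 0 i| <= n%:R * 0 * `|w - z|.
    apply: (coordinate_increments (a := fun=> 0) (d := d)).
    - by move=> u i /Hy Du; exact: (Ck_derivable i Cf Du).
    - by move=> u i /Hy Du; rewrite f0 // subr0 normr0.
    - exact/ball_rowP.
  move: K; rewrite [z + _]addrC subrK mulr0 mul0r normr_le0.
  rewrite big1 => [|i _]; last by rewrite mul0r.
  by rewrite subr0 subr_eq0 => /eqP.
pose B := D `&` [set z | f z = f x].
suff BD : B = D by have [_ ->] : B y by rewrite BD.
apply: cD.
- by exists x.
- exists B; last by rewrite /B setIA setIid.
  rewrite openE => z [Dz fz]; apply: filterS (loc z Dz) => w [Dw fw].
  by split => //=; rewrite fw.
- exists (~` (D `&` [set z | f z <> f x])).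
    apply: open_closedC; rewrite openE => z [Dz fz].
    apply: filterS (loc z Dz) => w [Dw fw].
    by split => //=; rewrite fw.
  apply/seteqP; split=> z [Dz fz]; split => //.
    by move=> [_]; exact.
  by apply: contrapT => h; apply: fz.
Qed.

End TotalDerivative.

(** * A smooth step on the line *)
Section Cutoffs.
Context {R : realType}.
Implicit Types (s t u : R).

Definition pospart t : R := (t + `|t|) / 2.

Lemma pospart_ge0E t : 0 <= t -> pospart t = t.
Proof. by move=> t0; rewrite /pospart ger0_norm //; lra. Qed.

Lemma pospart_le0E t : t <= 0 -> pospart t = 0.
Proof. by move=> t0; rewrite /pospart ler0_norm //; lra. Qed.

Lemma pospart_ge0 t : 0 <= pospart t.
Proof.
by have [t0|t0] := lerP 0 t; [rewrite pospart_ge0E|rewrite pospart_le0E // ltW].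
Qed.

Lemma continuous_idR t : {for t, continuous (fun s : R => s)}.
Proof. by move=> A. Qed.

Lemma continuous_pospart : continuous pospart.
Proof.
move=> t; rewrite /pospart; apply: (@continuousM _ _ (fun t : R => t + `|t|) (cst 2^-1)).
  by apply: continuousD; [exact: continuous_idR | exact: norm_continuous].
exact: cst_continuous.
Qed.

Lemma continuous_pospartX k : continuous (fun t => pospart t ^+ k).
Proof.
move=> t; apply: (@continuous_comp _ _ _ pospart (fun t => t ^+ k)).
  exact: continuous_pospart.
exact: exprn_continuous.
Qed.

Lemma is_derive_pospartX k t :
  is_derive t (1 : R) (fun s => pospart s ^+ k.+2) (k.+2%:R * pospart t ^+ k.+1).
Proof.
have [t0|t0|->] := ltgtP t 0.
- rewrite (pospart_le0E (ltW t0)) expr0n mulr0.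
  apply: (@near_eq_is_derive _ _ _ (cst 0)).
  near=> s; rewrite pospart_le0E ?expr0n //; near: s.
  apply: filterS (lt_nbhsl t0); by move=> s /ltW.
- rewrite (pospart_ge0E (ltW t0)).
  apply: (@near_eq_is_derive _ _ _ (fun s => s ^+ k.+2)).
    near=> s; rewrite pospart_ge0E //; near: s.
    apply: filterS (lt_nbhsr t0); by move=> s /ltW.
  have -> : (fun s : R => s ^+ k.+2) = (id : R -> R) ^+ k.+2.
    by apply/funext => s; rewrite exprfctE.
  by apply: is_derive_eq; rewrite /GRing.scale /= mulr1.
- rewrite (pospart_ge0E (lexx 0)) expr0n mulr0.
  have H : (fun h : R => h^-1 *: (((fun s => pospart s ^+ k.+2) \o shift 0) (h *: 1) -
      pospart 0 ^+ k.+2)) @ 0^' --> (0 : R).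
    have c0 : (fun h : R => pospart h ^+ k.+1) @ 0^' --> (0 : R).
      have := (continuous_withinNx _ _).1 (@continuous_pospartX k.+1 0).
      by rewrite (pospart_ge0E (lexx 0)) expr0n.
    apply: cvg_trans c0.
    apply: near_eq_cvg; near=> h => /=.
    rewrite addr0 [_ *: 1]mulr1 (pospart_ge0E (lexx 0)) expr0n subr0.
    have h0 : h != 0 by near: h; exact: nbhs_dnbhs_neq.
    have [hp|hn] := lerP 0 h.
      by rewrite pospart_ge0E // [h ^+ k.+2]exprS /GRing.scale /= mulKf.
    by rewrite pospart_le0E ?ltW // !expr0n scaler0.
  split; last exact: cvg_lim H.
  by apply/cvg_ex; exists 0.
Unshelve. all: by end_near. Qed.

(** The twofold primitive of 4 on the first half of [0, 1] and -4 on the second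
    half: a step from 0 to 1 with explicit bounds on the slope. *)
Definition step t : R :=
  2 * (pospart t ^+ 2 - 2 * pospart (t - 1 / 2) ^+ 2 + pospart (t - 1) ^+ 2).

Definition dstep t : R :=
  4 * (pospart t - 2 * pospart (t - 1 / 2) + pospart (t - 1)).

Lemma is_derive_step t : is_derive t (1 : R) step (dstep t).
Proof.
have sh a : is_derive t (1 : R) (fun s => pospart (s - a) ^+ 2) (2 * pospart (t - a)).
  have := @is_derive1_comp R (fun s => pospart s ^+ 2) (shift (- a)) t
    (2 * pospart (t - a)) 1.
  rewrite mulr1; apply.
    by have := is_derive_pospartX 0 (t - a); rewrite expr1.
  exact: is_derive_shift.
have h0 := sh 0; rewrite subr0 in h0.
have h1 := sh (1 / 2); have h2 := sh 1.
pose F0 := fun s => pospart (s - 0) ^+ 2.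
pose F1 := fun s => pospart (s - 1 / 2) ^+ 2.
pose F2 := fun s => pospart (s - 1) ^+ 2.
have -> : step = 2 \*: (F0 - 2 \*: F1 + F2).
  by apply/funext => s; rewrite /step -[X in pospart X](subr0 s).
apply: is_derive_eq.
by rewrite /dstep /GRing.scale /=; ring.
Qed.

Lemma step_le0 t : t <= 0 -> step t = 0.
Proof.
move=> t0; rewrite /step !pospart_le0E; try lra.
Qed.

Lemma step_ge1 t : 1 <= t -> step t = 1.
Proof.
move=> t0; rewrite /step !pospart_ge0E; try lra.
Qed.

Lemma step_itv t : 0 <= step t <= 1.
Proof.
have [t0|t0] := lerP t 0; first by rewrite step_le0 // lexx ler01.
have [t1|t1] := lerP 1 t; first by rewrite step_ge1 // ler01 lexx.
rewrite /step (pospart_ge0E (ltW t0)) (@pospart_le0E (t - 1)); last lra.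
have [t2|t2] := lerP t (1 / 2).
  rewrite pospart_le0E; last lra.
  by apply/andP; split; nra.
rewrite pospart_ge0E; last lra.
by apply/andP; split; nra.
Qed.

Lemma dstep_le0 t : t <= 0 -> dstep t = 0.
Proof.
move=> t0; rewrite /dstep !pospart_le0E; lra.
Qed.

Lemma dstep_ge1 t : 1 <= t -> dstep t = 0.
Proof.
move=> t0; rewrite /dstep !pospart_ge0E; lra.
Qed.

Lemma dstep_itv t : 0 <= dstep t <= 2.
Proof.
have [t0|t0] := lerP t 0; first by rewrite dstep_le0 // lexx ler0n.
have [t1|t1] := lerP 1 t; first by rewrite dstep_ge1 // ler0n lexx.
rewrite /dstep (pospart_ge0E (ltW t0)) (@pospart_le0E (t - 1)); last lra.
have [t2|t2] := lerP t (1 / 2).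
  by rewrite pospart_le0E; last lra; apply/andP; split; lra.
by rewrite pospart_ge0E; last lra; apply/andP; split; lra.
Qed.

Lemma dstep_third t : 1 / 3 <= t <= 1 / 2 -> 1 <= dstep t.
Proof.
move=> /andP[t0 t1]; rewrite /dstep pospart_ge0E ?pospart_le0E; lra.
Qed.

Lemma continuous_dstep : continuous dstep.
Proof.
have sh a : continuous (fun t => pospart (t - a)).
  move=> t; apply: (@continuous_comp _ _ _ (fun s => s - a) pospart).
    by apply: continuousD; [exact: continuous_idR|exact: cst_continuous].
  exact: continuous_pospart.
move=> t; rewrite /dstep.
apply: (@continuousM _ _ (cst (4 : R))
  (fun t => pospart t - 2 * pospart (t - 1 / 2) + pospart (t - 1))).
  exact: cst_continuous.
apply: continuousD; last exact: sh.
apply: continuousB; first exact: continuous_pospart.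
apply: (@continuousM _ _ (cst (2 : R)) (fun t => pospart (t - 1 / 2))).
  exact: cst_continuous.
exact: sh.
Qed.

Lemma continuous_step : continuous step.
Proof.
move=> t; have [dt _] := is_derive_step t.
exact: differentiable_continuous ((derivable1_diffP _ _).1 dt).
Qed.

End Cutoffs.

(** * Riemann sums over cubic grids *)
Section GridSums.
Context {R : realType} {n : nat}.
Implicit Types (f g : 'rV[R]_n -> R) (x v w a b : 'rV[R]_n) (D E K : set 'rV[R]_n).
Implicit Types (m : nat).

(** gsum m f is the Riemann sum of f over the grid of mesh 1/(m+1) in the cube
    of half-side m+1. These sums stand for integrals: they are linear and
    monotone for arbitrary functions, so no measurability is ever at stake. *)
Definition gstep m : R := m.+1%:R^-1.
Definition gsize m : nat := (2 * (m.+1 * m.+1))%N.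
Definition gcoord m (j : nat) : R := gstep m * j%:R - m.+1%:R.
Definition gpt m (k : {ffun 'I_n -> 'I_(gsize m)}) : 'rV[R]_n :=
  \row_i gcoord m (k i).
Definition gsum m f : R := gstep m ^+ n * \sum_k f (@gpt m k).

Lemma gstep_gt0 m : 0 < gstep m.
Proof. by rewrite invr_gt0. Qed.

Lemma gstep_le1 m : gstep m <= 1.
Proof. by rewrite invf_le1 ?ler1n. Qed.

Lemma near_gstep (e : R) : 0 < e -> \forall m \near \oo, gstep m < e.
Proof. by move=> e0; have /cvgrPdist_lt /(_ e e0) := @cvg_harmonic R;
  apply: filterS => m; rewrite sub0r normrN gtr0_norm ?gstep_gt0. Qed.

Lemma near_gbound (M : R) : \forall m \near \oo, M < m.+1%:R.
Proof.
near=> m; apply: (@lt_le_trans _ _ m%:R); last by rewrite ler_nat.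
near: m; exact: nbhs_infty_gtr.
Unshelve. all: by end_near. Qed.

Lemma gsumD m f g : gsum m (fun x => f x + g x) = gsum m f + gsum m g.
Proof. by rewrite /gsum big_split /= mulrDr. Qed.

Lemma gsumZ m (a : R) f : gsum m (fun x => a * f x) = a * gsum m f.
Proof. by rewrite /gsum -mulr_sumr mulrCA. Qed.

Lemma gsum_sum m (I : Type) (r : seq I) (F : I -> 'rV[R]_n -> R) :
  gsum m (fun x => \sum_(i <- r) F i x) = \sum_(i <- r) gsum m (F i).
Proof. by rewrite /gsum exchange_big /= mulr_sumr. Qed.

Lemma ler_gsum m f g : (forall x, f x <= g x) -> gsum m f <= gsum m g.
Proof.
move=> fg; apply: ler_wpM2l; first by rewrite exprn_ge0 // ltW // gstep_gt0.
exact: ler_sum.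
Qed.

Definition gcount m (s t : R) : R :=
  gstep m * \sum_(j < gsize m) (s <= gcoord m j < t)%R%:R.

Let clamp (s t u : R) : R := Num.max s (Num.min u t).

Let clampE s t u : s <= t ->
  clamp s t u = if u <= s then s else if t <= u then t else u.
Proof.
move=> st; rewrite /clamp /Num.min /Num.max.
by case: (ltrP u t) => ?; case: (ltrP s u) => ?; case: (ltrP s t) => ?; lra.
Qed.

Let gcoordS m j : gcoord m j.+1 = gcoord m j + gstep m.
Proof. by rewrite /gcoord -natr1 mulrDr mulr1; ring. Qed.

Let gcoord0 m : gcoord m 0 = - m.+1%:R.
Proof. by rewrite /gcoord mulr0 add0r. Qed.

Let gcoord_size m : gcoord m (gsize m) = m.+1%:R.
Proof.
rewrite /gcoord /gsize /gstep !natrM mulrCA mulKf ?pnatr_eq0 //.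
by rewrite mulr_natl mulr2n addrK.
Qed.

Let clamp_itv s t u : s <= t -> s <= clamp s t u <= t.
Proof.
move=> st; rewrite clampE //.
by case: (lerP u s) => ?; [|case: (lerP t u) => ?]; apply/andP; split; lra.
Qed.

Let clamp_incr s t u h : s <= t -> 0 <= h ->
  0 <= clamp s t (u + h) - clamp s t u <= h.
Proof.
move=> st h0; rewrite !clampE //.
case: (lerP u s) => ?; case: (lerP (u + h) s) => ?;
  try (case: (lerP t u) => ?); try (case: (lerP t (u + h)) => ?);
  apply/andP; split; lra.
Qed.

(** On each cell the indicator of [s, t) is compared with the increment of the
    projection onto an interval; these increments telescope. *)
Lemma gcount_le m (s t : R) : s <= t -> gcount m s t <= t - s + gstep m.
Proof.
move=> st; have h0 := gstep_gt0 m.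
have sth : s <= t + gstep m by lra.
have E : \sum_(0 <= j < gsize m) (clamp s (t + gstep m) (gcoord m j.+1) -
    clamp s (t + gstep m) (gcoord m j)) <= t - s + gstep m.
  rewrite (telescope_sumr (fun j => clamp s (t + gstep m) (gcoord m j))) //.
  have /andP[_ ?] := clamp_itv (gcoord m (gsize m)) sth.
  have /andP[? _] := clamp_itv (gcoord m 0) sth.
  lra.
apply: le_trans E; rewrite /gcount big_mkord mulr_sumr; apply: ler_sum => j _.
rewrite gcoordS; set u := gcoord m j.
have /andP[? _] := clamp_incr u sth (ltW h0).
case: (boolP (s <= u < t)) => [/andP[su ut]|_]; last by rewrite mulr0.
rewrite mulr1 !clampE // (_ : (t + gstep m <= u) = false); last by apply/negbTE; rewrite -ltNge; lra.
rewrite (_ : (u + gstep m <= s) = false); last by apply/negbTE; rewrite -ltNge; lra.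
by case: (lerP u s) => ?; case: (lerP (t + gstep m) (u + gstep m)) => ?; lra.
Qed.

Lemma gcount_ge m (s t : R) : - m.+1%:R <= s -> t <= m.+1%:R ->
  t - s - gstep m <= gcount m s t.
Proof.
move=> sm tm; have h0 := gstep_gt0 m.
have [ts|ts] := lerP t (s + gstep m).
  have : 0 <= gcount m s t by rewrite /gcount mulr_ge0 ?sumr_ge0 // ltW.
  lra.
have E : \sum_(0 <= j < gsize m) (clamp (s + gstep m) t (gcoord m j.+1) -
    clamp (s + gstep m) t (gcoord m j)) = t - s - gstep m.
  rewrite (telescope_sumr (fun j => clamp (s + gstep m) t (gcoord m j))) //.
  rewrite gcoord0 gcoord_size (clampE _ (ltW ts)).
  rewrite (clampE _ (ltW ts)) tm (_ : - m.+1%:R <= s + gstep m); last by lra.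
  by case: (lerP m.+1%:R (s + gstep m)) => ?; lra.
rewrite -E /gcount big_mkord mulr_sumr; apply: ler_sum => j _.
rewrite gcoordS; set u := gcoord m j.
have /andP[_ ?] := clamp_incr u (ltW ts) (ltW h0).
case: (lerP s u) => su; case: (ltrP u t) => ut; rewrite /= ?mulr1 ?mulr0 //.
- rewrite !(clampE _ (ltW ts)) ut (_ : t <= u + gstep m); last by lra.
  by case: (lerP u (s + gstep m)) => ?; case: (lerP (u + gstep m) (s + gstep m)) => ?; lra.
- rewrite !(clampE _ (ltW ts)) (_ : u <= s + gstep m); last by lra.
  by rewrite (_ : u + gstep m <= s + gstep m); lra.
- by lra.
Qed.

Lemma gsum_box m a b :
  gsum m \1_(box a b) = \prod_i gcount m (a 0 i) (b 0 i).
Proof.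
have E x : \1_(box a b) x = \prod_i (a 0 i <= x 0 i < b 0 i)%R%:R :> R.
  rewrite indicE; case: (boolP (x \in box a b)) => [/set_mem H|].
    by rewrite big1 // => i _; rewrite H.
  rewrite notin_setE => /existsNP[i Hi].
  rewrite (bigD1 i) //=; move/negP/negbTE: Hi => ->; by rewrite mul0r.
rewrite /gsum (eq_bigr _ (fun k _ => E (gpt k))).
rewrite big_split /= prodr_const card_ord; congr (_ * _).
rewrite (bigA_distr_bigA (fun i (j : 'I_(gsize m)) => (a 0 i <= gcoord m j < b 0 i)%R%:R)).
by apply: eq_bigr => k _; apply: eq_bigr => i _; rewrite mxE.
Qed.

Lemma gsum_box_le m a b : (forall i, a 0 i <= b 0 i) ->
  gsum m \1_(box a b) <= \prod_i (b 0 i - a 0 i + gstep m).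
Proof.
move=> ab; rewrite gsum_box; apply: ler_prod => i _.
rewrite gcount_le // andbT; apply: mulr_ge0; first by rewrite ltW // gstep_gt0.
exact: sumr_ge0.
Qed.

Lemma gsum_box_ge (c : R) a b : 0 < c -> (forall i, a 0 i + c <= b 0 i) ->
  \forall m \near \oo, (c / 2) ^+ n <= gsum m \1_(box a b).
Proof.
move=> c0 ab; near=> m.
rewrite gsum_box -[n in _ ^+ n](card_ord n) -prodr_const; apply: ler_prod => i _.
rewrite (divr_ge0 (ltW c0)) //=.
have am : `|a| < m.+1%:R by near: m; exact: near_gbound.
have bm : `|b| < m.+1%:R by near: m; exact: near_gbound.
have hc : gstep m < c / 2 by near: m; apply: near_gstep; lra.
have ai := le_lt_trans (entry_le_norm a i) am.
have bi := le_lt_trans (entry_le_norm b i) bm.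
have := @gcount_ge m (a 0 i) (b 0 i); have := ab i.
move: ai bi; rewrite !ltr_norml => /andP[ai _] /andP[_ bi] abi.
by move=> /(_ (ltW ai) (ltW bi)) /(le_trans _); apply; lra.
Unshelve. all: by end_near. Qed.

Lemma gsum_normball (L : R) m : 0 <= L ->
  gsum m \1_[set x : 'rV[R]_n | `|x| <= L] <= (2 * L + 2) ^+ n.
Proof.
move=> L0.
pose a : 'rV[R]_n := const_mx (- L); pose b : 'rV[R]_n := const_mx (L + 1).
apply: (@le_trans _ _ (gsum m \1_(box a b))).
  apply: ler_gsum => x; rewrite !indicE ler_nat.
  case: (boolP (x \in _)) => // /set_mem /= xL.
  rewrite mem_set //= => i; rewrite !mxE.
  have := le_trans (entry_le_norm x i) xL; rewrite ler_norml => /andP[-> h].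
  rewrite (le_lt_trans h) //; lra.
apply: le_trans (gsum_box_le _ _) _; first by move=> i; rewrite !mxE; lra.
rewrite -[n in _ ^+ n](card_ord n) -prodr_const; apply: ler_prod => i _.
rewrite !mxE; have := gstep_gt0 m; have := gstep_le1 m.
by move=> h1 h2; apply/andP; split; lra.
Qed.

Let gshift m (i : 'I_n) (k : {ffun 'I_n -> 'I_(gsize m)}) :
  {ffun 'I_n -> 'I_(gsize m)} := [ffun j => if j == i then ordS (k j) else k j].

Let gshift_inj m i : injective (@gshift m i).
Proof.
move=> k l /ffunP E; apply/ffunP => j; have := E j; rewrite !ffunE.
by case: eqP => // _; exact: ordS_inj.
Qed.

(** Integration by parts on the grid: shifting the grid cyclically along one
    coordinate leaves the sum of f unchanged when f vanishes near the faces
    of the grid, so the sum of the difference quotients of f is zero. *)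
Lemma gsum_partial f i (L : R) : 0 <= L ->
  (forall x, L < `|x| -> f x = 0) ->
  (forall x, derivable f x (ebasis i)) ->
  (forall e : R, 0 < e -> exists2 d : R, 0 < d & forall x t, `|t| < d ->
    `|partial i f (t *: ebasis i + x) - partial i f x| <= e) ->
  forall e : R, 0 < e -> \forall m \near \oo, `|gsum m (partial i f)| <= e.
Proof.
move=> L0 f0 df ucf e e0.
pose C : R := (2 * (L + 1) + 2) ^+ n.
have C0 : 0 < C by rewrite exprn_gt0 //; lra.
have e'0 : 0 < e / C by rewrite divr_gt0.
have [d d0 Hd] := ucf _ e'0.
near=> m.
have Lm : L + 1 < m.+1%:R by near: m; exact: near_gbound.
have hd : gstep m < d by near: m; exact: near_gstep.
have h0 := gstep_gt0 m; have h1 := gstep_le1 m.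
set h := gstep m in hd h0 h1 *.
have far x (j : 'I_n) : L < `|x 0 j| -> f x = 0.
  by move=> Lx; apply: f0; apply: lt_le_trans (entry_le_norm x j).
have shift k : f (h *: ebasis i + gpt k) = f (gpt (@gshift m i k)).
  have ki := ltn_ord (k i).
  have [kl|kl] := ltnP (k i).+1 (gsize m).
    congr (f _); apply/rowP => j; rewrite !mxE !ffunE eqxx /=.
    case: eqVneq => [->|_]; last by rewrite mulr0 add0r.
    by rewrite mulr1 /= modn_small // gcoordS addrC.
  have kE : (k i).+1 = gsize m by apply/eqP; rewrite eqn_leq ki kl.
  rewrite (@far _ i) ?(@far (gpt _) i) //; rewrite !mxE ?ffunE eqxx /=.
    rewrite kE modnn gcoord0 normrN ger0_norm //; lra.
  by rewrite eqxx mulr1 addrC -gcoordS kE gcoord_size ger0_norm //; lra.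
have S0 : \sum_(k : {ffun 'I_n -> 'I_(gsize m)})
    (f (h *: ebasis i + gpt k) - f (gpt k)) = 0.
  under eq_bigr => k _ do rewrite shift.
  by rewrite sumrB [X in _ - X](reindex_inj (@gshift_inj m i)) subrr.
have loc x : `|f (h *: ebasis i + x) - f x - h * partial i f x| <=
    h * (e / C * \1_[set y : 'rV[R]_n | `|y| <= L + 1] x).
  rewrite indicE; have [xL|xL] := lerP `|x| (L + 1).
    rewrite mem_set //= mulr1.
    have [//|t [/andP[t0 th] ->]] := @MVT_dir_pos _ _ f x (ebasis i) h (ltW h0).
    rewrite -mulrBr normrM (ger0_norm (ltW h0)); apply: ler_wpM2l; first exact: ltW.
    by apply: Hd; rewrite ger0_norm //; apply: le_lt_trans hd.
  rewrite memNset /=; last by rewrite leNgt xL.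
  rewrite !mulr0 (f0 x); last by lra.
  rewrite f0; last first.
    have : `|x| <= `|h *: ebasis i + x| + h.
      rewrite -{1}(addKr (h *: ebasis i) x) addrC.
      apply: le_trans (ler_normB _ _) _; rewrite lerD2l normrZ (gtr0_norm h0).
      by rewrite ler_piMr ?norm_ebasis // ltW.
    by lra.
  have -> : partial i f x = 0.
    rewrite /partial -(derive_cst (0 : R) x (ebasis i)); apply: near_eq_derive.
    have xL' : L < `|x| by lra.
    apply: filterS (_ : \forall y \near x, L < `|y|) => [y /f0 //|].
    have := @norm_continuous _ _ x; move=> /(_ _ (lt_nbhsr xL')).
    by [].
  by rewrite mulr0 !subr0 normr0.
pose s := \sum_(k : {ffun 'I_n -> 'I_(gsize m)}) partial i f (gpt k).
pose q := \sum_(k : {ffun 'I_n -> 'I_(gsize m)})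
  \1_[set y : 'rV[R]_n | `|y| <= L + 1] (gpt k) : R.
have : `|s| <= e / C * q.
  have : `|h * s| <= h * (e / C * q).
    have -> : h * s = - \sum_(k : {ffun 'I_n -> 'I_(gsize m)})
      (f (h *: ebasis i + gpt k) - f (gpt k) - h * partial i f (gpt k)).
      by rewrite sumrB S0 sub0r opprK mulr_sumr.
    rewrite normrN !mulr_sumr; apply: le_trans (ler_norm_sum _ _ _) _.
    by apply: ler_sum => k _; exact: loc.
  by rewrite normrM (gtr0_norm h0) ler_pM2l.
move=> sq; rewrite /gsum normrM ger0_norm ?exprn_ge0 ?(ltW h0) //.
apply: (@le_trans _ _ (h ^+ n * (e / C * q))).
  by apply: ler_wpM2l => //; rewrite exprn_ge0 // ltW.
rewrite mulrCA; apply: (@le_trans _ _ (e / C * C)); last by rewrite divfK // gt_eqF.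
by rewrite ler_pM2l //; apply: gsum_normball; lra.
Unshelve. all: by end_near. Qed.

End GridSums.

(** * Continuous functions on compact sets *)
Section Compactness.
Context {R : realType} {n : nat}.
Implicit Types (f g : 'rV[R]_n -> R) (x v w a b : 'rV[R]_n) (D E K : set 'rV[R]_n).

Lemma compact_norm_bound K : compact K ->
  exists2 L : R, 0 <= L & forall x, K x -> `|x| <= L.
Proof.
move=> /compact_bounded[M [_ H]].
exists (`|M| + 1); first by rewrite addr_ge0.
by move=> x Kx; apply: (H (`|M| + 1)) => //; have := ler_norm M; lra.
Qed.

Lemma compact_upper_bound K g : compact K ->
  (forall x, K x -> {for x, continuous g}) ->
  exists2 C : R, 0 < C & forall x, K x -> g x <= C.
Proof.
move=> /compact_near_coveringP cK cg.
have : \forall C \near +oo, K `<=` (fun x => g x <= C).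
  apply: cK => x Kx.
  have gx : \forall y \near x, g y < g x + 1.
    have := cg x Kx; rewrite /continuous_at => /(_ (fun t => t < g x + 1)).
    by apply; apply: lt_nbhsl; lra.
  exists ([set y | g y < g x + 1], [set C : R | g x + 1 < C]); first split=> //=.
    by apply: nbhs_pinfty_gt; exact: num_real.
  by move=> [y C] /= [h1 h2]; apply: ltW; exact: lt_trans h2.
move=> H2; have : \forall C \near +oo, 0 < C /\ K `<=` (fun x => g x <= C).
  by apply: filterS2 (nbhs_pinfty_gt (num_real 0)) H2.
by move=> /(@filter_ex _ _ _)[C [C0 HC]]; exists C.
Qed.

Lemma compact_lower_bound K g : compact K ->
  (forall x, K x -> {for x, continuous g}) -> (forall x, K x -> 0 < g x) ->
  exists2 c : R, 0 < c & forall x, K x -> c <= g x.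
Proof.
move=> cK cg g0.
have cgV x : K x -> {for x, continuous (fun x => (g x)^-1)}.
  move=> Kx; apply: continuousV; last exact: cg.
  by rewrite gt_eqF // g0.
have [C C0 HC] := compact_upper_bound cK cgV.
exists C^-1; first by rewrite invr_gt0.
move=> x Kx; rewrite -[leRHS]invrK lef_pV2 ?posrE ?invr_gt0 ?g0 //.
exact: HC.
Qed.

Lemma compact_ball (L : R) : compact [set x : 'rV[R]_n | `|x| <= L].
Proof.
apply: bounded_closed_compact.
  by exists L; split; [exact: num_real|move=> M h x xL; exact: le_trans xL (ltW h)].
apply: (@preimage_closed _ _ (fun x : 'rV[R]_n => `|x|) [set t | t <= L]); last exact: closed_le.
by move=> x _; exact: norm_continuous.
Qed.

Lemma compact_closure_ball D (L : R) :
  compact (closure D `&` [set x : 'rV[R]_n | `|x| <= L]).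
Proof.
rewrite setIC; apply: compact_closedI; first exact: compact_ball.
exact: closed_closure.
Qed.

(** By compactness: around a point where r is positive a small d leaves nothing
    to prove, and around the other points P holds on a whole neighbourhood. *)
Lemma near_zero_set K D (r : 'rV[R]_n -> R) (P : 'rV[R]_n -> Prop) : compact K ->
  (forall x, K x -> {for x, continuous r}) ->
  (forall x, K x -> 0 < r x \/ \forall y \near x, D y -> P y) ->
  exists2 d : R, 0 < d & forall x, K x -> D x -> r x <= d -> P x.
Proof.
move=> /compact_near_coveringP cK cr H.
have : \forall d \near 0^'+, K `<=` (fun x => D x -> r x <= d -> P x).
  apply: cK => x Kx.
  have [r0|HP] := H x Kx; last first.
    exists ([set y | D y -> P y], setT); first by split=> //=; exact: filterT.
    by move=> [y d] /= [Py _] Dy _; exact: Py.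
  have rx : \forall y \near x, r x / 2 < r y.
    have := cr x Kx; rewrite /continuous_at => /(_ (fun t => r x / 2 < t)).
    by apply; apply: lt_nbhsr; lra.
  exists ([set y | r x / 2 < r y], [set d : R | d < r x / 2]); first split=> //=.
    by apply: nbhs_right_lt; lra.
  by move=> [y d] /= [h1 h2] _ h3; lra.
move=> H2; have : \forall d \near 0^'+, 0 < d /\ K `<=` (fun x => D x -> r x <= d -> P x).
  by apply: filterS2 (nbhs_right_gt _) H2.
move=> /(@filter_ex _ _ _)[d [d0 Hd]]; exists d => // x Kx; exact: Hd.
Qed.

End Compactness.
Arguments compact_ball {R n} L.
Arguments compact_closure_ball {R n} D L.

(** * Grid sums of derivatives and of indicators *)
Section GridLimits.
Context {R : realType} {n : nat}.
Implicit Types (f g : 'rV[R]_n -> R) (x v w a b : 'rV[R]_n) (D E K : set 'rV[R]_n).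

(** A compact support inside D makes the extension of f by zero differentiable
    everywhere, with a uniformly continuous partial derivative. *)
Lemma gsum_partial_supp D K f i : open D -> compact K -> K `<=` D ->
  (forall x, ~ K x -> f x = 0) ->
  (forall x, D x -> derivable f x (ebasis i)) ->
  (forall x, D x -> {for x, continuous (partial i f)}) ->
  forall e : R, 0 < e -> \forall m \near \oo, `|gsum m (partial i f)| <= e.
Proof.
move=> oD cK KD f0 df cf.
have clK : closed K := compact_closed (@norm_hausdorff _ _) cK.
have [L L0 KL] := compact_norm_bound cK.
have nK x : ~ K x -> \forall y \near x, ~ K y.
  by move=> Kx; apply: open_nbhs_nbhs; split=> //; exact: closed_openC.
have nf x : ~ K x -> \forall y \near x, f y = 0.
  by move=> /nK; apply: filterS => y /f0.
have dfall x : derivable f x (ebasis i).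
  have [Kx|Kx] := pselect (K x); first exact/df/KD.
  apply: (@near_eq_derivable _ _ _ (cst 0)); last exact: derivable_cst.
  by apply: filterS (nf x Kx) => y ->.
have p0 x : ~ K x -> partial i f x = 0.
  move=> Kx; rewrite /partial -(derive_cst (0 : R) x (ebasis i)).
  by apply: near_eq_derive; apply: filterS (nf x Kx) => y ->.
have pc x : {for x, continuous (partial i f)}.
  have [Kx|Kx] := pselect (K x); first exact/cf/KD.
  apply: (@continuous_eq_near _ _ (cst 0)); last exact: cst_continuous.
  by apply: filterS (nK x Kx) => y /p0 ->.
have farK x : L < `|x| -> ~ K x by move=> h /KL; rewrite leNgt h.
apply: (@gsum_partial R n f i L L0) => // [x /farK/f0 //|e e0].
pose B : set 'rV[R]_n := [set x | `|x| <= L + 1].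
have cB : compact B := compact_ball (L + 1).
have e2 : 0 < e / 2 by lra.
have /compact_near_coveringP cBn := cB.
have : \forall d \near 0^'+, B `<=` (fun x => forall t, `|t| < d ->
    `|partial i f (t *: ebasis i + x) - partial i f x| <= e).
  apply: cBn => x Bx.
  have /cvgrPdist_le /(_ _ e2) /nbhs_ballP[r /= r0 Hr] := pc x.
  exists (ball x (r / 2), [set d : R | d < r / 2]); first split => /=.
  - by apply: nbhsx_ballx; lra.
  - by apply: nbhs_right_lt; lra.
  move=> [y d] /= [/ball_rowP xy dr] t td.
  have h1 : `|partial i f x - partial i f y| <= e / 2.
    by apply: Hr; apply/ball_rowP; lra.
  have h2 : `|partial i f x - partial i f (t *: ebasis i + y)| <= e / 2.
    apply: Hr; apply/ball_rowP; rewrite -addrA.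
    apply: le_lt_trans (ler_normD _ _) _; rewrite normrZ.
    have : `|t| * `|ebasis i : 'rV[R]_n| <= `|t| by rewrite ler_piMr ?norm_ebasis.
    lra.
  rewrite (_ : _ - _ = (partial i f x - partial i f y) -
     (partial i f x - partial i f (t *: ebasis i + y))); last by ring.
  by apply: le_trans (ler_normB _ _) _; lra.
move=> H; have : \forall d \near 0^'+, [/\ 0 < d, d < 1 & B `<=` (fun x => forall t, `|t| < d ->
    `|partial i f (t *: ebasis i + x) - partial i f x| <= e)].
  apply: filterS3 (nbhs_right_gt 0) (nbhs_right_lt (@ltr01 R)) H.
  by move=> d.
move=> /(@filter_ex _ _ _)[d [d0 d1 Hd]]; exists d => // x t td.
have [xB|xB] := lerP `|x| (L + 1); first exact: Hd.
rewrite !p0 ?subrr ?normr0 ?ltW //; apply: farK; first by lra.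
have : `|x| <= `|t *: ebasis i + x| + `|t|.
  rewrite -{1}(addKr (t *: ebasis i) x) addrC.
  apply: le_trans (ler_normB _ _) _; rewrite lerD2l normrZ.
  by rewrite ler_piMr ?norm_ebasis.
lra.
Qed.

Lemma prod_perturb (I : Type) (r : seq I) (c : I -> R) (e : R) : 0 < e ->
  exists2 t : R, 0 < t & \prod_(i <- r) (c i + t) <= \prod_(i <- r) c i + e.
Proof.
move=> e0.
have H : (fun t : R => \prod_(i <- r) (c i + t)) @ 0 --> \prod_(i <- r) c i.
  elim: r => [|i r IH].
    rewrite big_nil (_ : (fun t => _) = cst 1); first exact: cvg_cst.
    by apply/funext => t; rewrite big_nil.
  rewrite big_cons (_ : (fun t => _) = (fun t => (c i + t) * \prod_(i <- r) (c i + t))).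
    apply: cvgM IH; rewrite -[X in _ --> X]addr0.
    by apply: cvgD; [exact: cvg_cst|exact: cvg_id].
  by apply/funext => t; rewrite big_cons.
have /cvgrPdist_le /(_ e e0) := H.
move=> /nbhs_ballP[d /= d0 Hd]; exists (d / 2); first lra.
have := Hd (d / 2).
rewrite -ball_normE /ball_ /= sub0r normrN gtr0_norm ?divr_gt0 //.
have dd : d / 2 < d by lra.
by move=> /(_ dd); rewrite ler_norml; lra.
Qed.

(** Finitely many slightly enlarged boxes of an almost optimal covering of E
    still cover K, and the grid measures boxes up to its mesh. The
    outer measure enters only through this bound. *)
Lemma gsum_compact_le E K (V : R) : compact K -> K `<=` E ->
  (lebesgue_n E <= V%:E)%E ->
  forall e : R, 0 < e -> \forall m \near \oo, gsum m \1_K <= V + e.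
Proof.
move=> cK KE EV e e0.
have e2 : 0 < e / 2 by lra.
have : (lebesgue_n E < (V + e / 2)%:E)%E.
  by apply: le_lt_trans EV _; rewrite lte_fin; lra.
move=> /ereal_inf_lt[_ [a [b [ab Ecov ->]]] sumV].
have g2 N : \sum_(0 <= k < N) \prod_i (b k 0 i - a k 0 i) < V + e / 2.
  rewrite -lte_fin -sumEFin; apply: le_lt_trans sumV.
  apply: nneseries_lim_ge => k _ _; rewrite lee_fin prodr_ge0 // => i _.
  by rewrite subr_ge0.
clear EV sumV.
have /choice[s Hs] : forall k, exists s : R, 0 < s /\
    \prod_i (b k 0 i - a k 0 i + s) <=
    \prod_i (b k 0 i - a k 0 i) + geometric (e / 4) (1 / 2) k.
  move=> k; have gk : 0 < geometric (e / 4) (1 / 2 : R) k.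
    by rewrite /geometric /= mulr_gt0 ?exprn_gt0; lra.
  have [t t0 Ht] := prod_perturb (index_enum 'I_n) (fun i => b k 0 i - a k 0 i) gk.
  by exists t.
pose t k := s k / 4.
pose a' k : 'rV[R]_n := a k - const_mx (t k).
pose b' k : 'rV[R]_n := b k + const_mx (t k).
have s0 k : 0 < s k by have [] := Hs k.
have t0 k : 0 < t k by rewrite divr_gt0.
have [N HN] : exists N, K `<=` (fun x => exists2 k, (k < N)%N & box (a' k) (b' k) x).
  have /compact_near_coveringP cKn := cK.
  have : \forall N \near \oo, K `<=` (fun x => exists2 k, (k < N)%N & box (a' k) (b' k) x).
    apply: cKn => x Kx; have [k _ xk] := Ecov _ (KE _ Kx).
    exists (ball x (t k), [set N | (k < N)%N]); first split => /=.
    - exact: nbhsx_ballx.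
    - by exists k.+1.
    move=> [y N] /= [/ball_rowP xy kN]; exists k => // i.
    have := le_lt_trans (entry_le_norm (y - x) i) xy.
    have := xk i; rewrite !mxE ltr_norml => /andP[? ?] /andP[? ?].
    by apply/andP; split; lra.
  by move=> /(@filter_ex _ _ _)[N HN]; exists N.
have hs : \forall m \near \oo, forall k : 'I_N, @gstep R m < s k / 2.
  by apply: filter_forall => k; apply: near_gstep; rewrite divr_gt0.
apply: filterS hs => m hm.
have bk k : (k < N)%N -> gsum m \1_(box (a' k) (b' k)) <=
    \prod_i (b k 0 i - a k 0 i) + geometric (e / 4) (1 / 2) k.
  move=> kN; have [_] := Hs k; apply: le_trans.
  apply: le_trans (gsum_box_le _ _) _.
    by move=> i; rewrite !mxE; have := ab k i; have := t0 k; lra.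
  apply: ler_prod => i _; rewrite !mxE.
  have := ab k i; have := t0 k; have := @gstep_gt0 R m; have := hm (Ordinal kN).
  by rewrite /t /= => ? ? ? ?; apply/andP; split; lra.
apply: (@le_trans _ _ (\sum_(0 <= k < N) gsum m \1_(box (a' k) (b' k)))).
  rewrite -gsum_sum; apply: ler_gsum => x; rewrite indicE.
  case: (boolP (x \in K)) => [/set_mem Kx|_]; last by apply: sumr_ge0 => k _; rewrite indicE.
  have [k kN xk] := HN x Kx.
  rewrite big_mkord (bigD1 (Ordinal kN)) //= indicE mem_set //= lerDl.
  by apply: sumr_ge0 => j _; rewrite indicE.
apply: (@le_trans _ _ (\sum_(0 <= k < N) (\prod_i (b k 0 i - a k 0 i) +
    geometric (e / 4) (1 / 2) k))).
  by rewrite !big_mkord; apply: ler_sum => k _; exact: bk.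
rewrite big_split /=.
have g1 : \sum_(0 <= k < N) (e / 4 * (1 / 2) ^+ k) <= e / 2.
  have := @geometric_le_lim R N (e / 4) (1 / 2) _ _ _.
  rewrite /series /= => /(_ _ _ _)/le_trans; apply; try lra.
    by rewrite ger0_norm; lra.
  by rewrite (_ : 1 - 1 / 2 = 2^-1) ?invrK; lra.
have {}g2 := g2 N.
by lra.
Qed.

End GridLimits.

(** * Scalar product and quadratic forms *)
Section QuadraticForms.
Context {R : realType} {n : nat}.
Implicit Types (u v w : 'rV[R]_n) (M : 'M[R]_n).

Lemma dotC v w : dot v w = dot w v.
Proof. by apply: eq_bigr => i _; rewrite mulrC. Qed.

Lemma dotDr u v w : dot u (v + w) = dot u v + dot u w.
Proof. by rewrite -big_split; apply: eq_bigr => i _; rewrite mxE mulrDr. Qed.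

Lemma dotZr (a : R) v w : dot v (a *: w) = a * dot v w.
Proof. by rewrite mulr_sumr; apply: eq_bigr => i _; rewrite mxE mulrCA. Qed.

Lemma dotDl u v w : dot (u + v) w = dot u w + dot v w.
Proof. by rewrite dotC dotDr !(dotC w). Qed.

Lemma dotZl (a : R) v w : dot (a *: v) w = a * dot v w.
Proof. by rewrite dotC dotZr dotC. Qed.

Lemma dotNr v w : dot v (- w) = - dot v w.
Proof. by rewrite -scaleN1r dotZr mulN1r. Qed.

Lemma dotNl v w : dot (- v) w = - dot v w.
Proof. by rewrite dotC dotNr dotC. Qed.

Lemma dot_ge0 v : 0 <= dot v v.
Proof. by apply: sumr_ge0 => i _; rewrite -expr2 sqr_ge0. Qed.

Lemma dot_eq0 v : dot v v = 0 -> v = 0.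
Proof.
move=> /eqP; rewrite psumr_eq0; last by move=> i _; rewrite -expr2 sqr_ge0.
move=> /allP H; apply/rowP => i; rewrite mxE.
by have := H i (mem_index_enum i); rewrite /= -expr2 sqrf_eq0 => /eqP.
Qed.

Lemma dot_gt0 v : v != 0 -> 0 < dot v v.
Proof.
move=> v0; rewrite lt_neqAle dot_ge0 andbT eq_sym.
by apply: contraNneq v0 => /dot_eq0 ->.
Qed.

Lemma sqr_entry_le_dot v i : v 0 i ^+ 2 <= dot v v.
Proof.
rewrite /dot (bigD1 i) //= -expr2 lerDl.
by apply: sumr_ge0 => j _; rewrite -expr2 sqr_ge0.
Qed.

Lemma enorm_le (r : R) v : 0 <= r -> (enorm v <= r) = (dot v v <= r ^+ 2).
Proof.
move=> r0; rewrite /enorm -{1}(ger0_norm r0) -sqrtr_sqr ler_sqrt //.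
exact: sqr_ge0.
Qed.

Lemma norm_le_enorm v : `|v| <= enorm v.
Proof.
apply: normv_le => [|i]; first exact: sqrtr_ge0.
by rewrite -sqrtr_sqr /enorm ler_sqrt ?dot_ge0 // sqr_entry_le_dot.
Qed.

Lemma enorm_le_norm v : enorm v <= n%:R * `|v|.
Proof.
rewrite enorm_le ?mulr_ge0 //.
apply: (@le_trans _ _ (\sum_(i < n) `|v| ^+ 2)).
  apply: ler_sum => i _; rewrite -expr2 -real_normK ?num_real //.
  by rewrite lerXn2r ?nnegrE //; exact: entry_le_norm.
rewrite exprMn sumr_const card_ord -[leLHS]mulr_natl ler_wpM2r ?sqr_ge0 //.
by rewrite -natrX ler_nat; case: (n) => // m; rewrite -mulnn leq_pmulr.
Qed.

Lemma mxactE M v i : mxact M v 0 i = \sum_j M i j * v 0 j.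
Proof. by rewrite /mxact mxE; apply: eq_bigr => j _; rewrite mxE mulrC. Qed.

Lemma mxactD M v w : mxact M (v + w) = mxact M v + mxact M w.
Proof. by rewrite /mxact mulmxDl. Qed.

Lemma mxactZ M (a : R) v : mxact M (a *: v) = a *: mxact M v.
Proof. by rewrite /mxact scalemxAl. Qed.

Lemma mxactN M v : mxact M (- v) = - mxact M v.
Proof. by rewrite /mxact mulNmx. Qed.

Lemma dot_mxactC M v w : M^T = M -> dot v (mxact M w) = dot w (mxact M v).
Proof.
move=> MT; rewrite /dot.
under eq_bigr => i _ do rewrite mxactE mulr_sumr.
under [RHS]eq_bigr => i _ do rewrite mxactE mulr_sumr.
rewrite exchange_big; apply: eq_bigr => i _; apply: eq_bigr => j _.
rewrite -{1}MT mxE; ring.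
Qed.

Lemma psd_cauchy M v w (t : R) : M^T = M ->
  (forall z : 'rV[R]_n, 0 <= dot z (mxact M z)) -> 0 < t ->
  2 * dot v (mxact M w) <= t * dot v (mxact M v) + t^-1 * dot w (mxact M w).
Proof.
move=> MT pos t0; have := pos (t *: v - w).
rewrite mxactD mxactN mxactZ dotDl !dotDr dotNl dotNr dotZl dotZr.
rewrite dotNr dotNl dotZr dotZl opprK (dot_mxactC w v MT).
set a := dot v _; set b := dot v _; set c := dot w _ => H.
have ti : 0 < t^-1 by rewrite invr_gt0.
rewrite -subr_ge0 (_ : _ - _ = t^-1 * (t * (t * a) - t * b + (- (t * b) + c))).
  by rewrite mulr_ge0 // ltW.
by field; rewrite gt_eqF.
Qed.

Lemma quadratic_le_norm M v (L : R) : (forall i j, `|M i j| <= L) ->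
  dot v (mxact M v) <= n%:R * L * dot v v.
Proof.
move=> ML; rewrite /dot.
have E : n%:R * L * (\sum_i v 0 i * v 0 i) =
   \sum_i \sum_j L * ((v 0 i ^+ 2 + v 0 j ^+ 2) / 2).
  pose S := \sum_i v 0 i ^+ 2.
  transitivity (\sum_(i < n) L * ((n%:R * v 0 i ^+ 2 + S) / 2)).
    rewrite -mulr_sumr -mulr_suml big_split /= -mulr_sumr sumr_const card_ord.
    rewrite -[S *+ n]mulr_natl (_ : \sum_(i < n) v 0 i * v 0 i = S) //.
    by rewrite -/S; field.
  apply: eq_bigr => i _; rewrite -mulr_sumr -mulr_suml big_split /=.
  by rewrite sumr_const card_ord -[(v 0 i ^+ 2) *+ n]mulr_natl.
rewrite E; apply: ler_sum => i _; rewrite mxactE mulr_sumr; apply: ler_sum => j _.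
apply: le_trans (ler_norm _) _; rewrite !normrM.
have h : `|v 0 i| * `|v 0 j| <= (v 0 i ^+ 2 + v 0 j ^+ 2) / 2.
  rewrite -(real_normK (num_real (v 0 i))) -(real_normK (num_real (v 0 j))).
  by have := sqr_ge0 (`|v 0 i| - `|v 0 j|); nra.
by rewrite mulrCA; apply: ler_pM => //; exact: mulr_ge0.
Qed.

End QuadraticForms.

(** * Gradients of sums, products and compositions *)
Section Gradients.
Context {R : realType} {n : nat}.
Implicit Types (f g : 'rV[R]_n -> R) (x : 'rV[R]_n).

Lemma gradD f g x : (forall i, derivable f x (ebasis i)) ->
  (forall i, derivable g x (ebasis i)) ->
  grad (fun y => f y + g y) x = grad f x + grad g x.
Proof. by move=> df dg; apply/rowP => i; rewrite !mxE partialD. Qed.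

Lemma gradM f g x : (forall i, derivable f x (ebasis i)) ->
  (forall i, derivable g x (ebasis i)) ->
  grad (fun y => f y * g y) x = f x *: grad g x + g x *: grad f x.
Proof. by move=> df dg; apply/rowP => i; rewrite !mxE partialM. Qed.

Lemma grad_comp f (G : R -> R) x dg : (forall i, derivable f x (ebasis i)) ->
  is_derive (f x) (1 : R) G dg ->
  grad (fun y => G (f y)) x = dg *: grad f x.
Proof.
move=> df dG; apply/rowP => i; rewrite !mxE.
by have [_] := partial_comp (df i) dG.
Qed.

End Gradients.

(** * Local Hölder classes up to the boundary *)
Section Hoelder.
Context {R : realType} {n : nat}.
Implicit Types (f g : 'rV[R]_n -> R) (x y v w : 'rV[R]_n) (D E : set 'rV[R]_n).

Lemma enorm_ge0 x : 0 <= enorm x.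
Proof. exact: sqrtr_ge0. Qed.

Lemma powR_small (a C e : R) : 0 < a -> 0 < e ->
  exists2 d : R, 0 < d & forall t, 0 <= t -> t <= d -> C * t `^ a <= e.
Proof.
move=> a0 e0; pose C' := `|C| + 1.
have C'0 : 0 < C' by have := normr_ge0 C; rewrite /C'; lra.
exists ((e / C') `^ a^-1); first by rewrite powR_gt0 // divr_gt0.
move=> t t0 td.
have eC : 0 <= e / C' by rewrite divr_ge0 // ltW.
have h : t `^ a <= e / C'.
  have tn : t \in Num.nneg by rewrite nnegrE.
  have en : (e / C') `^ a^-1 \in Num.nneg by rewrite nnegrE powR_ge0.
  have := ge0_ler_powR (ltW a0) tn en td.
  by rewrite -powRrM mulVf ?(gt_eqF a0) // powRr1.
apply: (@le_trans _ _ (C' * (e / C'))); last by rewrite mulrC divfK ?(gt_eqF C'0).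
apply: (@le_trans _ _ (C' * t `^ a)); last by rewrite ler_pM2l.
apply: ler_wpM2r; first exact: powR_ge0.
by have := ler_norm C; rewrite /C'; lra.
Qed.

Lemma holder_cauchy (a : R) D f (r e : R) : 0 < a -> holder_loc a D f -> 0 < e ->
  exists2 d : R, 0 < d & forall x y, D x -> D y -> `|x| <= r -> `|y| <= r ->
    `|x - y| <= d -> `|f x - f y| <= e.
Proof.
move=> a0 hf e0; have [C HC] := hf (n%:R * r).
have [d d0 Hd] := powR_small C a0 e0.
have n1 : 0 < n.+1%:R :> R by rewrite ltr0n.
exists (d / n.+1%:R); first by rewrite divr_gt0.
have bnd (z : 'rV[R]_n) (s : R) : `|z| <= s -> enorm z <= n%:R * s.
  by move=> zs; apply: le_trans (enorm_le_norm _) _; rewrite ler_wpM2l.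
move=> x y Dx Dy xr yr xy.
apply: le_trans (HC x y Dx Dy (bnd _ _ xr) (bnd _ _ yr)) _.
apply: Hd; first exact: enorm_ge0.
apply: le_trans (bnd _ _ xy) _.
rewrite mulrA ler_pdivrMr // mulrC ler_pM2l // ler_nat.
exact: leqnSn.
Qed.

Lemma holder_continuous (a : R) D f x : 0 < a -> open D -> holder_loc a D f ->
  D x -> {for x, continuous f}.
Proof.
move=> a0 oD hf Dx; suff : f @ x --> f x by [].
apply: (@cvgrPdist_le _ _ _ (nbhs x) _ f (f x)).2 => e e0.
have [d d0 Hd] := holder_cauchy (`|x| + 1) a0 hf e0.
have e'0 : 0 < Num.min 1 d by rewrite lt_min ltr01.
near=> y.
have : `|y - x| < Num.min 1 d.
  by apply/ball_rowP; near: y; exact: nbhsx_ballx.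
rewrite lt_min => /andP[y1 yd].
have Dy : D y by near: y; exact: near_open.
apply: Hd => //; first lra.
  by rewrite -[y](subrK x); apply: le_trans (ler_normD _ _) _; lra.
Unshelve. all: by end_near. Qed.

Lemma Cka_Ck (a : R) k D f : 0 < a -> open D -> Cka k a D f -> Ck k D f.
Proof.
move=> a0 oD; elim: k f => [|k IH] f [hf df].
  by split=> // x Dx; exact: holder_continuous hf Dx.
split=> [x Dx|i]; first exact: holder_continuous hf Dx.
by have [d1 d2] := df i; split=> //; exact: IH.
Qed.

Lemma holder_bounded (a : R) D f (r : R) : 0 < a -> holder_loc a D f ->
  exists2 C : R, 0 < C & forall x, D x -> `|x| <= r -> `|f x| <= C.
Proof.
move=> a0 hf; have [C HC] := hf (n%:R * r).
have [[x0 [Dx0 x0r]]|noP] := pselect (exists x0, D x0 /\ `|x0| <= r); last first.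
  by exists 1 => // x Dx xr; exfalso; apply: noP; exists x.
have r0 : 0 <= r := le_trans (normr_ge0 x0) x0r.
exists (`|f x0| + `|C| * (n%:R * (2 * r)) `^ a + 1).
  by rewrite ltr_pwDr // addr_ge0 // mulr_ge0 // powR_ge0.
have bnd (z : 'rV[R]_n) (s : R) : `|z| <= s -> enorm z <= n%:R * s.
  by move=> zs; apply: le_trans (enorm_le_norm _) _; rewrite ler_wpM2l.
move=> x Dx xr.
have h1 : enorm (x - x0) `^ a <= (n%:R * (2 * r)) `^ a.
  apply: (ge0_ler_powR (ltW a0)); rewrite ?nnegrE ?enorm_ge0 //.
    by rewrite mulr_ge0 // mulr_ge0.
  by apply: bnd; apply: le_trans (ler_normB _ _) _; lra.
have h2 := HC x x0 Dx Dx0 (bnd _ _ xr) (bnd _ _ x0r).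
have h3 : C * enorm (x - x0) `^ a <= `|C| * (n%:R * (2 * r)) `^ a.
  apply: (@le_trans _ _ (`|C| * enorm (x - x0) `^ a)).
    by apply: ler_wpM2r; [exact: powR_ge0 | exact: ler_norm].
  by apply: ler_wpM2l.
rewrite -[f x](subrK (f x0)); apply: le_trans (ler_normD _ _) _; lra.
Qed.

(** The Hölder bound holds on all bounded parts of D, so f is Cauchy at every
    point of the closure: this is what gives boundary values a meaning. *)
Lemma holder_cvg (a : R) D f x : 0 < a -> holder_loc a D f -> closure D x ->
  cvg (f @ within D (nbhs x)).
Proof.
move=> a0 hf cDx; have PF := within_nbhs_proper cDx.
apply/cauchy_cvgP/cauchy_exP => e e0.
have e2 : 0 < e / 2 by lra.
have [d d0 Hd] := holder_cauchy (`|x| + 1) a0 hf e2.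
have e'0 : 0 < Num.min 1 (d / 2) by rewrite lt_min ltr01; lra.
have nb : \forall y \near x, `|y - x| < 1 /\ `|y - x| < d / 2.
  apply: filterS (nbhsx_ballx x _ e'0) => y /ball_rowP.
  by rewrite lt_min => /andP[].
have nrm (y : 'rV[R]_n) : `|y - x| < 1 -> `|y| <= `|x| + 1.
  by move=> h; rewrite -[y](subrK x); apply: le_trans (ler_normD _ _) _; lra.
have [y0 [Dy0 [y01 y0d]]] := cDx _ nb.
exists (f y0); rewrite /fmap /within /=.
apply: filterS nb => y [y1 yd] Dy.
rewrite -ball_normE /ball_ /=; apply: le_lt_trans (_ : e / 2 < e); last lra.
apply: Hd => //; [exact: nrm|exact: nrm|].
rewrite (_ : y0 - y = (y0 - x) - (y - x)); last by rewrite opprB addrA subrK.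
by apply: le_trans (ler_normB _ _) _; lra.
Qed.

End Hoelder.

(** * Defining functions at a boundary point *)
Section DefiningFunctions.
Context {R : realType} {n : nat}.
Implicit Types (s : 'rV[R]_n -> R) (x y v w : 'rV[R]_n) (Om : set 'rV[R]_n).

Definition defining_at Om s x : Prop := \forall y \near x, Om y <-> 0 < s y.

Lemma directional_expansion s x v (c : R) : Ck 1 setT s -> 0 < c ->
  \forall t \near 0^'+, `|s (x + t *: v) - s x - t * dot (grad s x) v| <= t * c.
Proof.
move=> Cs c0.
have v1 : 0 < `|v| + 1 by rewrite ltr_pwDr.
have [d d0 Hd] := @C1_expansion R n setT s x (c / (`|v| + 1)) openT Cs I (divr_gt0 c0 v1).
near=> t.
have t0 : 0 < t by near: t; exact: nbhs_right_gt.
have td : t < d / (`|v| + 1) by near: t; apply: nbhs_right_lt; rewrite divr_gt0.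
have tv : `|t *: v| < d.
  rewrite normrZ gtr0_norm //; rewrite ltr_pdivlMr // in td.
  by apply: le_lt_trans td; rewrite ler_pM2l // lerDl.
have := Hd _ tv; rewrite dotZr => /le_trans; apply.
rewrite normrZ (gtr0_norm t0) mulrCA ler_pM2l // mulrAC ler_pdivrMr //.
by rewrite ler_pM2l // lerDl.
Unshelve. all: by end_near. Qed.

Lemma boundary_notin Om x : open Om -> boundary Om x -> ~ Om x.
Proof. by move=> oO [_ nO] Ox; apply: nO; exact: near_open. Qed.

Lemma defining_zero Om s x : open Om -> Ck 1 setT s -> defining_at Om s x ->
  boundary Om x -> s x = 0.
Proof.
move=> oO Cs ds bx; have nOx := boundary_notin oO bx.
have [cl _] := bx; apply/eqP; rewrite eq_le; apply/andP; split.
  by rewrite leNgt; apply/negP => sx; apply: nOx; apply/(nbhs_singleton ds).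
rewrite leNgt; apply/negP => sx.
have cs : {for x, continuous s} by exact: Ck_continuous Cs _.
have neg : \forall y \near x, s y < 0.
  by have := cs; rewrite /continuous_at => /(_ (fun t => t < 0)); apply; exact: lt_nbhsl.
have [y [Oy [Hy sy]]] := cl _ (filterI ds neg).
by have := Hy.1 Oy; lra.
Qed.

(** Two defining functions of Om at a boundary point have parallel gradients:
    a direction along which one of them increases enters Om, so the other
    cannot decrease along it. *)
Lemma gradient_parallel Om s s' x : open Om -> boundary Om x ->
  Ck 1 setT s -> Ck 1 setT s' -> defining_at Om s x -> defining_at Om s' x ->
  grad s x != 0 -> grad s' x != 0 ->
  exists2 k : R, 0 < k & grad s x = k *: grad s' x.
Proof.
move=> oO bx Cs Cs' ds ds' g0 g'0.
have s0 := defining_zero oO Cs ds bx.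
have s'0 := defining_zero oO Cs' ds' bx.
set g := grad s x in g0 *; set g' := grad s' x in g'0 *.
have key v : 0 < dot g' v -> 0 <= dot g v.
  move=> g'v; rewrite leNgt; apply/negP => gv.
  have h1 := @directional_expansion s' x v (dot g' v / 2) Cs' (divr_gt0 g'v (ltr0n _ 2)).
  have gv' : 0 < - dot g v / 2 by lra.
  have h2 := @directional_expansion s x v _ Cs gv'.
  have near0 (P : 'rV[R]_n -> Prop) : (\forall y \near x, P y) ->
      \forall t \near 0^'+, P (x + t *: v).
    move=> Px; have c : (fun t : R => x + t *: v) @ 0^'+ --> x.
      rewrite -[X in _ --> X]addr0 -(scale0r v); apply: cvgD; first exact: cvg_cst.
      by apply: cvgZr_tmp; apply: cvg_within.
    exact: c.
  have h3 := near0 _ ds; have h4 := near0 _ ds'.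
  near (0 : R)^'+ => t.
  have t0 : 0 < t by near: t; exact: nbhs_right_gt.
  have Ht : `|s (x + t *: v) - s x - t * dot g v| <= t * (- dot g v / 2) by near: t.
  have Ht' : `|s' (x + t *: v) - s' x - t * dot g' v| <= t * (dot g' v / 2) by near: t.
  have e1 : Om (x + t *: v) <-> 0 < s (x + t *: v) by near: t.
  have e2 : Om (x + t *: v) <-> 0 < s' (x + t *: v) by near: t.
  move: Ht Ht'; rewrite s0 s'0 !subr0 !ler_norml => /andP[_ Ht] /andP[Ht' _].
  have p1 : t * dot g v < 0 by rewrite pmulr_rlt0.
  have p2 : 0 < t * dot g' v by rewrite mulr_gt0.
  have : 0 < s' (x + t *: v) by lra.
  by move=> /e2.2/e1.1; lra.
have gg' : 0 < dot g' g' by exact: dot_gt0.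
pose k := dot g g' / dot g' g'; pose u := g - k *: g'.
have ug' : dot u g' = 0.
  by rewrite /u dotDl dotNl dotZl /k divfK ?subrr // gt_eqF.
have gu : dot g u = dot u u.
  by rewrite {3}/u dotDr dotNr dotZr ug' mulr0 subr0 dotC.
have uu : dot u u <= 0.
  rewrite leNgt; apply/negP => u0.
  have [c c0 cE] : exists2 c : R, 0 < c & c * dot g g' <= dot u u / 2.
    have a1 : 0 < `|dot g g'| + 1 by rewrite ltr_pwDr.
    exists (dot u u / (2 * (`|dot g g'| + 1))); first by rewrite divr_gt0 // mulr_gt0.
    apply: (@le_trans _ _ (dot u u / (2 * (`|dot g g'| + 1)) * (`|dot g g'| + 1))).
      rewrite ler_pM2l; last by rewrite divr_gt0 // mulr_gt0.
      by have := ler_norm (dot g g'); lra.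
    by rewrite le_eqVlt; apply/orP; left; apply/eqP; field; rewrite gt_eqF.
  have := key (- u + c *: g').
  rewrite dotDr dotNr dotZr (dotC g' u) ug' oppr0 add0r dotDr dotNr dotZr gu.
  by move=> /(_ (mulr_gt0 c0 gg')); lra.
have uE : u = 0 by apply: dot_eq0; apply/eqP; rewrite eq_le uu dot_ge0.
have gE : g = k *: g' by apply/eqP; rewrite -subr_eq0; apply/eqP.
exists k => //.
have k0 : k != 0 by apply: contraNneq g0 => k0; rewrite gE k0 scale0r.
rewrite lt_neqAle eq_sym k0 /k divr_ge0 ?dot_ge0 //.
exact: key.
Unshelve. all: by end_near. Qed.

End DefiningFunctions.

(** * A global defining function *)
Section LocalCharts.
Context {R : realType} {n : nat}.
Implicit Types (s h : 'rV[R]_n -> R) (x y v w : 'rV[R]_n) (Om : set 'rV[R]_n).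

Definition chart_fun (i : 'I_n) (b : bool) h : 'rV[R]_n -> R :=
  fun y => (-1) ^+ b * y 0 i - h y.

Lemma Ck_chart k i b h : Ck k setT h -> Ck k setT (chart_fun i b h).
Proof.
move=> Ch; apply: Ck_sub_fun => //; first exact: openT.
by apply: Ck_scale; [exact: openT|exact: Ck_coord].
Qed.

Lemma grad_chart i b h y : Ck 1 setT h ->
  grad (chart_fun i b h) y = (-1) ^+ b *: ebasis i - grad h y.
Proof.
move=> Ch; have d1 j : derivable (fun y : 'rV[R]_n => (-1) ^+ b * y 0 i) y (ebasis j).
  by apply: (@Ck_derivable _ _ 0 setT) => //; apply: Ck_scale; [exact: openT|exact: Ck_coord].
have d2 j : derivable h y (ebasis j) by exact: (Ck_derivable j Ch).
apply/rowP => j; rewrite !mxE /chart_fun /partial.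
have := deriveB (d1 j) (d2 j); rewrite /GRing.add /GRing.opp /= => ->.
congr (_ - _).
have d3 : derivable (fun y : 'rV[R]_n => y 0 i) y (ebasis j).
  by case: (is_derive_coord i y (ebasis j)).
have := partialM (derivable_cst ((-1) ^+ b : R) y (ebasis j)) d3.
rewrite /partial /= => ->; rewrite derive_cst mulr0 addr0.
by case: (is_derive_coord i y (ebasis j)) => _ ->; rewrite /ebasis mxE eqxx eq_sym.
Qed.

Lemma local_epigraph_partial Om x i b h y : local_epigraph Om x i b h ->
  partial i h y = 0.
Proof.
move=> [inv _]; rewrite /partial derive_line.
rewrite (_ : (fun t : R => _) = cst (h y)); first exact: derive_cst.
by apply/funext => t; rewrite addrC inv.
Qed.

Lemma grad_chart_neq0 Om x i b h y : Ck 1 setT h -> local_epigraph Om x i b h ->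
  grad (chart_fun i b h) y != 0.
Proof.
move=> Ch le; apply/eqP => /rowP /(_ i).
rewrite grad_chart // !mxE (local_epigraph_partial _ le) !eqxx mulr1 subr0.
by move/eqP; rewrite signr_eq0.
Qed.

Lemma chart_defining Om x i b h : local_epigraph Om x i b h ->
  defining_at Om (chart_fun i b h) x.
Proof.
by move=> [_]; apply: filterS => y H; rewrite /chart_fun subr_gt0.
Qed.

(** On the line the class C^n only gives C^1, but there h depends on no
    variable at all and is therefore constant. *)
Lemma boundary_chart (a : R) Om x : (0 < n)%N -> 0 < a -> smooth_domain a Om ->
  boundary Om x -> exists i b h,
    [/\ Ck 2 setT h, local_epigraph Om x i b h & Ck 1 setT h].
Proof.
move=> n0 a0 [_ _ _ H] bx; have [i [b [h [Ph le]]]] := H x bx.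
exists i, b, h.
have C2 : Ck 2 setT h.
  case: ifP Ph => [_ Ph|n2 Ph]; first exact: (Cka_Ck a0 openT Ph).
  have [n1|n1] := ltnP 1 n; first exact: Ck_le n1 Ph.
  have nE : n = 1%N by apply/eqP; rewrite eqn_leq n1 n0.
  apply: (Ck_eq openT _ (Ck_cst 2 setT (h 0))) => y _.
  have [inv _] := le; rewrite -(inv 0 (y 0 i)) add0r; congr (h _).
  apply/rowP => j; rewrite !mxE eqxx /=.
  have -> : j = i by move: i j {le inv}; rewrite nE => i j; rewrite [i]ord1 [j]ord1.
  by rewrite eqxx mulr1.
by split=> //; exact: Ck_pred.
Qed.

Lemma outer_normal_gradient (a : R) Om x : (0 < n)%N -> 0 < a ->
  smooth_domain a Om -> boundary Om x ->
  exists s (k : R), [/\ Ck 1 setT s, defining_at Om s x, grad s x != 0, 0 < k &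
    outer_normal Om x = - (k *: grad s x)].
Proof.
move=> n0 a0 sm bx.
have [i [b [h [_ le C1]]]] := boundary_chart n0 a0 sm bx.
have : is_outer_normal Om x (outer_normal Om x).
  apply: xgetPex; exists ((enorm (grad h x - (-1) ^+ b *: ebasis i))^-1 *:
    (grad h x - (-1) ^+ b *: ebasis i)).
  by exists i, b, h.
move=> [i' [b' [h' [C1' le' /= E]]]].
exists (chart_fun i' b' h'), (enorm (grad h' x - (-1) ^+ b' *: ebasis i'))^-1.
have gE : grad h' x - (-1) ^+ b' *: ebasis i' = - grad (chart_fun i' b' h') x.
  by rewrite grad_chart // opprB.
split.
- exact: (Ck_chart i' b' C1').
- exact: chart_defining.
- exact: grad_chart_neq0 le'.
- rewrite invr_gt0 gE /enorm dotNl dotNr opprK sqrtr_gt0 dot_gt0 //.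
  exact: grad_chart_neq0 le'.
- by rewrite E [in X in _ *: X = _]gE scalerN.
Qed.

(** The third power is the least that makes the truncation C^2. *)
Definition bump x (r : R) : 'rV[R]_n -> R :=
  fun y => pospart (r ^+ 2 - dot (y - x) (y - x)) ^+ 3.

Lemma Ck_dist2 k x : Ck k setT (fun y => dot (y - x) (y - x)).
Proof.
rewrite /dot; apply: Ck_sum => [|i]; first exact: openT.
have C : Ck k setT (fun y : 'rV[R]_n => (y - x) 0 i).
  apply: (Ck_eq openT _ (Ck_sub_fun openT (Ck_coord k setT i) (Ck_cst k setT (x 0 i)))).
  by move=> y _; rewrite !mxE.
by apply: Ck_mul => //; exact: openT.
Qed.

Lemma Ck_pospart3 f : Ck 2 setT f -> Ck 2 setT (fun y : 'rV[R]_n => pospart (f y) ^+ 3).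
Proof.
move=> Cf.
pose G (j : nat) (t : R) : R := match j with
  | 0 => pospart t ^+ 3 | 1 => 3 * pospart t ^+ 2 | _ => 6 * pospart t ^+ 1 end.
apply: (@Ck_comp R n 2 setT f G) => //; first exact: openT.
- move=> [|[|//]] x _ _; first exact: is_derive_pospartX.
  have := is_derive_pospartX 0 (f x) => H.
  have -> : G 1%N = 3 \*: (fun s : R => pospart s ^+ 2) by [].
  apply: is_derive_eq.
  by rewrite /G /GRing.scale /=; ring.
- move=> j x _ _.
  have cc (c : R) k : {for f x, continuous (fun t => c * pospart t ^+ k)}.
    apply: (@continuousM _ _ (cst c) (fun t => pospart t ^+ k)).
      exact: cst_continuous.
    exact: continuous_pospartX.
  case: j => [|[|j]]; [exact: continuous_pospartX|exact: cc|exact: cc].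
Qed.

Lemma Ck_bump x r : Ck 2 setT (bump x r).
Proof.
apply: Ck_pospart3; apply: Ck_sub_fun; first exact: openT.
  exact: Ck_cst.
exact: Ck_dist2.
Qed.

Lemma bump_ge0 x r y : 0 <= bump x r y.
Proof. by rewrite exprn_ge0 // pospart_ge0. Qed.

Lemma bump_gt0 x r y : (0 < bump x r y) = (dot (y - x) (y - x) < r ^+ 2).
Proof.
rewrite /bump; have [h|h] := lerP (r ^+ 2) (dot (y - x) (y - x)).
  by rewrite pospart_le0E ?expr0n ?ltxx //; lra.
by rewrite pospart_ge0E ?exprn_gt0 //; lra.
Qed.

Lemma bump_near x (r : R) y : 0 < r -> 0 < bump x r y -> `|y - x| < r.
Proof.
move=> r0; rewrite bump_gt0 => h.
apply: le_lt_trans (norm_le_enorm _) _.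
rewrite /enorm -(gtr0_norm r0) -sqrtr_sqr ltr_sqrt // exprn_gt0 //.
Qed.

Lemma grad_bump0 x r y : bump x r y = 0 -> grad (bump x r) y = 0.
Proof.
move=> /eqP; rewrite expf_eq0 /= => /eqP b0.
have df j : derivable (fun y => r ^+ 2 - dot (y - x) (y - x)) y (ebasis j).
  apply: (@Ck_derivable _ _ 0 setT) => //; apply: Ck_sub_fun; first exact: openT.
    exact: Ck_cst.
  exact: Ck_dist2.
have := grad_comp df (is_derive_pospartX 1 _).
by rewrite /bump => ->; rewrite b0 expr0n mulr0 scale0r.
Qed.

(** The local defining functions, glued with nonnegative bumps: on the zero
    set all the glued functions vanish together, so the gradient of the sum
    only sees their gradients, which point in one common direction. *)
Lemma global_defining (a : R) Om (L : R) : (0 < n)%N -> 0 < a ->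
  smooth_domain a Om ->
  exists rho, [/\ Ck 2 setT rho,
    forall x, Om x -> `|x| <= L -> 0 < rho x,
    forall x, boundary Om x -> `|x| <= L -> rho x = 0 &
    forall x s, boundary Om x -> `|x| <= L -> Ck 1 setT s ->
      defining_at Om s x -> grad s x != 0 ->
      exists2 k : R, 0 < k & grad rho x = k *: grad s x].
Proof.
move=> n0 a0 sm; have [oO _ _ _] := sm.
pose good x (p : R * ('rV[R]_n -> R)) := [/\ 0 < p.1, Ck 2 setT p.2 &
  forall y, `|y - x| < p.1 -> (Om y <-> 0 < p.2 y) /\
    (p.2 y = 0 -> grad p.2 y != 0)].
have /choice[p Hp] : forall x, exists p, Ck 2 setT p.2 /\ (closure Om x -> good x p).
  move=> x; have [cx|ncx] := pselect (closure Om x); last first.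
    by exists (0, fun=> 0); split=> //; exact: (Ck_cst 2 setT 0).
  have [Ox|nOx] := pselect (Om x).
    have /nbhs_ballP[r /= r0 Hr] := near_open oO Ox.
    exists (r, fun=> 1); have C1 := Ck_cst 2 setT (1 : R); split=> // _; split=> //.
    move=> y /ball_rowP /Hr Oy; split; first by split.
    by move=> /= /eqP; rewrite oner_eq0.
  have bx : boundary Om x by split=> //; apply: contra_not nOx; exact: interior_subset.
  have [i [b [h [C2 le C1]]]] := boundary_chart n0 a0 sm bx.
  have /nbhs_ballP[r /= r0 Hr] := chart_defining le.
  have C2' := Ck_chart i b C2.
  exists (r, chart_fun i b h); split=> // _; split=> //.
  move=> y /ball_rowP /Hr Hy; split=> // _; exact: grad_chart_neq0 le.
pose K : set 'rV[R]_n := closure Om `&` [set x | `|x| <= L].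
have cK : compact K := compact_closure_ball Om L.
pose xi x := bump x (p x).1.
have [X XK HX] : finite_subset_cover K (fun x => [set y | 0 < xi x y]) K.
  move: cK; rewrite compact_cover; apply.
    move=> x _; rewrite openE => y /= xy.
    have c : {for y, continuous (xi x)} by exact: Ck_continuous (Ck_bump _ _) I.
    by move: c; rewrite /continuous_at => /(_ (fun t => 0 < t)); apply; exact: lt_nbhsr.
  move=> x Kx; exists x => //=; rewrite /xi bump_gt0 subrr.
  have [_ /(_ Kx.1) [r0 _ _]] := Hp x.
  by rewrite /dot big1 ?exprn_gt0 // => i _; rewrite mxE mul0r.
pose rho y := \sum_(x <- X) xi x y * (p x).2 y.
have gX x : x \in X -> good x (p x).
  by move=> /XK/set_mem[cx _]; have [_] := Hp x; apply.
have sgn x y : x \in X -> 0 < xi x y -> Om y <-> 0 < (p x).2 y.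
  move=> xX xy; have [r0 _ H] := gX x xX.
  by have [] := H y (bump_near r0 xy).
have def x y : x \in X -> 0 < xi x y -> defining_at Om (p x).2 y.
  move=> xX xy; have [r0 _ H] := gX x xX.
  have yr := bump_near r0 xy; apply/nbhs_ballP.
  exists ((p x).1 - `|y - x|) => /=; first by rewrite subr_gt0.
  move=> z /ball_rowP zy; have [//|//] := H z _.
  rewrite (_ : z - x = (z - y) + (y - x)); last by rewrite addrA subrK.
  by apply: le_lt_trans (ler_normD _ _) _; rewrite -ltrBrDr.
have zer x y : x \in X -> boundary Om y -> xi x y * (p x).2 y = 0.
  move=> xX bdy; have [->|xy] := eqVneq (xi x y) 0; first by rewrite mul0r.
  have {}xy : 0 < xi x y by rewrite lt_neqAle eq_sym xy bump_ge0.
  have [_ /Ck_pred Cp _] := gX x xX.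
  by rewrite (defining_zero oO Cp (def x y xX xy) bdy) mulr0.
have C2t x : Ck 2 setT (fun y => xi x y * (p x).2 y).
  by apply: Ck_mul; [exact: openT|exact: Ck_bump|have [] := Hp x].
have cov y : closure Om y -> `|y| <= L -> exists2 x, x \in X & 0 < xi x y.
  by move=> cy yL; have [x /= xX xy] := HX y (conj cy yL); exists x.
exists rho; split.
- by apply: Ck_sum => [|x]; [exact: openT|exact: C2t].
- move=> y Oy yL; have [x xX xy] := cov y (subset_closure Oy) yL.
  rewrite /rho (big_rem x) //=; apply: ltr_pwDl.
    by rewrite mulr_gt0 //; apply/(sgn x y).
  rewrite big_seq; apply: sumr_ge0 => z /mem_rem zX.
  have [->|zy] := eqVneq (xi z y) 0; first by rewrite mul0r.
  have {}zy : 0 < xi z y by rewrite lt_neqAle eq_sym zy bump_ge0.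
  by apply: mulr_ge0; [exact: ltW|apply/ltW/(sgn z y)].
- by move=> y bdy yL; rewrite /rho big_seq big1 // => x xX; exact: zer.
- move=> y s bdy yL Cs ds gs0.
  have drv x j : derivable (fun y => xi x y * (p x).2 y) y (ebasis j).
    exact: (Ck_derivable j (C2t x)).
  have term x : x \in X -> exists c : R, [/\ 0 <= c, 0 < xi x y -> 0 < c &
      grad (fun y => xi x y * (p x).2 y) y = c *: grad s y].
    move=> xX; have [r0 Cp H] := gX x xX.
    rewrite gradM; last 2 first.
    - by move=> j; exact: (Ck_derivable j (Ck_bump _ _)).
    - by move=> j; exact: (Ck_derivable j Cp).
    have [x0|xy] := eqVneq (xi x y) 0.
      by exists 0; rewrite x0 ltxx; split=> //; rewrite grad_bump0 // !scale0r scaler0 addr0.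
    have {}xy : 0 < xi x y by rewrite lt_neqAle eq_sym xy bump_ge0.
    have p0 : (p x).2 y = 0.
      exact: (defining_zero oO (Ck_pred Cp) (def x y xX xy) bdy).
    have [_ /(_ p0) gp0] := H y (bump_near r0 xy).
    have [k k0 kE] := gradient_parallel oO bdy (Ck_pred Cp) Cs (def x y xX xy) ds gp0 gs0.
    exists (xi x y * k); rewrite mulr_ge0 ?bump_ge0 ?(ltW k0) //; split=> //.
      by move=> _; rewrite mulr_gt0.
    by rewrite p0 scale0r addr0 kE scalerA.
  have [x xX xy] := cov y bdy.1 yL.
  have drs (r : seq 'rV[R]_n) j :
      derivable (fun y => \sum_(x <- r) xi x y * (p x).2 y) y (ebasis j).
    apply: (@Ck_derivable _ _ 1 setT) => //; apply: Ck_sum => [|z]; first exact: openT.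
    exact: C2t.
  have H (r : seq 'rV[R]_n) : {subset r <= X} -> exists c : R, [/\ 0 <= c,
      x \in r -> 0 < c &
      grad (fun y => \sum_(x <- r) xi x y * (p x).2 y) y = c *: grad s y].
    elim: r => [|z r IH] rX.
      exists 0; split=> //; rewrite scale0r.
      rewrite (_ : (fun y => _) = cst 0); last by apply/funext => w; rewrite big_nil.
      by apply/rowP => j; rewrite !mxE /partial derive_cst.
    have [c [c0 cx cE]] : exists c : R, [/\ 0 <= c, x \in r -> 0 < c &
      grad (fun y => \sum_(x <- r) xi x y * (p x).2 y) y = c *: grad s y].
      by apply: IH => w wr; apply: rX; rewrite inE wr orbT.
    have [d [d0 dx dE]] := term z (rX z (mem_head _ _)).
    exists (d + c); split; first exact: addr_ge0.
      rewrite inE => /orP[/eqP xz|/cx cp]; last by rewrite ltr_pwDr.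
      by rewrite ltr_pwDl // dx // -xz.
    rewrite (_ : (fun y => _) = (fun y => xi z y * (p z).2 y +
      \sum_(x <- r) xi x y * (p x).2 y)); last by apply/funext => w; rewrite big_cons.
    by rewrite gradD // dE cE scalerDl.
  have [c [_ c0 cE]] := H X (fun z zX => zX).
  by exists c => //; exact: c0.
Qed.

End LocalCharts.

(** * The measure of thin boundary strips *)
Section Strip.
Context {R : realType} {n : nat}.
Implicit Types (f g rho : 'rV[R]_n -> R) (x y v w : 'rV[R]_n) (D K Om : set 'rV[R]_n).

(** The divergence theorem without boundary term: each component, extended by
    zero, has compact support. *)
Lemma gsum_divergence D K (F : 'I_n -> 'rV[R]_n -> R) : open D -> compact K ->
  K `<=` D -> (forall i, Ck 1 D (F i)) ->
  (forall i x, D x -> ~ K x -> F i x = 0) ->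
  forall e : R, 0 < e -> \forall m \near \oo,
    `|gsum m (fun x => \1_D x * \sum_i partial i (F i) x)| <= e.
Proof.
move=> oD cK KD CF F0 e e0.
pose f i x := \1_D x * F i x.
have clK : closed K := compact_closed (@norm_hausdorff _ _) cK.
have f0 i x : ~ K x -> f i x = 0.
  move=> nK; rewrite /f indicE; case: (boolP (x \in D)) => [/set_mem Dx|_].
    by rewrite F0 // mulr0.
  by rewrite mul0r.
have fin i x : D x -> \forall y \near x, F i y = f i y.
  move=> Dx; apply: filterS (near_open oD Dx) => y Dy.
  by rewrite /f indicE mem_set // mul1r.
have pin i x : D x -> partial i (f i) x = partial i (F i) x.
  by move=> Dx; apply: near_eq_derive; apply: filterS (fin i x Dx) => y ->.
have pE i x : partial i (f i) x = \1_D x * partial i (F i) x.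
  rewrite indicE; case: (boolP (x \in D)) => [/set_mem Dx|].
    by rewrite mul1r pin.
  rewrite notin_setE => nD; rewrite mul0r.
  rewrite /partial -(derive_cst (0 : R) x (ebasis i)); apply: near_eq_derive.
  have nK : ~ K x by move=> /KD.
  have : \forall y \near x, ~ K y by apply: open_nbhs_nbhs; split=> //; exact: closed_openC.
  by apply: filterS => y /f0.
have e'0 : 0 < e / n.+1%:R by rewrite divr_gt0.
have H i : \forall m \near \oo, `|gsum m (partial i (f i))| <= e / n.+1%:R.
  apply: (@gsum_partial_supp R n D K (f i) i) => //; first exact: f0.
    move=> x Dx; apply: near_eq_derivable (fin i x Dx) _.
    exact: (Ck_derivable i (CF i) Dx).
  move=> x Dx; apply: (@continuous_eq_near _ _ (partial i (F i))).
    by apply: filterS (near_open oD Dx) => y Dy; rewrite pin.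
  exact: Ck_continuous (Ck_partial i (CF i)) Dx.
have : \forall m \near \oo, forall i, `|gsum m (partial i (f i))| <= e / n.+1%:R.
  exact: filter_forall.
apply: filterS => m Hm.
rewrite (_ : (fun x => _) = (fun x => \sum_i partial i (f i) x)); last first.
  by apply/funext => x; rewrite mulr_sumr; apply: eq_bigr => i _; rewrite pE.
rewrite gsum_sum; apply: le_trans (ler_norm_sum _ _ _) _.
apply: (@le_trans _ _ (\sum_(i < n) e / n.+1%:R)); first by apply: ler_sum => i _.
rewrite sumr_const card_ord -[_ *+ _]mulr_natl mulrCA ler_piMr ?(ltW e0) //.
by rewrite ler_pdivrMr ?ltr0n // mul1r ler_nat.
Qed.

(** A product of two steps: the first one switches on between kap/2 and kap and
    never decreases the slope; the second one climbs by at most 6 d and is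
    placed so that [0, d] lies in the part where its slope is at least 1. *)
Lemma strip_profile (kap d : R) : 0 < kap -> 0 < d ->
  exists th dth : R -> R, [/\ forall t, is_derive t (1 : R) th (dth t),
    continuous dth, forall t, t <= kap / 2 -> th t = 0 &
    forall t, [/\ 0 <= th t, th t <= 6 * d, 0 <= dth t &
      kap <= t <= d -> 1 <= dth t]].
Proof.
move=> k0 d0.
pose u t : R := 2 / kap * t - 1; pose v t : R := (6 * d)^-1 * t + 1 / 3.
have aff (a b t : R) : is_derive t (1 : R) (fun t => a * t + b) a.
  rewrite (_ : (fun t => _) = (a \*: (id : R -> R)) + cst b).
    by apply: is_derive_eq; rewrite addr0 /GRing.scale /= mulr1.
  by apply/funext.
have du t : is_derive t (1 : R) (fun t => step (u t)) (dstep (u t) * (2 / kap)).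
  exact: (@is_derive1_comp R step u t _ _ (is_derive_step _) (aff _ _ _)).
have dv t : is_derive t (1 : R) (fun t => step (v t)) (dstep (v t) * (6 * d)^-1).
  exact: (@is_derive1_comp R step v t _ _ (is_derive_step _) (aff _ _ _)).
have contaff (a b : R) : continuous (fun t => a * t + b).
  move=> t; have [da _] := aff a b t.
  exact: differentiable_continuous ((derivable1_diffP _ _).1 da).
exists (fun t => step (u t) * (6 * d * step (v t))).
exists (fun t => step (u t) * dstep (v t) +
  (6 * d * step (v t)) * (dstep (u t) * (2 / kap))).
split.
- move=> t.
  rewrite (_ : (fun t => step (u t) * _) =
     (fun t => step (u t)) * (6 * d \*: (fun t => step (v t)))) //.
  have h1 := du t; have h2 := dv t.
  apply: is_derive_eq.
  rewrite -[LHS]/(step (u t) * (6 * d * (dstep (v t) * (6 * d)^-1)) +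
    6 * d * step (v t) * (dstep (u t) * (2 / kap))).
  by field; apply/andP; split; lra.
- have cc (f g : R -> R) : continuous f -> continuous g -> continuous (fun t => f t * g t).
    by move=> cf cg t; apply: continuousM; [exact: cf|exact: cg].
  have cu (f : R -> R) : continuous f -> continuous (fun t => f (u t)).
    move=> cf t; apply: (@continuous_comp _ _ _ u f); [exact: contaff|exact: cf].
  have cv (f : R -> R) : continuous f -> continuous (fun t => f (v t)).
    move=> cf t; apply: (@continuous_comp _ _ _ v f); [exact: contaff|exact: cf].
  have k c : continuous (fun _ : R => c : R) by move=> t; exact: cst_continuous.
  have c1 := cc _ _ (cu _ continuous_step) (cv _ continuous_dstep).
  have c2 := cc _ _ (cc _ _ (k (6 * d)) (cv _ continuous_step))
    (cc _ _ (cu _ continuous_dstep) (k (2 / kap))).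
  by move=> t; exact: (continuousD (c1 t) (c2 t)).
- move=> t tk; rewrite step_le0 ?mul0r // /u.
  have : 2 / kap * t <= 2 / kap * (kap / 2) by rewrite ler_pM2l // divr_gt0.
  by rewrite (_ : 2 / kap * (kap / 2) = 1); [lra|field; lra].
- move=> t; have /andP[su0 su1] := step_itv (u t); have /andP[sv0 sv1] := step_itv (v t).
  have /andP[du0 _] := dstep_itv (u t); have /andP[dv0 _] := dstep_itv (v t).
  have p0 : 0 <= 6 * d * step (v t) by rewrite mulr_ge0 //; lra.
  have p1 : 6 * d * step (v t) <= 6 * d by rewrite ler_piMr //; lra.
  have q0 : 0 <= dstep (u t) * (2 / kap) by rewrite mulr_ge0 // divr_ge0 // ltW.
  split.
  + exact: mulr_ge0.
  + by apply: le_trans p1; rewrite ler_piMl.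
  + by rewrite addr_ge0 // mulr_ge0.
  move=> /andP[kt td].
  have -> : step (u t) = 1.
    apply: step_ge1; rewrite /u.
    have : 2 / kap * kap <= 2 / kap * t by rewrite ler_pM2l // divr_gt0.
    by rewrite divfK; [lra|rewrite gt_eqF].
  rewrite mul1r; apply: (@le_trans _ _ (dstep (v t))); last by rewrite lerDl mulr_ge0.
  apply: dstep_third; rewrite /v.
  have a0 : 0 < (6 * d)^-1 by rewrite invr_gt0; lra.
  have t0 : 0 <= (6 * d)^-1 * t by rewrite mulr_ge0 //; lra.
  have : (6 * d)^-1 * t <= (6 * d)^-1 * d by rewrite ler_pM2l.
  rewrite (_ : (6 * d)^-1 * d = 1 / 6); last by field; lra.
  by move=> ?; apply/andP; split; lra.
Qed.

Lemma closure_cases Om x : closure Om x -> Om x \/ boundary Om x.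
Proof.
move=> cx; have [Ox|nOx] := pselect (Om x); [by left|right; split=> //].
by apply: contra_not nOx; exact: interior_subset.
Qed.

(** The test fields are supported in sets of this form: closed, bounded, and
    inside Om as soon as rho vanishes on the boundary and kap is positive. *)
Definition core Om rho (L kap : R) : set 'rV[R]_n :=
  closure Om `&` [set x | `|x| <= L] `&` [set x | kap <= rho x].

Lemma compact_core Om rho (L kap : R) : Ck 0 setT rho -> compact (core Om rho L kap).
Proof.
move=> Cr; have cl : closed (core Om rho L kap); last first.
  have sub : core Om rho L kap `<=` closure Om `&` [set x | `|x| <= L] by move=> x [].
  exact: (subclosed_compact cl (compact_closure_ball Om L) sub).
apply: closedI; first by apply: compact_closed (compact_closure_ball Om L); exact: norm_hausdorff.
rewrite (_ : [set x | _] = rho @^-1` [set t | kap <= t]) //.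
apply: preimage_closed; last exact: closed_ge.
by move=> x _; exact: Ck_continuous Cr _.
Qed.
Arguments compact_core Om {rho} L kap _.

Lemma core_sub Om rho (L kap : R) : 0 < kap ->
  (forall x, boundary Om x -> `|x| <= L -> rho x = 0) -> core Om rho L kap `<=` Om.
Proof.
move=> k0 H x [[cx xL] /= xk]; have [//|bx] := closure_cases cx.
by move: xk; rewrite H // => h; lra.
Qed.

Lemma norm_le_dot x (Q L : R) : 0 <= L -> L ^+ 2 = Q -> dot x x <= Q -> `|x| <= L.
Proof.
move=> L0 LQ xQ; apply: le_trans (norm_le_enorm x) _.
by rewrite enorm_le // LQ.
Qed.

(** Thin strips along the boundary have measure of the order of their width,
    uniformly in how much of the boundary itself is left out: integrate by
    parts th(rho) times grad rho, whose divergence is at least |grad rho|^2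
    on the strip up to an error bounded by th. *)
Lemma strip_bound Om rho (Q L : R) : open Om -> Ck 2 setT rho -> 0 <= L ->
  L ^+ 2 = Q + 1 ->
  (forall x, Om x -> `|x| <= L -> 0 < rho x) ->
  (forall x, boundary Om x -> `|x| <= L -> rho x = 0) ->
  (forall x, boundary Om x -> `|x| <= L -> grad rho x != 0) ->
  exists C d0 : R, [/\ 0 < C, 0 < d0 & forall kap d : R, 0 < kap -> 0 < d ->
    d <= d0 -> \forall m \near \oo,
    gsum m \1_[set x | Om x /\ dot x x <= Q /\ kap <= rho x <= d] <= C * d].
Proof.
move=> oO Cr L0 LQ Hpos Hzero Hgrad.
have C1 := Ck_pred Cr; have C0 := Ck_pred C1.
pose g2 x := \sum_i partial i rho x * partial i rho x.
have Cg2 : Ck 1 setT g2.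
  apply: Ck_sum => [|i]; first exact: openT.
  by apply: Ck_mul; [exact: openT|exact: Ck_partial Cr|exact: Ck_partial Cr].
have g2E x : g2 x = dot (grad rho x) (grad rho x).
  by apply: eq_bigr => i _; rewrite mxE.
have g2ge0 x : 0 <= g2 x by rewrite g2E dot_ge0.
have cg2 x : {for x, continuous g2} by exact: Ck_continuous Cg2 I.
pose K := closure Om `&` [set x : 'rV[R]_n | `|x| <= L].
have cK : compact K := compact_closure_ball Om L.
pose Kb := core Om (fun x => - rho x) L 0 .
have cKb : compact Kb by apply: compact_core; apply: Ck_opp => //; exact: openT.
have Kbb x : Kb x -> boundary Om x /\ `|x| <= L.
  move=> [[cx xL] /= r0]; split=> //; have [Ox|//] := closure_cases cx.
  by have := Hpos x Ox xL; lra.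
have bKb x : boundary Om x -> `|x| <= L -> Kb x.
  by move=> bx xL; split; [split=> //; exact: bx.1|rewrite /= Hzero // oppr0].
have [m0 m00 Hm0] : exists2 c : R, 0 < c & forall x, Kb x -> c <= g2 x.
  apply: compact_lower_bound => // x /Kbb[bx xL].
  by rewrite g2E dot_gt0 // Hgrad.
have [d0 d00 Hd0] : exists2 d : R, 0 < d & forall x, K x -> Om x -> rho x <= d ->
    m0 / 2 <= g2 x.
  apply: near_zero_set => //; first by move=> x _; exact: Ck_continuous C0 I.
  move=> x [cx xL]; have [Ox|bx] := closure_cases cx; first by left; exact: Hpos.
  right; have gx := Hm0 x (bKb x bx xL).
  have : \forall y \near x, m0 / 2 < g2 y.
    have := cg2 x; rewrite /continuous_at => /(_ (fun t => m0 / 2 < t)).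
    by apply; apply: lt_nbhsr; lra.
  by apply: filterS => y /ltW.
(* at least 1 where dot x x <= Q since L ^+ 2 = Q + 1, and zero beyond L *)
pose om := bump (0 : 'rV[R]_n) L.
have Com2 : Ck 2 setT om := Ck_bump 0 L.
have Com : Ck 1 setT om := Ck_pred Com2.
have om0 x : L < `|x| -> om x = 0.
  move=> xL; apply/eqP; rewrite eq_le bump_ge0 andbT leNgt bump_gt0 subr0 -leNgt.
  rewrite leNgt; apply/negP => h.
  by have := norm_le_dot L0 erefl (ltW h); lra.
have om1 x : dot x x <= Q -> 1 <= om x.
  move=> xQ; rewrite /om /bump subr0 LQ pospart_ge0E; last by lra.
  by rewrite exprn_ege1 //; lra.
pose E x := \sum_i (om x * partial i (partial i rho) x + partial i om x * partial i rho x).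
have [C2 C20 HC2] : exists2 C : R, 0 < C & forall x, `|x| <= L -> `|E x| <= C.
  have cE : forall x, [set x : 'rV[R]_n | `|x| <= L] x ->
      {for x, continuous (fun x => `|E x|)}.
    move=> x _; apply: (@continuous_comp _ _ _ E (fun t : R => `|t|)); last exact: norm_continuous.
    apply: (@Ck_continuous _ _ 0 setT) => //; apply: Ck_sum => [|i]; first exact: openT.
    apply: Ck_add; first exact: openT.
      apply: Ck_mul; first exact: openT.
        exact: Ck_pred.
      exact: Ck_partial (Ck_partial i Cr).
    apply: Ck_mul; first exact: openT.
      exact: Ck_partial Com.
    exact: Ck_partial C1.
  have [C C0' HC] := compact_upper_bound (compact_ball L) cE.
  by exists C => // x xL; exact: HC.
pose V : R := (2 * L + 2) ^+ n.
have V0 : 0 < V by rewrite exprn_gt0 //; lra.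
exists ((1 + 6 * C2 * V) / (m0 / 2)), d0; split=> //.
  by rewrite divr_gt0 //; [rewrite addr_gt0 // !mulr_gt0|lra].
move=> kap d k0 dp dd0.
have [th [dth [Hth cdth th0 Hth2]]] := strip_profile k0 dp.
have Cth : Ck 1 setT (fun x => th (rho x)).
  pose G j := if j is 0%N then th else dth.
  apply: (@Ck_comp R n 1 setT rho G) => //; first exact: openT.
    by move=> [|//] x _ _; exact: Hth.
  move=> [|j] x _ _; last exact: cdth.
  have [dt _] := Hth (rho x).
  exact: differentiable_continuous ((derivable1_diffP _ _).1 dt).
pose F i x := th (rho x) * (om x * partial i rho x).
have Com' i : Ck 1 setT (fun x => om x * partial i rho x).
  by apply: Ck_mul; [exact: openT|exact: Com|exact: Ck_partial Cr].
have CF i : Ck 1 setT (F i) := Ck_mul openT Cth (Com' i).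
have k20 : 0 < kap / 2 by lra.
have HF : forall i x, Om x -> ~ core Om rho L (kap / 2) x -> F i x = 0.
  move=> i x Ox nK; rewrite /F; have [xL|xL] := lerP `|x| L; last first.
    by rewrite om0 // mul0r mulr0.
  rewrite th0 ?mul0r // leNgt; apply/negP => xk; apply: nK.
  by split; [split=> //; exact: subset_closure|exact: ltW].
have := gsum_divergence oO (compact_core Om L (kap / 2) C0)
  (core_sub k20 Hzero) (fun i => Ck_sub (@subsetT _ Om) (CF i)) HF dp.
apply: filterS => m Hm.
have divE x : \sum_i partial i (F i) x = th (rho x) * E x + dth (rho x) * (om x * g2 x).
  rewrite /E /g2 !mulr_sumr -big_split; apply: eq_bigr => i _ /=.
  have d1 := Ck_derivable i Cth (I : setT x).
  have d2 := Ck_derivable i (Com' i) (I : setT x).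
  rewrite /F (partialM d1 d2).
  rewrite (partialM (Ck_derivable i Com (I : setT x)) (Ck_derivable i (Ck_partial i Cr) (I : setT x))).
  have [_ ->] := partial_comp (Ck_derivable i C1 (I : setT x)) (Hth (rho x)).
  ring.
pose S := [set x | Om x /\ dot x x <= Q /\ kap <= rho x <= d].
pose B := [set x : 'rV[R]_n | `|x| <= L].
have pw x : m0 / 2 * \1_S x <= \1_Om x * (\sum_i partial i (F i) x) + 6 * d * C2 * \1_B x.
  rewrite !indicE; have [Ox|nOx] := pselect (Om x); last first.
    rewrite (memNset nOx) mul0r add0r (@memNset _ S) ?mulr0; last by move=> [].
    by rewrite mulr_ge0 // !mulr_ge0 ?(ltW dp) ?(ltW C20).
  rewrite (mem_set Ox) mul1r divE.
  have [t0 t6 dt0 dt1] := Hth2 (rho x).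
  have omg : 0 <= om x * g2 x by rewrite mulr_ge0 // bump_ge0.
  have dtm : 0 <= dth (rho x) * (om x * g2 x) by rewrite mulr_ge0.
  have [xL|xL] := lerP `|x| L; last first.
    rewrite (@memNset _ S) ?(@memNset _ B); last 2 first.
    - by rewrite /B /= leNgt xL.
    - move=> [_ [xQ _]]; have : dot x x <= Q + 1 by lra.
      by move=> /(norm_le_dot L0 LQ); lra.
    rewrite !mulr0 addr0 (om0 _ xL) mul0r mulr0 addr0.
    rewrite /E (om0 _ xL) big1 ?mulr0 // => i _.
    have -> : partial i om x = 0.
      by have /rowP/(_ i) := grad_bump0 (om0 _ xL); rewrite !mxE.
    by rewrite !mul0r addr0.
  rewrite (@mem_set _ B) // mulr1.
  have tE : - (6 * d * C2) <= th (rho x) * E x.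
    have : `|th (rho x) * E x| <= 6 * d * C2.
      rewrite normrM (ger0_norm t0); apply: ler_pM => //; exact: HC2.
    by rewrite ler_norml => /andP[].
  case: (boolP (x \in S)) => [/set_mem [_ [xQ /andP[xk xd]]]|_];
    last by rewrite mulr0; lra.
  have h1 : 1 <= dth (rho x) by apply: dt1; rewrite xk xd.
  have h2 := om1 x xQ.
  have h3 : m0 / 2 <= g2 x.
    by apply: Hd0 => //; [split=> //; exact: subset_closure|exact: le_trans dd0].
  have h4 : m0 / 2 <= om x * g2 x by apply: le_trans h3 _; rewrite ler_peMl.
  have h5 : om x * g2 x <= dth (rho x) * (om x * g2 x) by rewrite ler_peMl.
  by rewrite mulr1; lra.
have := ler_gsum m pw.
rewrite gsumZ gsumD gsumZ => h.
have hB := @gsum_normball R n L m L0.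
have hD := le_trans (ler_norm _) Hm.
have h2 : m0 / 2 * gsum m \1_S <= d + 6 * d * C2 * V.
  apply: le_trans h _; apply: lerD => //.
  by rewrite ler_wpM2l // !mulr_ge0 ?(ltW dp) ?(ltW C20).
rewrite mulrAC ler_pdivlMr; last by lra.
by rewrite mulrC; apply: le_trans h2 _; rewrite le_eqVlt; apply/orP; left; apply/eqP; ring.
Qed.

End Strip.
Arguments compact_core {R n} Om {rho} L kap _.

(** * Logarithmic cut-offs *)
Section LogCutoff.
Context {R : realType} {n : nat}.
Implicit Types (x y v w : 'rV[R]_n) (D K Om : set 'rV[R]_n).

(** Linear, up to smoothing, in the logarithm of 1 + |x|^2: it falls from 1 at
    the value a of this logarithm to 0 at the value a + N + 1. *)
Definition logcut (a N : nat) x : R := 1 - step ((ln (1 + dot x x) - a%:R) / N.+1%:R).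

Lemma is_derive_lnstep (a N : nat) (t : R) : 0 < t ->
  is_derive t (1 : R) (fun t => 1 - step ((ln t - a%:R) / N.+1%:R))
    (- (dstep ((ln t - a%:R) / N.+1%:R) * (t^-1 / N.+1%:R))).
Proof.
move=> t0.
have h : is_derive t (1 : R) (fun t => (ln t - a%:R) / N.+1%:R) (t^-1 / N.+1%:R).
  rewrite (_ : (fun t => _) = N.+1%:R^-1 \*: ((@ln R) - cst a%:R)); last first.
    by apply/funext => s /=; rewrite mulrC.
  have hl := is_derive1_ln t0.
  apply: is_derive_eq; rewrite subr0 mulrC; exact: erefl.
have h2 := @is_derive1_comp R step _ t _ _ (is_derive_step _) h.
rewrite (_ : (fun t => _) = cst 1 - (fun t => step ((ln t - a%:R) / N.+1%:R))) //.
by apply: is_derive_eq; rewrite sub0r.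
Qed.

Lemma Ck_logcut a N : Ck 1 setT (logcut a N).
Proof.
pose G (j : nat) (t : R) : R := if j is 0%N
  then 1 - step ((ln t - a%:R) / N.+1%:R)
  else - (dstep ((ln t - a%:R) / N.+1%:R) * (t^-1 / N.+1%:R)).
have p0 x : 0 < 1 + dot x x by have := dot_ge0 x; lra.
apply: (@Ck_comp R n 1 setT (fun x => 1 + dot x x) G); first exact: openT.
- by move=> [|//] x _ _; exact: is_derive_lnstep.
- move=> j x _ _.
  have ct (f : R -> R) df : is_derive (1 + dot x x) (1 : R) f df ->
      {for 1 + dot x x, continuous f}.
    by move=> [dt _]; exact: differentiable_continuous ((derivable1_diffP _ _).1 dt).
  case: j => [|j]; first exact: ct (is_derive_lnstep a N (p0 x)).
  have cl : {for 1 + dot x x, continuous (@ln R)} := ct _ _ (is_derive1_ln (p0 x)).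
  have c1 : {for 1 + dot x x, continuous (fun t => (ln t - a%:R) / N.+1%:R)}.
    apply: (@continuousM _ _ (fun t => ln t - a%:R) (cst N.+1%:R^-1)); last exact: cst_continuous.
    by apply: continuousB => //; exact: cst_continuous.
  have c2 : {for 1 + dot x x, continuous (fun t => dstep ((ln t - a%:R) / N.+1%:R))}.
    by apply: (@continuous_comp _ _ _ (fun t => (ln t - a%:R) / N.+1%:R) dstep) => //; exact: continuous_dstep.
  have c3 : {for 1 + dot x x, continuous (fun t : R => t^-1 / N.+1%:R)}.
    apply: (@continuousM _ _ (fun t : R => t^-1) (cst N.+1%:R^-1)); last exact: cst_continuous.
    by apply: continuousV; [rewrite gt_eqF|exact: continuous_idR].
  have c4 := continuousM c2 c3.
  by apply: continuousN.
- apply: Ck_add; first exact: openT.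
    exact: Ck_cst.
  apply: (Ck_eq openT _ (Ck_dist2 1 0)) => x _; by rewrite subr0.
Qed.

Lemma logcut_itv a N x : 0 <= logcut a N x <= 1.
Proof.
rewrite /logcut; have /andP[h1 h2] := step_itv ((ln (1 + dot x x) - a%:R) / N.+1%:R).
by apply/andP; split; lra.
Qed.

Lemma logcut_eq1 a N x : 1 + dot x x <= expR a%:R -> logcut a N x = 1.
Proof.
move=> h; rewrite /logcut step_le0 ?subr0 // pmulr_lle0 ?invr_gt0 ?ltr0n // subr_le0.
by rewrite -[leRHS]expRK ler_ln ?posrE ?expR_gt0 //; have := dot_ge0 x; lra.
Qed.

Lemma logcut_eq0 a N x : expR (a + N.+1)%:R <= 1 + dot x x -> logcut a N x = 0.
Proof.
move=> h; rewrite /logcut step_ge1 ?subrr // ler_pdivlMr ?ltr0n // mul1r lerBrDl.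
rewrite -natrD -[leLHS]expRK ler_ln ?posrE ?expR_gt0 //; have := dot_ge0 x; lra.
Qed.

Lemma grad_logcut a N x : grad (logcut a N) x =
  (- (dstep ((ln (1 + dot x x) - a%:R) / N.+1%:R) * ((1 + dot x x)^-1 / N.+1%:R)) * 2) *: x.
Proof.
have p0 : 0 < 1 + dot x x by have := dot_ge0 x; lra.
have Cf : Ck 1 setT (fun x : 'rV[R]_n => 1 + dot x x).
  apply: Ck_add; first exact: openT.
    exact: Ck_cst.
  by apply: (Ck_eq openT _ (Ck_dist2 1 0)) => y _; rewrite subr0.
have := grad_comp (fun j => Ck_derivable j Cf (I : setT x)) (is_derive_lnstep a N p0).
rewrite /logcut => ->; rewrite -scalerA; congr (_ *: _).
apply/rowP => i; rewrite !mxE.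
have dd j k : derivable (fun y : 'rV[R]_n => y 0 j * y 0 j) x (ebasis k).
  by have [d _] := is_derive_coord j x (ebasis k); exact: derivableM.
have dc j : derivable (fun y : 'rV[R]_n => y 0 j) x (ebasis i).
  by have [d _] := is_derive_coord j x (ebasis i).
rewrite partialD; last 2 first.
- exact: derivable_cst.
- apply: (@Ck_derivable _ _ 0 setT) => //.
  by apply: (Ck_eq openT _ (Ck_dist2 1 0)) => y _; rewrite subr0.
rewrite /partial derive_cst add0r.
have -> : (fun y : 'rV[R]_n => dot y y) = \sum_j (fun y : 'rV[R]_n => y 0 j * y 0 j).
  by apply/funext => y; rewrite fct_sumE.
rewrite derive_sum; last by move=> j; exact: dd.
have E j : 'D_(ebasis i) (fun y : 'rV[R]_n => y 0 j * y 0 j) x = 2 * x 0 j * (i == j)%:R.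
  have := partialM (dc j) (dc j); rewrite /partial => ->.
  by have := partial_coord i j x; rewrite /partial => ->; ring.
rewrite (eq_bigr _ (fun j _ => E j)) (bigD1 i) //= eqxx mulr1 big1 ?addr0 // => j ji.
by rewrite eq_sym (negbTE ji) mulr0.
Qed.

Lemma grad_logcut_eq0 a N x : expR (a + N.+1)%:R <= 1 + dot x x ->
  grad (logcut a N) x = 0.
Proof.
move=> h; rewrite grad_logcut dstep_ge1 ?mul0r ?oppr0 ?mul0r ?scale0r //.
rewrite ler_pdivlMr ?ltr0n // mul1r lerBrDl.
rewrite -natrD -[leLHS]expRK ler_ln ?posrE ?expR_gt0 //; have := dot_ge0 x; lra.
Qed.

Lemma grad_logcut_le a N x (k : nat) :
  k%:R <= ln (1 + dot x x) ->
  dot (grad (logcut a N) x) (grad (logcut a N) x) <= 16 / N.+1%:R ^+ 2 * expR (- k%:R).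
Proof.
move=> kx; have d0 := dot_ge0 x; have p0 : 0 < 1 + dot x x by lra.
rewrite grad_logcut dotZl dotZr.
set s := dstep _; have /andP[s0 s2] : 0 <= s <= 2 by exact: dstep_itv.
set q := (1 + dot x x)^-1; set M := N.+1%:R : R.
have M0 : 0 < M by rewrite /M ltr0n.
have q0 : 0 < q by rewrite invr_gt0.
have qx : q * dot x x <= 1.
  by rewrite /q mulrC ler_pdivrMr // mul1r lerDr.
have qk : q <= expR (- k%:R).
  rewrite /q expRN lef_pV2 ?posrE ?expR_gt0 //.
  by rewrite -[leRHS]lnK ?posrE // ler_expR.
have -> : - (s * (q / M)) * 2 * (- (s * (q / M)) * 2 * dot x x) =
   (s ^+ 2 * 4 / M ^+ 2) * (q * (q * dot x x)) by field; rewrite gt_eqF.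
apply: ler_pM.
- by rewrite divr_ge0 ?exprn_ge0 ?(ltW M0) // mulr_ge0 ?exprn_ge0.
- by rewrite !mulr_ge0 // ltW.
- rewrite ler_wpM2r ?invr_ge0 ?exprn_ge0 ?(ltW M0) //.
  by nra.
- by apply: le_trans qk; rewrite ler_piMr // ltW.
Qed.

(** The shell where the logarithm of 1 + |x|^2 is between k and k + 1 has volume
    at most of order e^k, while the squared gradient there is at most of order
    e^(-k) / N^2: each of the roughly N shells contributes order 1 / N^2. *)
Lemma log_cutoff_energy Om (C tau M : R) :
  (\forall r \near +oo,
    (lebesgue_n (Om `&` [set x | (enorm x <= r)%R]) <= (C * r ^+ 2)%:E)%E) ->
  0 < tau -> exists a N : nat, M <= expR a%:R /\
    forall K, compact K -> K `<=` Om -> \forall m \near \oo,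
      gsum m (fun x => \1_K x * dot (grad (logcut a N) x) (grad (logcut a N) x)) <= tau.
Proof.
move=> [M0 [_ HM0]] tau0.
pose C' := `|C| + 1; have C'0 : 0 < C' by rewrite ltr_pwDr.
have [a Ha] : exists a : nat, `|M| + 2 * `|M0| < a%:R.
  have := @nbhs_infty_gtr R (`|M| + 2 * `|M0|).
  by move=> /(@filter_ex _ _ _)[a]; exists a.
have [N HN] : exists N : nat, 32 * C' * expR 1 / tau < N%:R.
  have := @nbhs_infty_gtr R (32 * C' * expR 1 / tau).
  by move=> /(@filter_ex _ _ _)[N]; exists N.
exists a, N; split.
  have := expR_ge1Dx (a%:R : R); have := ler_norm M; have := normr_ge0 M0; lra.
move=> K cK KO.
have clK : closed K := compact_closed (@norm_hausdorff _ _) cK.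
pose Kk (k : nat) := K `&` [set x : 'rV[R]_n | 1 + dot x x <= expR k.+1%:R].
have cKk k : compact (Kk k).
  have cl : closed (Kk k).
    apply: closedI => //.
    rewrite (_ : [set x | _] = (fun x : 'rV[R]_n => 1 + dot x x) @^-1` [set t | t <= expR k.+1%:R]) //.
    apply: preimage_closed; last exact: closed_le.
    move=> x _; apply: (@Ck_continuous _ _ 0 setT) => //; apply: Ck_add; first exact: openT.
      exact: Ck_cst.
    by apply: (Ck_eq openT _ (Ck_dist2 0 0)) => y _; rewrite subr0.
  by have := subclosed_compact cl cK (@subIsetl _ _ _); exact.
have vol k : (a <= k)%N -> \forall m \near \oo, gsum m \1_(Kk k) <= C' * expR k.+1%:R.
  move=> ak; pose r := expR (k.+1%:R / 2 : R).
  have rr : r ^+ 2 = expR k.+1%:R.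
    by rewrite -expRM_natl; congr expR; field.
  have rM : M0 < r.
    have := expR_ge1Dx (k.+1%:R / 2 : R); have := ler_norm M0; rewrite -/r.
    have : a%:R <= k.+1%:R :> R by rewrite ler_nat ltnW.
    have := normr_ge0 M; have := Ha; lra.
  have sub : Kk k `<=` Om `&` [set x | enorm x <= r].
    move=> x [Kx /= xr]; split; first exact: KO.
    by rewrite /= enorm_le ?expR_ge0 // rr; lra.
  have V : (lebesgue_n (Om `&` [set x | (enorm x <= r)%R]) <= (`|C| * expR k.+1%:R)%:E)%E.
    apply: le_trans (HM0 r rM) _; rewrite lee_fin rr ler_wpM2r ?expR_ge0 //.
    exact: ler_norm.
  have := gsum_compact_le (cKk k) sub V (expR_gt0 k.+1%:R).
  by apply: filterS => m /le_trans; apply; rewrite /C' mulrDl mul1r.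
have volall : \forall m \near \oo, forall j : 'I_N.+2,
    gsum m \1_(Kk (a + j)%N) <= C' * expR (a + j).+1%:R.
  by apply: filter_forall => j; apply: vol; exact: leq_addr.
apply: filterS volall => m Hm.
have pw x : \1_K x * dot (grad (logcut a N) x) (grad (logcut a N) x) <=
  \sum_(j < N.+2) (16 / N.+1%:R ^+ 2 * expR (- (a + j)%:R)) * \1_(Kk (a + j)%N) x.
  have rhs0 : 0 <= \sum_(j < N.+2) (16 / N.+1%:R ^+ 2 * expR (- (a + j)%:R)) * \1_(Kk (a + j)%N) x :> R.
    apply: sumr_ge0 => j _; by rewrite indicE mulr_ge0 // mulr_ge0 ?expR_ge0.
  rewrite {1}indicE; case: (boolP (x \in K)) => [/set_mem Kx|_]; last by rewrite mul0r.
  rewrite mul1r; have d0 := dot_ge0 x; have p0 : 0 < 1 + dot x x by lra.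
  have t0 : 0 <= ln (1 + dot x x) by rewrite ln_ge0 //; lra.
  have [xN|xN] := lerP (expR (a + N.+1)%:R) (1 + dot x x).
    by rewrite grad_logcut_eq0 // /dot big1 // => i _; rewrite mxE mul0r.
  have [ax|ax] := lerP (1 + dot x x) (expR a%:R).
    have -> : grad (logcut a N) x = 0.
      rewrite grad_logcut dstep_le0 ?mul0r ?oppr0 ?mul0r ?scale0r //.
      rewrite pmulr_lle0 ?invr_gt0 ?ltr0n // subr_le0.
      by rewrite -[leRHS]expRK ler_ln ?posrE ?expR_gt0.
    by rewrite /dot big1 // => i _; rewrite mxE mul0r.
  have /andP[k1 k2] := truncn_itv t0.
  set k := Num.trunc _ in k1 k2.
  have ka : (a <= k)%N.
    rewrite -ltnS -(ltr_nat R); apply: le_lt_trans k2.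
    by rewrite -[leLHS]expRK ler_ln ?posrE ?expR_gt0 // ltW.
  have kN : (k - a < N.+2)%N.
    rewrite ltn_subLR // addnS ltnS -(ler_nat R); apply: le_trans k1 _.
    by rewrite -[leRHS]expRK ler_ln ?posrE ?expR_gt0 // ltW.
  rewrite (bigD1 (Ordinal kN)) //= subnKC //.
  apply: (@le_trans _ _ (16 / N.+1%:R ^+ 2 * expR (- k%:R) * \1_(Kk k) x)); last first.
    rewrite lerDl; apply: sumr_ge0 => j _; by rewrite indicE mulr_ge0 // mulr_ge0 ?expR_ge0.
  rewrite indicE mem_set ?mulr1; first exact: grad_logcut_le.
  by split=> //=; rewrite -[leLHS]lnK ?posrE // ler_expR ltW.
apply: le_trans (ler_gsum m pw) _; rewrite gsum_sum.
have N0 : 0 < N.+1%:R :> R by rewrite ltr0n.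
apply: (@le_trans _ _ (\sum_(j < N.+2) 16 / N.+1%:R ^+ 2 * (C' * expR 1))).
  apply: ler_sum => j _; rewrite gsumZ -[leLHS]mulrA; apply: ler_wpM2l.
    by rewrite divr_ge0 // exprn_ge0.
  apply: (@le_trans _ _ (expR (- (a + j)%:R) * (C' * expR (a + j).+1%:R))).
    by rewrite ler_wpM2l ?expR_ge0.
  by rewrite mulrCA -expRD -[X in expR (_ + X)]natr1 addKr.
rewrite sumr_const card_ord -[_ *+ _]mulr_natl.
have N2 : N.+2%:R <= 2 * N.+1%:R :> R by rewrite -natrM ler_nat mul2n -addnn addSn ltnS leq_addl.
apply: (@le_trans _ _ (2 * N.+1%:R * (16 / N.+1%:R ^+ 2 * (C' * expR 1)))).
  by apply: ler_wpM2r => //; rewrite mulr_ge0 ?mulr_ge0 ?expR_ge0 ?(ltW C'0).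
have -> : 2 * N.+1%:R * (16 / N.+1%:R ^+ 2 * (C' * expR 1)) = 32 * C' * expR 1 / N.+1%:R.
  by field; rewrite gt_eqF.
rewrite ler_pdivrMr //; move: HN; rewrite ltr_pdivrMr // => /ltW/le_trans; apply.
by rewrite mulrC ler_pM2l // ler_nat.
Qed.

End LogCutoff.

(** * The flux at the boundary *)
Section BoundaryFlux.
Context {R : realType} {n : nat}.
Implicit Types (u phi psi rho : 'rV[R]_n -> R) (x y v w : 'rV[R]_n) (Om : set 'rV[R]_n).
Implicit Types (A : 'rV[R]_n -> 'M[R]_n).

Lemma cvg_rV (T : Type) (F : set_system T) {FF : Filter F} (f : T -> 'rV[R]_n) v :
  (forall i, (fun t => f t 0 i) @ F --> v 0 i) -> f @ F --> v.
Proof.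
move=> H; apply/cvgrPdist_le => e e0.
have : \forall t \near F, forall i, `|v 0 i - f t 0 i| <= e.
  by apply: filter_forall => i; have /cvgrPdist_le := H i; apply.
by apply: filterS => t Ht; apply: normv_le; [exact: ltW|move=> i; rewrite !mxE].
Qed.

Lemma cvg_sum_seq (T I : Type) (F : set_system T) {FF : Filter F} (r : seq I)
  (f : I -> T -> R) (l : I -> R) :
  (forall i, f i @ F --> l i) ->
  (fun t => \sum_(i <- r) f i t) @ F --> \sum_(i <- r) l i.
Proof.
move=> H; elim: r => [|i r IH].
  rewrite big_nil (_ : (fun t => _) = cst 0); first exact: cvg_cst.
  by apply/funext => t; rewrite big_nil.
rewrite big_cons (_ : (fun t => _) = (fun t => f i t + \sum_(i <- r) f i t)).
  by apply: cvgD; [exact: H|exact: IH].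
by apply/funext => t; rewrite big_cons.
Qed.

Lemma cvg_dot (T : Type) (F : set_system T) {FF : Filter F} (f g : T -> 'rV[R]_n) v w :
  f @ F --> v -> g @ F --> w -> (fun t => dot (f t) (g t)) @ F --> dot v w.
Proof.
move=> fv gw; apply: cvg_sum_seq => i.
have coord (h : T -> 'rV[R]_n) (z : 'rV[R]_n) : h @ F --> z -> (fun t => h t 0 i) @ F --> z 0 i.
  move=> hz; apply: (@cvg_comp _ _ _ h (fun M : 'rV[R]_n => M 0 i) F (nbhs z)) => //.
  exact: coord_continuous.
by apply: cvgM; exact: coord.
Qed.

Lemma flux_cvg (a : R) Om A u x : 0 < a -> closure Om x ->
  (forall i j, Cka 1 a Om (fun x => A x i j)) -> Cka 2 a Om u ->
  exists (b : R) (v : 'rV[R]_n), [/\ u @ within Om (nbhs x) --> b,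
      (fun y => mxact (A y) (grad u y)) @ within Om (nbhs x) --> v,
      bval Om u x = b & bval Om (fun y => mxact (A y) (grad u y)) x = v].
Proof.
move=> a0 cx CA Cu; have PF := within_nbhs_proper cx.
have cvu : cvg (u @ within Om (nbhs x)) := holder_cvg a0 Cu.1 cx.
have [v Hv] : exists v, (fun y => mxact (A y) (grad u y)) @ within Om (nbhs x) --> v.
  exists (\row_i \sum_j lim ((fun y => A y i j) @ within Om (nbhs x)) *
    lim (partial j u @ within Om (nbhs x))).
  apply: cvg_rV => i; rewrite mxE.
  rewrite (_ : (fun t => _) = (fun y => \sum_j A y i j * partial j u y)); last first.
    by apply/funext => y; rewrite mxactE; apply: eq_bigr => j _; rewrite mxE.
  apply: cvg_sum_seq => j; apply: cvgM.
    exact: (holder_cvg a0 (CA i j).1 cx).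
  by have [_ [hu _]] := Cu.2 j; exact: (holder_cvg a0 hu cx).
exists (lim (u @ within Om (nbhs x))), v; split=> //.
by rewrite /bval; exact: cvg_lim Hv.
Qed.

(** On the boundary the flux phi A grad psi - psi A grad phi has no normal
    component: each term is gamma phi psi for Robin conditions, and each
    factor phi, psi vanishes for Dirichlet conditions. *)
Lemma boundary_flux_vanishes (a : R) Om A (bc : boundary_condition R n) phi psi rho x :
  (0 < n)%N -> 0 < a -> smooth_domain a Om ->
  (forall i j, Cka 1 a Om (fun x => A x i j)) ->
  Cka 2 a Om phi -> Cka 2 a Om psi -> boundary Om x ->
  boundary_op Om A bc phi x = 0 -> boundary_op Om A bc psi x = 0 ->
  Ck 1 setT rho ->
  (forall s, Ck 1 setT s -> defining_at Om s x -> grad s x != 0 ->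
     exists2 k : R, 0 < k & grad rho x = k *: grad s x) ->
  forall tau : R, 0 < tau -> \forall y \near x, Om y ->
    `|phi y * dot (grad rho y) (mxact (A y) (grad psi y)) -
      psi y * dot (grad rho y) (mxact (A y) (grad phi y))| <= tau.
Proof.
move=> n0 a0 sm CA Cphi Cpsi bx b1 b2 Crho Hrho tau tau0.
have PF := within_nbhs_proper bx.1.
have [fb [fa [f1 f2 fbE faE]]] := flux_cvg a0 bx.1 CA Cphi.
have [gb [ga [g1 g2 gbE gaE]]] := flux_cvg a0 bx.1 CA Cpsi.
set F := within Om (nbhs x) in PF f1 f2 g1 g2.
have gr : grad rho @ F --> grad rho x.
  apply: cvg_rV => i; rewrite mxE.
  rewrite (_ : (fun t => _) = partial i rho); last by apply/funext => y; rewrite mxE.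
  have c : partial i rho @ nbhs x --> partial i rho x by exact: Ck_continuous (Ck_partial i Crho) I.
  by apply: cvg_trans c; apply: cvg_app; exact: cvg_within.
pose l := fb * dot (grad rho x) ga - gb * dot (grad rho x) fa.
have W : (fun y => phi y * dot (grad rho y) (mxact (A y) (grad psi y)) -
      psi y * dot (grad rho y) (mxact (A y) (grad phi y))) @ F --> l.
  have FF : Filter F by exact: within_filter.
  have w1 : (fun y => dot (grad rho y) (mxact (A y) (grad psi y))) @ F -->
    dot (grad rho x) ga by exact: cvg_dot gr g2.
  have w2 : (fun y => dot (grad rho y) (mxact (A y) (grad phi y))) @ F -->
    dot (grad rho x) fa by exact: cvg_dot gr f2.
  exact: (cvgB (cvgM f1 w1) (cvgM g1 w2)).
have l0 : l = 0.
  rewrite /l; case: bc b1 b2 => [|gamma] /=.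
    by rewrite fbE gbE => -> ->; rewrite !mul0r subrr.
  rewrite fbE gbE faE gaE => e1 e2.
  have [s [k [Cs ds gs0 k0 nu]]] := outer_normal_gradient n0 a0 sm bx.
  have [k' k'0 rE] := Hrho s Cs ds gs0.
  have E z : dot (grad rho x) z = - (k' / k) * dot (outer_normal Om x) z.
    by rewrite rE nu dotNl !dotZl; field; rewrite gt_eqF.
  rewrite !E.
  set P := dot _ ga in e2 *; set Q := dot _ fa in e1 *.
  have -> : P = - (gamma x * gb) by lra.
  have -> : Q = - (gamma x * fb) by lra.
  by ring.
have := W; rewrite l0 => /cvgrPdist_le /(_ tau tau0).
move=> H; have {}H : \forall y \near x, Om y ->
    `|0 - (phi y * dot (grad rho y) (mxact (A y) (grad psi y)) -
      psi y * dot (grad rho y) (mxact (A y) (grad phi y)))| <= tau by exact: H.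
by apply: filterS H => y H Oy; have := H Oy; rewrite sub0r normrN.
Qed.

End BoundaryFlux.

(** * Picone's identity *)
Section Picone.
Context {R : realType} {n : nat}.
Implicit Types (u psi Z eta c : 'rV[R]_n -> R) (x y v w : 'rV[R]_n) (Om : set 'rV[R]_n).
Implicit Types (A : 'rV[R]_n -> 'M[R]_n) (B : 'rV[R]_n -> 'rV[R]_n).

Lemma posdef_unitmx (M : 'M[R]_n) (lb : R) : M^T = M -> 0 < lb ->
  (forall v, lb * dot v v <= dot v (mxact M v)) -> M \in unitmx.
Proof.
move=> MT lb0 H; rewrite unitmxE unitfE; apply/negP => /det0P[v v0 vM].
have := H v; rewrite /mxact MT vM.
have -> : dot v 0 = 0 by rewrite /dot big1 // => i _; rewrite mxE mulr0.
by rewrite leNgt mulr_gt0 // dot_gt0.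
Qed.

Lemma mxact_invmx (M : 'M[R]_n) v : M \in unitmx -> mxact M (mxact (invmx M) v) = v.
Proof.
by move=> uM; rewrite /mxact -mulmxA -trmx_mul mulmxV // trmx1 mulmx1.
Qed.

(** The i-th component of exp(- eta) A grad u. *)
Definition wflux A eta u (i : 'I_n) : 'rV[R]_n -> R :=
  fun y => expR (- eta y) * \sum_j A y i j * partial j u y.

Lemma Ck_expR k Om (f : 'rV[R]_n -> R) : open Om -> Ck k Om f ->
  Ck k Om (fun y => expR (f y)).
Proof.
move=> oO Cf; apply: (@Ck_comp R n k Om f (fun _ => @expR R)) => //.
by move=> j x _ _; exact: continuous_expR.
Qed.

Lemma Ck_wflux A eta u i Om : open Om -> (forall i j, Ck 1 Om (fun y => A y i j)) ->
  Ck 1 Om eta -> Ck 2 Om u -> Ck 1 Om (wflux A eta u i).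
Proof.
move=> oO CA Ce Cu; apply: (Ck_mul oO); first exact: (Ck_expR oO (Ck_opp oO Ce)).
by apply: (Ck_sum _ oO) => j; exact: (Ck_mul oO (CA i j) (Ck_partial j Cu)).
Qed.

Lemma wfluxE A eta u i x :
  wflux A eta u i x = expR (- eta x) * mxact (A x) (grad u x) 0 i.
Proof. by rewrite /wflux mxactE; congr (_ * _); apply: eq_bigr => j _; rewrite mxE. Qed.

(** The exponential weight absorbs the drift, since A grad eta = -B: in
    divergence form the operator is self-adjoint for the weight exp(-eta). *)
Lemma wflux_divergence A B c eta u Om x : open Om -> Om x ->
  (forall i j, Ck 1 Om (fun y => A y i j)) -> Ck 1 Om eta -> Ck 2 Om u ->
  (A x)^T = A x -> A x \in unitmx -> grad eta x = - mxact (invmx (A x)) (B x) ->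
  \sum_i partial i (wflux A eta u i) x =
  - expR (- eta x) * (elliptic_op A B c u x + c x * u x).
Proof.
move=> oO Ox CA Ce Cu AT uA ge.
pose f i y := \sum_j A y i j * partial j u y.
have Cf i : Ck 1 Om (f i).
  by apply: (Ck_sum _ oO) => j; exact: (Ck_mul oO (CA i j) (Ck_partial j Cu)).
have Cw : Ck 1 Om (fun y => expR (- eta y)) := Ck_expR oO (Ck_opp oO Ce).
have dw i : partial i (fun y => expR (- eta y)) x = - expR (- eta x) * partial i eta x.
  have dN : derivable (fun y => - eta y) x (ebasis i).
    exact: (Ck_derivable i (Ck_opp oO Ce) Ox).
  have [_ ->] := partial_comp dN (is_derive_expR (- eta x)).
  rewrite mulNr -mulrN; congr (_ * _).
  by have := deriveN (Ck_derivable i Ce Ox); rewrite /partial => <-.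
have E i : partial i (wflux A eta u i) x = expR (- eta x) * partial i (f i) x
    - expR (- eta x) * (partial i eta x * f i x).
  rewrite /wflux (partialM (Ck_derivable i Cw Ox) (Ck_derivable i (Cf i) Ox)) dw.
  by rewrite /f; ring.
rewrite (eq_bigr _ (fun i _ => E i)) big_split /= sumrN -!mulr_sumr.
have fE i y : f i y = mxact (A y) (grad u y) 0 i.
  by rewrite mxactE; apply: eq_bigr => j _; rewrite mxE.
have -> : \sum_i partial i (f i) x = divergence (fun y => mxact (A y) (grad u y)) x.
  by apply: eq_bigr => i _; congr (partial i _ x); apply/funext => y; rewrite fE.
have -> : \sum_i partial i eta x * f i x = - dot (B x) (grad u x).
  transitivity (dot (grad eta x) (mxact (A x) (grad u x))).
    by apply: eq_bigr => i _; rewrite fE; congr (_ * _); rewrite mxE.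
  by rewrite (dot_mxactC _ _ AT) ge mxactN dotNr mxact_invmx // dotC.
rewrite /elliptic_op; ring.
Qed.

Lemma partialV i u x : u x != 0 -> derivable u x (ebasis i) ->
  partial i (fun y => (u y)^-1) x = - (u x) ^- 2 * partial i u x.
Proof. by move=> u0 du; rewrite /partial; have := deriveV u0 du; rewrite /GRing.scale. Qed.

Lemma Ck1_inv Om u : open Om -> Ck 1 Om u -> (forall x, Om x -> u x != 0) ->
  Ck 1 Om (fun y => (u y)^-1).
Proof.
move=> oO Cu u0.
split=> [x Ox|i]; first by apply: continuousV; [exact: u0|exact: Ck_continuous Cu Ox].
have du x (Ox : Om x) := Ck_derivable i Cu Ox.
split=> [x Ox|]; first by apply: derivableV; [exact: u0|exact: du].
have C0 : Ck 0 Om (fun y => - ((u y)^-1 * (u y)^-1) * partial i u y).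
  have Cv : Ck 0 Om (fun y => (u y)^-1).
    by split=> // x Ox; apply: continuousV; [exact: u0|exact: Ck_continuous Cu Ox].
  exact: (Ck_mul oO (Ck_opp oO (Ck_mul oO Cv Cv)) (Ck_partial i Cu)).
apply: Ck_eq oO _ C0 => x Ox.
by rewrite (partialV (u0 x Ox) (du x Ox)) expr2 invfM.
Qed.

Definition picone_field A eta psi u Z (i : 'I_n) : 'rV[R]_n -> R :=
  fun y => Z y * (psi y * (wflux A eta psi i y - psi y * (u y)^-1 * wflux A eta u i y)).

Lemma Ck_picone_field A eta psi u Z i Om : open Om ->
  (forall i j, Ck 1 Om (fun y => A y i j)) -> Ck 1 Om eta ->
  Ck 2 Om psi -> Ck 2 Om u -> Ck 1 Om Z -> (forall x, Om x -> u x != 0) ->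
  Ck 1 Om (picone_field A eta psi u Z i).
Proof.
move=> oO CA Ce Cpsi Cu CZ u0.
have Cpsi1 := Ck_pred Cpsi; have CV := Ck1_inv oO (Ck_pred Cu) u0.
have CJ (v : 'rV[R]_n -> R) (Cv : Ck 2 Om v) := Ck_wflux i oO CA Ce Cv.
exact: (Ck_mul oO CZ (Ck_mul oO Cpsi1 (Ck_sub_fun oO (CJ _ Cpsi)
  (Ck_mul oO (Ck_mul oO Cpsi1 CV) (CJ _ Cu))))).
Qed.

(** Picone's identity: testing the equation of psi with psi and that of u with
    psi^2/u, the zeroth order terms cancel and the square of
    X = grad psi - (psi/u) grad u remains. *)
Lemma picone_divergence A B c eta psi u Z (l h : R) Om x : open Om -> Om x ->
  (forall i j, Ck 1 Om (fun y => A y i j)) -> Ck 1 Om eta ->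
  Ck 2 Om psi -> Ck 2 Om u -> Ck 1 Om Z -> (forall x, Om x -> 0 < u x) ->
  (A x)^T = A x -> A x \in unitmx -> grad eta x = - mxact (invmx (A x)) (B x) ->
  elliptic_op A B c psi x = l * psi x ->
  elliptic_op A B c u x = l * u x + h ->
  let s := psi x / u x in
  let X := grad psi x - s *: grad u x in
  \sum_i partial i (picone_field A eta psi u Z i) x =
  expR (- eta x) * (Z x * (dot X (mxact (A x) X) + s * psi x * h) +
    psi x * dot (grad Z x) (mxact (A x) X)).
Proof.
move=> oO Ox CA Ce Cpsi Cu CZ up AT uA ge Epsi Eu s X.
have u0 y : Om y -> u y != 0 by move=> /up; exact: lt0r_neq0.
have Cpsi1 := Ck_pred Cpsi; have Cu1 := Ck_pred Cu.
set e := expR (- eta x).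
have CJp i := Ck_wflux i oO CA Ce Cpsi; have CJu i := Ck_wflux i oO CA Ce Cu.
have CV := Ck1_inv oO Cu1 u0.
have Cs := Ck_mul oO Cpsi1 CV.
have CsJ i := Ck_mul oO Cs (CJu i).
have CG i := Ck_sub_fun oO (CJp i) (CsJ i).
have CpG i := Ck_mul oO Cpsi1 (CG i).
have ux0 := u0 x Ox.
have T i : partial i (picone_field A eta psi u Z i) x =
    Z x * psi x * (partial i (wflux A eta psi i) x - s * partial i (wflux A eta u i) x)
    + e * (Z x * (grad psi x 0 i * mxact (A x) X 0 i - s * (X 0 i * mxact (A x) (grad u x) 0 i)))
    + e * (psi x * (grad Z x 0 i * mxact (A x) X 0 i)).
  rewrite /picone_field (partialM (Ck_derivable i CZ Ox) (Ck_derivable i (CpG i) Ox)).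
  rewrite (partialM (Ck_derivable i Cpsi1 Ox) (Ck_derivable i (CG i) Ox)).
  have -> : partial i (fun y => wflux A eta psi i y - psi y / u y * wflux A eta u i y) x =
      partial i (wflux A eta psi i) x - partial i (fun y => psi y / u y * wflux A eta u i y) x.
    by have := deriveB (Ck_derivable i (CJp i) Ox) (Ck_derivable i (CsJ i) Ox); rewrite /partial => <-.
  rewrite (partialM (Ck_derivable i Cs Ox) (Ck_derivable i (CJu i) Ox)).
  rewrite (partialM (Ck_derivable i Cpsi1 Ox) (Ck_derivable i CV Ox)).
  rewrite (partialV ux0 (Ck_derivable i Cu1 Ox)) !wfluxE -/e.
  have -> : mxact (A x) X 0 i = mxact (A x) (grad psi x) 0 i - s * mxact (A x) (grad u x) 0 i.
    by rewrite /X mxactD mxactN mxactZ !mxE.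
  have -> : X 0 i = partial i psi x - s * partial i u x by rewrite !mxE.
  have -> : grad psi x 0 i = partial i psi x by rewrite mxE.
  have -> : grad Z x 0 i = partial i Z x by rewrite mxE.
  rewrite /s; move: ux0; clearbody e.
  move: (partial i (wflux A eta psi i) x) (partial i (wflux A eta u i) x) => d1 d2.
  move: (mxact _ (grad u x) 0 i) (mxact _ (grad psi x) 0 i) => j1 j2.
  move: (partial i psi x) (partial i u x) (partial i Z x) => p1 p2 p3.
  by move: (psi x) (u x) (Z x) => a b z b0; field.
rewrite (eq_bigr _ (fun i _ => T i)) !big_split /= -!mulr_sumr.
rewrite big_split /= sumrN -mulr_sumr.
have Dpsi := wflux_divergence c oO Ox CA Ce Cpsi AT uA ge.
have Du := wflux_divergence c oO Ox CA Ce Cu AT uA ge.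
rewrite [X in _ * (X - _)]Dpsi [X in _ - _ * X]Du.
rewrite Epsi Eu big_split /= sumrN -mulr_sumr.
rewrite -/(dot (grad psi x) (mxact (A x) X)) -/(dot X (mxact (A x) (grad u x))).
rewrite -/(dot (grad Z x) (mxact (A x) X)) (dot_mxactC X _ AT) -/e.
have -> : dot X (mxact (A x) X) = dot (grad psi x) (mxact (A x) X) -
    s * dot (grad u x) (mxact (A x) X).
  by rewrite {1}/X dotDl dotNl dotZl.
have sE : psi x = s * u x by rewrite /s divfK.
move: (dot (grad psi x) _) (dot (grad u x) _) (dot (grad Z x) _) => d1 d2 d3.
have key (s' : R) : psi x = s' * u x ->
    Z x * psi x * (- e * (l * psi x + c x * psi x) -
      s' * (- e * (l * u x + h + c x * u x))) + e * (Z x * (d1 - s' * d2)) + e * (psi x * d3) =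
    e * (Z x * (d1 - s' * d2 + s' * psi x * h) + psi x * d3) by move=> ->; ring.
exact: key.
Qed.

End Picone.

(** * Lower bounds for the Picone divergence *)
Section PointwiseEstimates.
Context {R : realType} {n : nat}.
Implicit Types (u v psi phi : 'rV[R]_n -> R) (x y : 'rV[R]_n) (Om D : set 'rV[R]_n).
Implicit Types (A : 'rV[R]_n -> 'M[R]_n) (B : 'rV[R]_n -> 'rV[R]_n).

(** The corrector p = exp(-K rho) has a large conormal derivative, which
    dominates the conormal derivative of psi by Cauchy-Schwarz; no sign and
    no size of the Robin coefficient enters. *)
Lemma picone_boundary_lower (M : 'M[R]_n) (gpsi gphi grho X : 'rV[R]_n)
    (phi psi p eps K u s w : R) : M^T = M ->
  (forall z : 'rV[R]_n, 0 <= dot z (mxact M z)) ->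
  0 < phi -> 0 < eps -> 0 < p -> 0 < K ->
  u = phi + eps * p -> s = psi / u ->
  X = gpsi - s *: (gphi + eps *: ((- (K * p)) *: grho)) ->
  w = phi * dot grho (mxact M gpsi) - psi * dot grho (mxact M gphi) ->
  - (`|s| * `|w| + (4 * K)^-1 * dot gpsi (mxact M gpsi)) <=
  psi * dot grho (mxact M X).
Proof.
move=> MT pos phi0 e0 p0 K0 uE sE XE wE.
have ep : 0 < eps * p by rewrite mulr_gt0.
have u0 : 0 < u by rewrite uE addr_gt0.
set dgp := dot grho (mxact M gpsi); set dgf := dot grho (mxact M gphi).
set dgg := dot grho (mxact M grho); set qp := dot gpsi (mxact M gpsi).
have E : psi * dot grho (mxact M X) =
    s * w + (eps * p / u) * (psi * dgp + K * psi ^+ 2 * dgg).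
  rewrite XE mxactD mxactN mxactZ mxactD !mxactZ dotDr dotNr dotZr dotDr !dotZr.
  rewrite -/dgp -/dgf -/dgg wE sE -/dgp -/dgf uE; field.
  by rewrite -uE gt_eqF.
have qp0 : 0 <= qp by exact: pos.
have K2 : 0 < 2 * K by lra.
have h1 : - (psi * dgp) <= K * psi ^+ 2 * dgg + (4 * K)^-1 * qp.
  have := psd_cauchy (psi *: grho) (- gpsi) MT pos K2.
  rewrite mxactN mxactZ !dotNr !dotZl !dotNl !dotZr opprK -/dgp -/dgg -/qp.
  have -> : (2 * K)^-1 = 2 * (4 * K)^-1 by field; rewrite gt_eqF.
  by move=> h; nra.
have r01 : 0 <= eps * p / u <= 1.
  rewrite divr_ge0 ?(ltW ep) ?(ltW u0) //= ler_pdivrMr // mul1r uE; lra.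
have h2 : - ((4 * K)^-1 * qp) <= (eps * p / u) * (psi * dgp + K * psi ^+ 2 * dgg).
  have q0 : 0 <= (4 * K)^-1 * qp by rewrite mulr_ge0 // invr_ge0; lra.
  have h3 : - ((4 * K)^-1 * qp) <= psi * dgp + K * psi ^+ 2 * dgg by lra.
  have /andP[r0 r1] := r01.
  have h4 := ler_wpM2l r0 h3.
  apply: le_trans h4; rewrite mulrN lerN2 ler_piMl //.
have h5 : - (`|s| * `|w|) <= s * w by rewrite -normrM; have := ler_norm (- (s * w)); rewrite normrN; lra.
by rewrite E; lra.
Qed.

(** The cut-off gradient meets X in a cross term; half of the square of X pays
    for its part along gz, and the part along grho is kept as it is. *)
Lemma picone_lower (M : 'M[R]_n) (X gz grho gZ : 'rV[R]_n) (psi chi dchi z sph b : R) :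
  M^T = M -> (forall z : 'rV[R]_n, 0 <= dot z (mxact M z)) ->
  0 <= chi -> 0 <= dchi -> gZ = (2 * chi * z) *: gz + (z ^+ 2 * dchi) *: grho ->
  - b <= psi * dot grho (mxact M X) ->
  1 / 2 * (chi * z ^+ 2) * dot X (mxact M X) - 2 * chi * psi ^+ 2 * dot gz (mxact M gz)
  - chi * z ^+ 2 * `|sph| - z ^+ 2 * dchi * b <=
  chi * z ^+ 2 * (dot X (mxact M X) + sph) + psi * dot gZ (mxact M X).
Proof.
move=> MT pos c0 d0 -> hb.
have half : 0 < 1 / 2 :> R by lra.
have h := psd_cauchy (z *: X) (- psi *: gz) MT pos half.
move: h; rewrite mxactZ mxactZ !dotZl !dotZr (dot_mxactC X gz MT) dotDl !dotZl.
have -> : (1 / 2 : R)^-1 = 2 by field.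
set q := dot X _; set g := dot gz (mxact M X); set gg := dot gz (mxact M gz) => h.
set r := dot grho _ in hb *.
have h1 : - (1 / 2 * z ^+ 2 * q + 2 * psi ^+ 2 * gg) <= 2 * z * psi * g by nra.
have h2 := ler_wpM2l c0 h1.
have zd : 0 <= z ^+ 2 * dchi by rewrite mulr_ge0 // sqr_ge0.
have h3 := ler_wpM2l zd hb.
have cz : 0 <= chi * z ^+ 2 by rewrite mulr_ge0 // sqr_ge0.
have h4 : - `|sph| <= sph by have := ler_norm (- sph); rewrite normrN; lra.
have h5 := ler_wpM2l cz h4.
lra.
Qed.

Lemma elliptic_opD A B (c : 'rV[R]_n -> R) phi p (eps : R) Om x : open Om -> Om x ->
  (forall i j, Ck 1 Om (fun y => A y i j)) -> Ck 2 Om phi -> Ck 2 Om p ->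
  elliptic_op A B c (fun y => phi y + eps * p y) x =
  elliptic_op A B c phi x + eps * elliptic_op A B c p x.
Proof.
move=> oO Ox CA Cf Cp.
pose u := fun y => phi y + eps * p y.
have pE j y : Om y -> partial j u y = partial j phi y + eps * partial j p y.
  move=> Oy; have df := Ck_derivable j Cf Oy; have dp := Ck_derivable j Cp Oy.
  rewrite /u (partialD df (Ck_derivable j (Ck_scale eps oO Cp) Oy)); congr (_ + _).
  rewrite (partialM (derivable_cst eps y (ebasis j)) dp).
  by rewrite /partial derive_cst mulr0 addr0.
have gE y : Om y -> grad u y = grad phi y + eps *: grad p y.
  by move=> Oy; apply/rowP => j; rewrite !mxE pE.
have flux (v : 'rV[R]_n -> R) i : Ck 2 Om v -> Ck 1 Om (fun y => mxact (A y) (grad v y) 0 i).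
  move=> Cv; apply: (Ck_eq oO _ (Ck_sum _ oO (fun j => Ck_mul oO (CA i j) (Ck_partial j Cv)))).
  by move=> y _; rewrite mxactE; apply: eq_bigr => j _; rewrite mxE.
have dE : divergence (fun y => mxact (A y) (grad u y)) x =
    divergence (fun y => mxact (A y) (grad phi y)) x +
    eps * divergence (fun y => mxact (A y) (grad p y)) x.
  rewrite /divergence mulr_sumr -big_split; apply: eq_bigr => i _ /=.
  have d1 := Ck_derivable i (flux _ i Cf) Ox; have d2 := Ck_derivable i (flux _ i Cp) Ox.
  transitivity (partial i (fun y => mxact (A y) (grad phi y) 0 i +
      eps * mxact (A y) (grad p y) 0 i) x).
    apply: near_eq_derive; apply: filterS (near_open oO Ox) => y Oy.
    by rewrite gE // mxactD mxactZ !mxE.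
  have d3 := Ck_derivable i (Ck_scale eps oO (flux _ i Cp)) Ox.
  rewrite (partialD d1 d3); congr (_ + _).
  rewrite (partialM (derivable_cst eps x (ebasis i)) d2).
  by rewrite /partial derive_cst mulr0 addr0.
rewrite /elliptic_op -/u dE (gE x Ox) dotDr dotZr.
move: (divergence (fun y => mxact (A y) (grad phi y)) x) => d1.
move: (divergence (fun y => mxact (A y) (grad p y)) x) => d2.
move: (dot (B x) (grad phi x)) (dot (B x) (grad p x)) => d3 d4.
by move: (phi x) (p x) => a b; ring.
Qed.

Definition bounded_by D u : Prop := exists2 C : R, 0 <= C & forall x, D x -> `|u x| <= C.

Lemma bounded_byD D u v : bounded_by D u -> bounded_by D v ->
  bounded_by D (fun x => u x + v x).
Proof.
move=> [C C0 HC] [E E0 HE]; exists (C + E); first exact: addr_ge0.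
move=> x Dx; apply: le_trans (ler_normD _ _) _; apply: lerD; [exact: HC|exact: HE].
Qed.

Lemma bounded_byM D u v : bounded_by D u -> bounded_by D v ->
  bounded_by D (fun x => u x * v x).
Proof.
move=> [C C0 HC] [E E0 HE]; exists (C * E); first exact: mulr_ge0.
by move=> x Dx; rewrite normrM ler_pM // ?HC ?HE.
Qed.

Lemma bounded_byN D u : bounded_by D u -> bounded_by D (fun x => - u x).
Proof. by move=> [C C0 HC]; exists C => // x Dx; rewrite normrN HC. Qed.

Lemma bounded_by_sum D (I : Type) (r : seq I) (F : I -> 'rV[R]_n -> R) :
  (forall i, bounded_by D (F i)) -> bounded_by D (fun x => \sum_(i <- r) F i x).
Proof.
move=> H; elim: r => [|i r IH].
  by exists 0 => // x _; rewrite big_nil normr0.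
have [C C0 HC] := bounded_byD (H i) IH.
by exists C => // x Dx; rewrite big_cons HC.
Qed.

Lemma bounded_by_eq D u v : (forall x, D x -> u x = v x) -> bounded_by D u ->
  bounded_by D v.
Proof. by move=> uv [C C0 HC]; exists C => // x Dx; rewrite -uv // HC. Qed.

Lemma bounded_by_smooth (L : R) Om u : Ck 0 setT u ->
  bounded_by (Om `&` [set x | `|x| <= L]) u.
Proof.
move=> Cu; have cu x : [set x : 'rV[R]_n | `|x| <= L] x ->
    {for x, continuous (fun x => `|u x|)}.
  move=> _; apply: (@continuous_comp _ _ _ u (fun t : R => `|t|)); last exact: norm_continuous.
  exact: Ck_continuous Cu I.
have [C C0 HC] := compact_upper_bound (compact_ball L) cu.
exists C; first exact: ltW.
by move=> x [_ xL]; exact: HC.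
Qed.

Lemma bounded_by_holder (a : R) (L : R) Om u : 0 < a -> holder_loc a Om u ->
  bounded_by (Om `&` [set x | `|x| <= L]) u.
Proof.
move=> a0 hu; have [C C0 HC] := holder_bounded L a0 hu.
by exists C; [exact: ltW|move=> x [Ox xL]; exact: HC].
Qed.

(** Expanding the divergence, every coefficient is Hölder on bounded parts of
    Om and every derivative of p is continuous on the whole space. *)
Lemma bounded_by_elliptic (a L : R) A B (c : 'rV[R]_n -> R) p Om : 0 < a -> open Om ->
  (forall i j, Cka 1 a Om (fun x => A x i j)) ->
  (forall i, Cka 0 a Om (fun x => B x 0 i)) -> Cka 0 a Om c -> Ck 2 setT p ->
  bounded_by (Om `&` [set x | `|x| <= L]) (elliptic_op A B c p).
Proof.
move=> a0 oO HA HB Hc Cp.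
have CA i j : Ck 1 Om (fun x => A x i j) := Cka_Ck a0 oO (HA i j).
have CpO := Ck_sub (@subsetT _ Om) Cp.
apply: bounded_byD; first apply: bounded_byD.
- apply: bounded_byN.
  apply: (@bounded_by_eq _ (fun x => \sum_i \sum_j
    (A x i j * partial i (partial j p) x + partial j p x * partial i (fun y => A y i j) x))).
    move=> x [Ox _]; apply: eq_bigr => i _.
    have dt j : derivable (fun y => A y i j * partial j p y) x (ebasis i).
      exact: (Ck_derivable i (Ck_mul oO (CA i j) (Ck_partial j CpO)) Ox).
    transitivity (partial i (\sum_j (fun y => A y i j * partial j p y)) x).
      rewrite /partial derive_sum; last by move=> j; exact: dt.
      apply: eq_bigr => j _.
      exact/esym/(partialM (Ck_derivable i (CA i j) Ox) (Ck_derivable i (Ck_partial j CpO) Ox)).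
    congr (partial i _ x); apply/funext => y.
    by rewrite fct_sumE mxactE; apply: eq_bigr => j _; rewrite mxE.
  apply: bounded_by_sum => i; apply: bounded_by_sum => j; apply: bounded_byD.
    apply: bounded_byM; first exact: (bounded_by_holder _ a0 (HA i j).1).
    exact: bounded_by_smooth (Ck_partial i (Ck_partial j Cp)).
  apply: bounded_byM; first exact: bounded_by_smooth (Ck_pred (Ck_partial j Cp)).
  by have [_ [h _]] := (HA i j).2 i; exact: (bounded_by_holder _ a0 h).
- apply: bounded_byN; apply: bounded_by_sum => i; apply: bounded_byM.
    exact: (bounded_by_holder _ a0 (HB i).1).
  apply: (@bounded_by_eq _ (partial i p)); first by move=> x _; rewrite mxE.
  exact: bounded_by_smooth (Ck_pred (Ck_partial i Cp)).
- apply: bounded_byN; apply: bounded_byM; first exact: (bounded_by_holder _ a0 Hc.1).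
  exact: bounded_by_smooth (Ck_pred (Ck_pred Cp)).
Qed.

End PointwiseEstimates.

(** * The Picone estimate with cut-offs and corrector *)
Section QuotientGradient.
Context {R : realType} {n : nat}.
Implicit Types (u v psi phi rho p : 'rV[R]_n -> R) (x y : 'rV[R]_n) (Om D : set 'rV[R]_n).
Implicit Types (A : 'rV[R]_n -> 'M[R]_n) (B : 'rV[R]_n -> 'rV[R]_n).

Lemma mx_entry_le_norm (M : 'M[R]_n) i j : `|M i j| <= `|M|.
Proof.
rewrite [leRHS]/Num.norm /= mx_normrE.
by apply/bigmax_geP; right => /=; exists (i, j).
Qed.

Lemma bounded_on_le (T : normedModType R) (f : 'rV[R]_n -> T) Om :
  [bounded f x | x in Om] -> exists2 C : R, 0 < C & forall x, Om x -> `|f x| <= C.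
Proof.
move=> [M [_ H]]; exists (`|M| + 1); first by rewrite ltr_pwDr.
by move=> x Ox; apply: (H (`|M| + 1)) => //; have := ler_norm M; lra.
Qed.

Lemma Ck_quadratic k Om A (X : 'rV[R]_n -> 'rV[R]_n) : open Om ->
  (forall i j, Ck k Om (fun y => A y i j)) -> (forall i, Ck k Om (fun y => X y 0 i)) ->
  Ck k Om (fun y => dot (X y) (mxact (A y) (X y))).
Proof.
move=> oO CA CX.
apply: (Ck_eq oO _ (Ck_sum _ oO (fun i => Ck_mul oO (CX i)
  (Ck_sum (index_enum 'I_n) oO (fun j => Ck_mul oO (CA i j) (CX j)))))).
by move=> y _; apply: eq_bigr => i _; rewrite mxactE.
Qed.

Definition bdcut (d : R) rho : 'rV[R]_n -> R := fun y => step (d^-1 * rho y - 1).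

Lemma is_derive_bdcut (d t : R) :
  is_derive t (1 : R) (fun t => step (d^-1 * t - 1)) (dstep (d^-1 * t - 1) * d^-1).
Proof.
have h : is_derive t (1 : R) (fun t => d^-1 * t - 1) d^-1.
  rewrite (_ : (fun t => _) = (d^-1 \*: (id : R -> R)) - cst 1) //.
  by apply: is_derive_eq; rewrite subr0 /GRing.scale /= mulr1.
exact: (@is_derive1_comp R step _ t _ _ (is_derive_step _) h).
Qed.

Lemma Ck_bdcut (d : R) rho : Ck 1 setT rho -> Ck 1 setT (bdcut d rho).
Proof.
move=> Cr; pose G (j : nat) (t : R) : R := if j is 0%N then step (d^-1 * t - 1)
  else dstep (d^-1 * t - 1) * d^-1.
apply: (@Ck_comp R n 1 setT rho G _ _ _ Cr); first exact: openT.
  by move=> [|//] x _ _; exact: is_derive_bdcut.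
move=> j x _ _.
have ct (f : R -> R) t df : is_derive t (1 : R) f df -> {for t, continuous f}.
  by move=> [dt _]; exact: differentiable_continuous ((derivable1_diffP _ _).1 dt).
case: j => [|j]; first exact: ct (is_derive_bdcut d (rho x)).
apply: (@continuousM _ _ (fun t => dstep (d^-1 * t - 1)) (cst d^-1)); last exact: cst_continuous.
apply: (@continuous_comp _ _ _ (fun t => d^-1 * t - 1) dstep); last exact: continuous_dstep.
apply: continuousB; last exact: cst_continuous.
by apply: (@continuousM _ _ (cst d^-1) (fun t => t)); [exact: cst_continuous|exact: continuous_idR].
Qed.

Lemma bdcut_facts (d : R) rho x : 0 < d ->
  [/\ 0 <= bdcut d rho x <= 1, rho x < d -> bdcut d rho x = 0,
      2 * d <= rho x -> bdcut d rho x = 1 &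
      exists dc : R, [/\ 0 <= dc <= 2 / d,
        (rho x < d \/ 2 * d < rho x) -> dc = 0 &
        Ck 1 setT rho -> grad (bdcut d rho) x = dc *: grad rho x]].
Proof.
move=> d0; have di : 0 < d^-1 by rewrite invr_gt0.
have dd : d^-1 * d = 1 by rewrite mulVf // gt_eqF.
split.
- exact: step_itv.
- by move=> h; apply: step_le0; have := ltr_pM2l di (rho x) d; rewrite dd h; lra.
- move=> h; apply: step_ge1; have := ler_pM2l di (2 * d) (rho x).
  by rewrite mulrCA dd h; lra.
exists (dstep (d^-1 * rho x - 1) * d^-1).
have /andP[s0 s2] := dstep_itv (d^-1 * rho x - 1).
split.
- by rewrite mulr_ge0 ?(ltW di) //= ler_pM2r.
- move=> [h|h].
    rewrite dstep_le0 ?mul0r //.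
    by have := ltr_pM2l di (rho x) d; rewrite dd h; lra.
  rewrite dstep_ge1 ?mul0r //.
  by have := ltr_pM2l di (2 * d) (rho x); rewrite mulrCA dd h; lra.
- move=> Cr; have := grad_comp (fun j => Ck_derivable j Cr (I : setT x)) (is_derive_bdcut d (rho x)).
  exact.
Qed.

(** Added to phi with a small factor, it keeps the denominator of psi^2 / u away
    from zero up to the boundary; its steep inward decrease, at the rate K, is
    what picone_boundary_lower exploits. *)
Definition corrector (K : R) rho : 'rV[R]_n -> R := fun y => expR (- K * rho y).

Lemma Ck_corrector K rho : Ck 2 setT rho -> Ck 2 setT (corrector K rho).
Proof. by move=> Cr; exact: (Ck_expR openT (Ck_scale (- K) openT Cr)). Qed.

Lemma grad_scale f (a : R) x : (forall i, derivable f x (ebasis i)) ->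
  grad (fun y => a * f y) x = a *: grad f x.
Proof.
move=> df; apply/rowP => i; rewrite !mxE.
rewrite (partialM (derivable_cst a x (ebasis i)) (df i)).
by rewrite /partial derive_cst mulr0 addr0.
Qed.

Lemma grad_corrector K rho x : Ck 1 setT rho ->
  grad (corrector K rho) x = (- (K * corrector K rho x)) *: grad rho x.
Proof.
move=> Cr; have d1 i := Ck_derivable i Cr (I : setT x).
have d2 i := Ck_derivable i (Ck_scale (- K) openT Cr) (I : setT x).
have -> := grad_comp d2 (is_derive_expR (- K * rho x)).
rewrite (grad_scale _ d1) scalerA; congr (_ *: _); rewrite /corrector; ring.
Qed.

Definition cutoff2 (d : R) rho zeta : 'rV[R]_n -> R :=
  fun y => bdcut d rho y * (zeta y * zeta y).

Lemma Ck_cutoff2 d rho zeta : Ck 1 setT rho -> Ck 1 setT zeta ->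
  Ck 1 setT (cutoff2 d rho zeta).
Proof.
by move=> Cr Cz; exact: (Ck_mul openT (Ck_bdcut d Cr) (Ck_mul openT Cz Cz)).
Qed.

Lemma grad_cutoff2 d rho zeta x : Ck 1 setT rho -> Ck 1 setT zeta ->
  grad (cutoff2 d rho zeta) x = (2 * bdcut d rho x * zeta x) *: grad zeta x +
    (zeta x ^+ 2) *: grad (bdcut d rho) x.
Proof.
move=> Cr Cz; have d1 i := Ck_derivable i (Ck_bdcut d Cr) (I : setT x).
have d2 i := Ck_derivable i Cz (I : setT x).
have d3 i := Ck_derivable i (Ck_mul openT Cz Cz) (I : setT x).
rewrite (gradM d1 d3) (gradM d2 d2) -scalerDl scalerA expr2; congr (_ *: _ + _).
by ring.
Qed.

(** What remains of Picone's identity once the three errors are isolated: the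
    gradient of zeta, the defect of u in the equation, which carries the factor
    eps, and the gradient of the boundary cut-off, supported in a thin strip.
    X is the Picone gradient of psi over u, and its relation to the gradient
    of psi / phi is recorded for the final lower bound. *)
Lemma picone_pointwise Om A B (c eta : 'rV[R]_n -> R) phi psi rho zeta
    (l eps K d : R) x : open Om -> Om x ->
  (forall i j, Ck 1 Om (fun y => A y i j)) -> Ck 1 Om eta ->
  Ck 2 Om phi -> Ck 2 Om psi -> Ck 2 setT rho -> Ck 1 setT zeta ->
  (forall y, Om y -> 0 < phi y) -> 0 < eps -> 0 < K -> 0 < d ->
  (A x)^T = A x -> (forall z : 'rV[R]_n, 0 <= dot z (mxact (A x) z)) ->
  A x \in unitmx -> grad eta x = - mxact (invmx (A x)) (B x) ->
  elliptic_op A B c phi x = l * phi x -> elliptic_op A B c psi x = l * psi x ->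
  let p := corrector K rho in let u := fun y => phi y + eps * p y in
  let s := psi x / u x in
  exists X : 'rV[R]_n, exists dc : R,
   [/\ u x *: X = phi x *: (grad psi x - (psi x / phi x) *: grad phi x) +
         eps *: (p x *: grad psi x - psi x *: grad p x),
       0 <= dc <= 2 / d, (rho x < d \/ 2 * d < rho x) -> dc = 0 &
   1 / 2 * expR (- eta x) * (cutoff2 d rho zeta x * dot X (mxact (A x) X)) <=
   \sum_i partial i (picone_field A eta psi u (cutoff2 d rho zeta) i) x +
   expR (- eta x) * (2 * bdcut d rho x * psi x ^+ 2 *
        dot (grad zeta x) (mxact (A x) (grad zeta x)) +
     cutoff2 d rho zeta x * `|s * psi x * (eps * (elliptic_op A B c p x - l * p x))| +
     zeta x ^+ 2 * dc *
      (`|s| * `|phi x * dot (grad rho x) (mxact (A x) (grad psi x)) -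
         psi x * dot (grad rho x) (mxact (A x) (grad phi x))| +
       (4 * K)^-1 * dot (grad psi x) (mxact (A x) (grad psi x))))].
Proof.
move=> oO Ox CA Ce Cphi Cpsi Cr Cz phi0 e0 K0 d0 AT pos uA ge Ephi Epsi p u s.
have Cr1 := Ck_pred Cr; have CpT : Ck 2 setT p := Ck_corrector K Cr.
have Cp : Ck 2 Om p := Ck_sub (@subsetT _ Om) CpT.
have Cu : Ck 2 Om u := Ck_add oO Cphi (Ck_scale eps oO Cp).
have p0 y : 0 < p y by exact: expR_gt0.
have u0 y : Om y -> 0 < u y by move=> Oy; rewrite addr_gt0 ?phi0 // mulr_gt0.
have dphi i := Ck_derivable i Cphi Ox; have dp i := Ck_derivable i Cp Ox.
have gu : grad u x = grad phi x + eps *: ((- (K * p x)) *: grad rho x).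
  rewrite /u (gradD dphi (fun i => Ck_derivable i (Ck_scale eps oO Cp) Ox)).
  by rewrite (grad_scale eps dp) (grad_corrector K _ Cr1).
have Eu : elliptic_op A B c u x = l * u x + eps * (elliptic_op A B c p x - l * p x).
  rewrite (elliptic_opD B c eps oO Ox CA Cphi Cp) Ephi /u.
  by move: (elliptic_op _ _ _ _ _) => q; ring.
have CZ : Ck 1 Om (cutoff2 d rho zeta) := Ck_sub (@subsetT _ Om) (Ck_cutoff2 d Cr1 Cz).
pose X := grad psi x - s *: grad u x.
have [bd01 bd0 _ [dc [dc2 dc0 gdc]]] := bdcut_facts rho x d0.
exists X, dc; split=> //.
  have ux := lt0r_neq0 (u0 x Ox); have fx := lt0r_neq0 (phi0 x Ox).
  rewrite /X scalerBr scalerA /s mulrC divfK // gu (grad_corrector K _ Cr1) -/p.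
  by apply/rowP => i; rewrite /u !mxE; field.
have := picone_divergence oO Ox CA Ce Cpsi Cu CZ u0 AT uA ge Epsi Eu.
rewrite /= -/s -/X => ->.
have /andP[bdl _] := bd01; have /andP[dcl _] := dc2.
have gZ : grad (cutoff2 d rho zeta) x = (2 * bdcut d rho x * zeta x) *: grad zeta x +
    (zeta x ^+ 2 * dc) *: grad rho x.
  by rewrite grad_cutoff2 // gdc // scalerA.
have hb := picone_boundary_lower AT pos (phi0 x Ox) e0 (p0 x) K0 (erefl (u x)) (erefl s)
  (_ : X = grad psi x - s *: (grad phi x + eps *: ((- (K * p x)) *: grad rho x))) (erefl _).
have {}hb := hb (congr1 (fun g => grad psi x - s *: g) gu).
have h := picone_lower (s * psi x * (eps * (elliptic_op A B c p x - l * p x)))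
  AT pos bdl dcl gZ hb.
have cE : bdcut d rho x * zeta x ^+ 2 = cutoff2 d rho zeta x by rewrite expr2.
rewrite cE in h; clear -h.
rewrite -mulrDr [1 / 2 * _]mulrC -[leLHS]mulrA; apply: ler_wpM2l; first exact: expR_ge0.
move: h; rewrite mulrA.
move: (dot X _) (dot (grad (cutoff2 d rho zeta) x) _) (2 * _ * _ * _) => q1 q2 q3.
move: (zeta x ^+ 2 * dc * _) (cutoff2 d rho zeta x * Num.norm _) => q4 q5.
by move: (psi x * q2) => q6; lra.
Qed.

End QuotientGradient.

(** * Rigidity of bounded solutions *)
Section Liouville.
Context {R : realType} {n : nat}.
Implicit Types (u v psi phi rho p : 'rV[R]_n -> R) (x y : 'rV[R]_n) (Om D : set 'rV[R]_n).
Implicit Types (A : 'rV[R]_n -> 'M[R]_n) (B : 'rV[R]_n -> 'rV[R]_n).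

Lemma psd_split (M : 'M[R]_n) (v w : 'rV[R]_n) : M^T = M ->
  (forall z : 'rV[R]_n, 0 <= dot z (mxact M z)) ->
  1 / 2 * dot v (mxact M v) - dot w (mxact M w) <= dot (v + w) (mxact M (v + w)).
Proof.
move=> MT pos; have half : 0 < 1 / 2 :> R by lra.
have := psd_cauchy (- v) w MT pos half.
rewrite mxactD mxactN !dotDl !dotDr !dotNl dotNr opprK (dot_mxactC w v MT).
have -> : (1 / 2 : R)^-1 = 2 by field.
lra.
Qed.

(** A positive value of a continuous density cannot be missed by the grid sums:
    the density is bounded below on a ball, which contains a box. *)
Lemma ball_lower_bound Om (q : 'rV[R]_n -> R) x1 : open Om -> Ck 0 Om q -> Om x1 ->
  0 < q x1 -> exists b : set 'rV[R]_n, exists (c0 vb : R) (bx : set 'rV[R]_n),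
    [/\ compact b, b `<=` Om, 0 < c0 & forall y, b y -> c0 <= q y] /\
    [/\ bx `<=` b, 0 < vb & \forall m \near \oo, vb <= gsum m \1_bx].
Proof.
move=> oO Cq Ox1 q1.
have near1 : \forall y \near x1, Om y /\ q x1 / 2 < q y.
  have := Ck_continuous Cq Ox1; rewrite /continuous_at => /(_ (fun t => q x1 / 2 < t)).
  move=> H; have {}H : \forall y \near x1, q x1 / 2 < q y by apply: H; apply: lt_nbhsr; lra.
  by apply: filterS2 (near_open oO Ox1) H.
have /nbhs_ballP[r /= r0 Hr] := near1.
have r2 : 0 < r / 2 by lra.
pose b := [set y : 'rV[R]_n | `|y - x1| <= r / 2].
have bsub y : b y -> Om y /\ q x1 / 2 < q y.
  by move=> /= yb; apply: Hr; apply/ball_rowP; apply: le_lt_trans yb _; lra.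
pose lo := x1 - const_mx (r / 2); pose hi := x1 + const_mx (r / 2) : 'rV[R]_n.
exists b, (q x1 / 2), ((r / 2) ^+ n), (box lo hi); split; split.
- apply: bounded_closed_compact.
    exists (`|x1| + r / 2); split; first exact: num_real.
    move=> M hM y yb; apply: ltW; apply: le_lt_trans hM.
    by rewrite -[y](subrK x1) addrC; apply: le_trans (ler_normD _ _) _; rewrite lerD2l.
  rewrite (_ : b = (fun y => `|y - x1|) @^-1` [set t | t <= r / 2]) //.
  apply: preimage_closed; last exact: closed_le.
  move=> y _; apply: (@continuous_comp _ _ _ (fun y => y - x1) (fun z : 'rV[R]_n => `|z|)); last exact: norm_continuous.
  by apply: continuousB; [move=> U; exact: id|exact: cst_continuous].
- by move=> y /bsub[].
- lra.
- by move=> y /bsub[_ /ltW].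
- move=> y yb; apply: normv_le; first exact: ltW.
  move=> i; have := yb i; rewrite !mxE => /andP[h1 h2]; rewrite ler_norml; apply/andP; split; lra.
- by rewrite exprn_gt0.
- by apply: (@gsum_box_ge R n r lo hi r0) => i; rewrite !mxE; lra.
Qed.

Lemma small_pos (s : seq (R * R)) :
  (forall kt, kt \in s -> 0 < kt.1 /\ 0 < kt.2) ->
  exists2 e : R, 0 < e & forall kt, kt \in s -> e * kt.1 <= kt.2.
Proof.
elim: s => [|[k t] s IH] H; first by exists 1.
have [e e0 He] : exists2 e : R, 0 < e & forall kt, kt \in s -> e * kt.1 <= kt.2.
  by apply: IH => kt ks; apply: H; rewrite inE ks orbT.
have [/= k0 t0] := H (k, t) (mem_head _ _).
have m0 : 0 < Num.min e (t / k) by rewrite lt_min e0 divr_gt0.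
exists (Num.min e (t / k)) => // kt; rewrite inE => /orP[/eqP ->|ks] /=.
  by rewrite -ler_pdivlMr // ge_min lexx orbT.
apply: le_trans (He kt ks); have [k0' _] : 0 < kt.1 /\ 0 < kt.2 by apply: H; rewrite inE ks orbT.
by rewrite ler_pM2r // ge_min lexx.
Qed.

Lemma psd_split_scale (M : 'M[R]_n) (f e t : R) (v w z : 'rV[R]_n) : M^T = M ->
  (forall z : 'rV[R]_n, 0 <= dot z (mxact M z)) -> t *: z = f *: v + e *: w ->
  1 / 2 * (f * (f * dot v (mxact M v))) - e * (e * dot w (mxact M w)) <=
  t * (t * dot z (mxact M z)).
Proof.
move=> MT pos E; have := psd_split (f *: v) (e *: w) MT pos.
by rewrite -E !mxactZ !dotZl !dotZr.
Qed.

(** The perturbation, of size e, takes at most a quarter of the square of the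
    leading gradient, and u is at most 2 f. *)
Lemma absorbed_lower (c0 b f q qX qY e u r M : R) : 0 < c0 -> 0 < b -> 0 < e -> 0 < M ->
  b <= f -> 0 <= r -> r <= b -> e <= 1 -> e * (4 * M) <= b ^+ 2 * c0 -> c0 <= q -> qY <= M ->
  0 <= qX -> u = f + r ->
  1 / 2 * (f * (f * q)) - e * (e * qY) <= u * (u * qX) -> c0 / 16 <= qX.
Proof.
move=> c00 b0 e0 M0 bf r0 rb e1 eM cq qYM qX0 uE H.
have h2 : e * (e * qY) <= b ^+ 2 * c0 / 4.
  apply: (@le_trans _ _ (e * M)); last by lra.
  rewrite ler_pM2l //; apply: le_trans (_ : e * M <= _); first by rewrite ler_pM2l.
  by rewrite ler_piMl // ltW.
have f0 : 0 < f ^+ 2 by rewrite exprn_gt0 //; lra.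
have bf2 : b ^+ 2 <= f ^+ 2 by rewrite ler_pXn2r ?nnegrE //; lra.
have h3 : b ^+ 2 * c0 <= f ^+ 2 * c0 by rewrite ler_pM2r.
have h4 : u ^+ 2 * qX <= 4 * (f ^+ 2 * qX).
  rewrite mulrA; apply: ler_wpM2r => //; rewrite (_ : 4 * f ^+ 2 = (2 * f) ^+ 2); last by ring.
  by rewrite ler_pXn2r ?nnegrE //; lra.
have h5 : f ^+ 2 * c0 <= f ^+ 2 * q by rewrite ler_pM2l.
rewrite -(ler_pM2l f0) mulrA; move: H h2 h3 h4 h5.
have sq (t z : R) : t * (t * z) = t ^+ 2 * z by rewrite mulrA expr2.
rewrite !sq.
move: (f ^+ 2 * q) (f ^+ 2 * qX) (u ^+ 2 * qX) (e ^+ 2 * qY) (b ^+ 2 * c0) (f ^+ 2 * c0) => x1 x2 x3 x4 x5 x6.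
lra.
Qed.

Lemma cutoff_term (e e0 chi s S q La g : R) : 0 <= e <= e0 -> 0 <= chi <= 1 ->
  s ^+ 2 <= S -> 0 <= q <= La * g ->
  e * (2 * chi * s ^+ 2 * q) <= 2 * e0 * S * La * g.
Proof.
move=> /andP[ep ele] /andP[cp c1] sS /andP[q0 qg].
have s0 : 0 <= s ^+ 2 := sqr_ge0 s.
have h1 : s ^+ 2 * q <= S * (La * g) by apply: ler_pM.
have h2 : e * chi <= e0 by apply: le_trans ele; rewrite ler_piMr.
have h3 : e * chi * (s ^+ 2 * q) <= e0 * (S * (La * g)).
  by apply: ler_pM h2 h1; [exact: mulr_ge0|exact: mulr_ge0].
rewrite (_ : e * _ = 2 * (e * chi * (s ^+ 2 * q))); last by ring.
rewrite (_ : 2 * e0 * S * La * g = 2 * (e0 * (S * (La * g)))); last by ring.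
by rewrite ler_pM2l.
Qed.

Lemma corrector_term (e e0 z s S eps u h H : R) : 0 <= e <= e0 -> 0 <= z <= 1 ->
  s ^+ 2 <= S -> 0 < eps -> 0 < u -> `|h| <= H ->
  e * (z * `|s / u * s * (eps * h)|) <= e0 * S * (H + 1) * (eps / u).
Proof.
move=> /andP[ep ele] /andP[zp z1] sS eps0 u0 hH.
have eu : 0 < eps / u by rewrite divr_gt0.
rewrite (_ : s / u * s * (eps * h) = s ^+ 2 * (eps / u) * h); last first.
  by rewrite expr2; ring.
rewrite normrM (ger0_norm (mulr_ge0 (sqr_ge0 s) (ltW eu))).
have h1 : s ^+ 2 * `|h| <= S * (H + 1).
  by apply: ler_pM => //; [exact: sqr_ge0|apply: le_trans hH _; lra].
have h2 : e * z <= e0 by apply: le_trans ele; rewrite ler_piMr.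
rewrite (_ : e * _ = e * z * (s ^+ 2 * `|h|) * (eps / u)); last by ring.
rewrite ler_pM2r // -[leRHS]mulrA; apply: ler_pM h2 h1; first exact: mulr_ge0.
by rewrite mulr_ge0 ?sqr_ge0.
Qed.

(** v is a lower bound of u that survives where phi vanishes. *)
Lemma flux_term (e e0 z dc k s S u v w tau q G D : R) : 0 <= e <= e0 -> 0 <= z <= 1 ->
  0 <= dc <= D -> 0 <= k -> `|s| <= S -> 0 < v <= u -> `|w| <= tau -> 0 <= q <= G ->
  e * (z * dc * (`|s / u| * `|w| + k * q)) <= D * (e0 * (S / v * tau + k * G)).
Proof.
move=> /andP[ep ele] /andP[zp z1] /andP[dp dD] k0 sS /andP[v0 vu] wt /andP[q0 qG].
have u0 := lt_le_trans v0 vu.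
have su : `|s / u| <= S / v.
  rewrite normrM normfV (gtr0_norm u0); apply: ler_pM => //.
    by rewrite invr_ge0 ltW.
  by rewrite lef_pV2.
have h1 : `|s / u| * `|w| + k * q <= S / v * tau + k * G.
  by apply: lerD; [apply: ler_pM|apply: ler_wpM2l].
have h0 : 0 <= `|s / u| * `|w| + k * q by rewrite addr_ge0 ?mulr_ge0.
have h2 : z * dc <= D by apply: le_trans dD; rewrite ler_piMl.
rewrite (_ : e * _ = z * dc * (e * (`|s / u| * `|w| + k * q))); last by ring.
by apply: ler_pM h2 (ler_pM ep h0 ele h1); rewrite mulr_ge0.
Qed.

(** If X = grad psi - (psi / phi) grad phi were nonzero somewhere, the grid sums
    of its weighted square would stay above c1 vb = 8 T0 by ball_lower_bound.
    Summing picone_pointwise, they are also at most 6 T0. The constants are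
    chosen in an order that breaks the apparent circle: zeta, which fixes the
    radius L; then rho, the strip constant Cs and K; then the width dp of the
    strip where the defect of u is measured by the width, eps / u being at
    most 1 / p; then eps, which handles the defect in the rest of Om, where phi
    has a positive minimum; then the tolerance tau for the boundary flux, which
    may depend on eps since the numerator psi is bounded and u is at least
    eps p; and last the width d of the boundary cut-off. *)
Lemma quotient_gradient_zero (a : R) Om A B c (bc : boundary_condition R n) eta phi psi (l C : R) :
  (0 < n)%N -> standing_assumptions a Om A B c bc ->
  Ck 1 Om eta -> [bounded eta x | x in Om] ->
  (forall x, Om x -> grad eta x = - mxact (invmx (A x)) (B x)) ->
  (\forall r \near +oo,
    (lebesgue_n (Om `&` [set x | (enorm x <= r)%R]) <= (C * r ^+ 2)%:E)%E) ->
  Cka 2 a Om phi -> Cka 2 a Om psi -> (forall x, Om x -> 0 < phi x) ->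
  [bounded psi x | x in Om] ->
  (forall x, Om x -> elliptic_op A B c phi x = l * phi x) ->
  (forall x, Om x -> elliptic_op A B c psi x = l * psi x) ->
  (forall x, boundary Om x -> boundary_op Om A bc phi x = 0) ->
  (forall x, boundary Om x -> boundary_op Om A bc psi x = 0) ->
  forall x, Om x -> grad psi x - (psi x / phi x) *: grad phi x = 0.
Proof.
move=> n0 [/andP[a0 _] sm HA Abnd Asym [lb Alb] HB _ Hc _ _] Ce Ebnd ge hvol.
move=> Hphi Hpsi phi0 Pbnd Ephi Epsi bphi bpsi x1 Ox1.
have [oO _ _ _] := sm.
have CA i j : Ck 1 Om (fun x => A x i j) := Cka_Ck a0 oO (HA i j).
have Cphi := Cka_Ck a0 oO Hphi; have Cpsi := Cka_Ck a0 oO Hpsi.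
have Apos x : Om x -> forall z : 'rV[R]_n, 0 <= dot z (mxact (A x) z).
  move=> Ox z; have [lb0 h] := Alb x Ox; apply: le_trans (h z).
  by rewrite mulr_ge0 ?dot_ge0 // ltW.
have Aun x : Om x -> A x \in unitmx.
  by move=> Ox; have [lb0 h] := Alb x Ox; exact: posdef_unitmx (Asym x Ox) lb0 h.
have [La La0 HLa] : exists2 La : R, 0 < La & forall x z, Om x ->
    dot z (mxact (A x) z) <= La * dot z z.
  have [M M0 HM] := bounded_on_le Abnd.
  exists (n%:R * M); first by rewrite mulr_gt0 // ltr0n.
  move=> x z Ox; apply: quadratic_le_norm => i j.
  by apply: le_trans (mx_entry_le_norm _ _ _) (HM x Ox).
have [E0 E00 HE0] := bounded_on_le Ebnd.
have [Ps Ps0 HPs] := bounded_on_le Pbnd.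
pose e0 : R := expR E0; have e00 : 0 < e0 by exact: expR_gt0.
have eub x : Om x -> expR (- eta x) <= e0.
  move=> Ox; rewrite ler_expR; have := HE0 x Ox; rewrite ler_norml => /andP[]; lra.
have elb x : Om x -> e0^-1 <= expR (- eta x).
  move=> Ox; rewrite /e0 -expRN ler_expR; have := HE0 x Ox; rewrite ler_norml => /andP[]; lra.
clearbody e0; clear E0 E00 HE0 Ebnd Pbnd Abnd.
apply: contrapT => /eqP X1.
pose X0 y := grad psi y - (psi y / phi y) *: grad phi y.
pose q y := dot (X0 y) (mxact (A y) (X0 y)).
have CV : Ck 1 Om (fun y => (phi y)^-1).
  by apply: (Ck1_inv oO (Ck_pred Cphi)) => y /phi0; exact: lt0r_neq0.
have CX0 i : Ck 0 Om (fun y => X0 y 0 i).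
  have Cq := Ck_mul oO (Ck_pred Cpsi) CV.
  have := Ck_sub_fun oO (Ck_pred (Ck_partial i Cpsi)) (Ck_mul oO (Ck_pred Cq) (Ck_pred (Ck_partial i Cphi))).
  by apply: (Ck_eq oO) => y _; rewrite !mxE.
have Cq : Ck 0 Om q := Ck_quadratic oO (fun i j => Ck_pred (CA i j)) CX0.
have q1 : 0 < q x1.
  have [lb0 h] := Alb x1 Ox1; apply: lt_le_trans (h _).
  by rewrite mulr_gt0 // dot_gt0.
have [b [c0 [vb [bx [[cb bO c00 qb] [bxb vb0 Hvb]]]]]] := ball_lower_bound oO Cq Ox1 q1.
pose c1 : R := e0^-1 * c0 / 32.
have c10 : 0 < c1 by rewrite divr_gt0 // mulr_gt0 // invr_gt0.
(* the budget of one error term *)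
pose T0 : R := c1 * vb / 8; have T00 : 0 < T0 by rewrite divr_gt0 // mulr_gt0.
have [Lb Lb0 HLb] := compact_norm_bound cb.
pose a1 : R := 2 * e0 * Ps ^+ 2 * La.
have a10 : 0 < a1 by rewrite !mulr_gt0 // exprn_gt0.
have [av [N [Mexp Hen]]] :=
  @log_cutoff_energy R n Om C (T0 / a1) (1 + (n%:R * Lb) ^+ 2) hvol (divr_gt0 T00 a10).
pose zeta : 'rV[R]_n -> R := logcut av N.
have Cz : Ck 1 setT zeta := Ck_logcut av N.
pose Q : R := expR (av + N.+1)%:R - 1.
pose L : R := Num.sqrt (Q + 1).
have Q1 : 0 < Q + 1 by rewrite /Q subrK expR_gt0.
have LQ : L ^+ 2 = Q + 1 by rewrite sqr_sqrtr // ltW.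
have L0 : 0 <= L by exact: sqrtr_ge0.
have zQ x : Q <= dot x x -> zeta x = 0.
  by move=> h; apply: logcut_eq0; rewrite /Q in h; lra.
have gzQ x : Q <= dot x x -> grad zeta x = 0.
  by move=> h; apply: grad_logcut_eq0; rewrite /Q in h; lra.
have z01 x : 0 <= zeta x <= 1 := logcut_itv av N x.
have zb x : b x -> zeta x = 1.
  move=> bx'; apply: logcut_eq1; apply: le_trans Mexp; rewrite lerD2l.
  rewrite -enorm_le ?mulr_ge0 //; apply: le_trans (enorm_le_norm x) _.
  by rewrite ler_wpM2l // HLb.
have bQ x : b x -> dot x x < Q.
  by move=> bx'; rewrite ltNge; apply/negP => /zQ; rewrite zb // => /eqP; rewrite oner_eq0.
have QL x : dot x x <= Q -> `|x| <= L.
  by move=> h; apply: (norm_le_dot L0 LQ); lra.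
have xL x : L < `|x| -> Q <= dot x x.
  by move=> h; rewrite leNgt; apply/negP => /ltW/QL; lra.
have [rho [Cr rpos rzero rgrad]] := global_defining L n0 a0 sm.
have Cr1 := Ck_pred Cr; have Cr0 := Ck_pred Cr1.
have rgrad0 x : boundary Om x -> `|x| <= L -> grad rho x != 0.
  move=> bdx xL'; have [i [bb [h [C2 le C1]]]] := boundary_chart n0 a0 sm bdx.
  have g0 := @grad_chart_neq0 R n Om x i bb h x C1 le.
  have [k k0 ->] := rgrad x _ bdx xL' (Ck_chart i bb C1) (chart_defining le) g0.
  by rewrite scaler_eq0 negb_or (gt_eqF k0).
have [Cs [d0 [Cs0 d00 Hstrip]]] := strip_bound oO Cr L0 LQ rpos rzero rgrad0.
pose D := Om `&` [set x : 'rV[R]_n | `|x| <= L].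
have [Ga Ga0 HGa] : exists2 G : R, 0 <= G & forall x, D x ->
    dot (grad psi x) (mxact (A x) (grad psi x)) <= G.
  have : bounded_by D (fun x => dot (grad psi x) (grad psi x)).
    apply: bounded_by_sum => i.
    have bi : bounded_by D (fun x => grad psi x 0 i).
      apply: (@bounded_by_eq _ _ D (partial i psi)); first by move=> x _; rewrite mxE.
      by have [_ [h _]] := Hpsi.2 i; exact: (bounded_by_holder L a0 h).
    exact: bounded_byM.
  move=> [G G0 HG]; exists (La * G); first by rewrite mulr_ge0 // ltW.
  move=> x Dx; apply: le_trans (HLa _ _ Dx.1) _; rewrite ler_pM2l //.
  by apply: le_trans (HG x Dx); exact: ler_norm.
(* a density of size (2 / d) e0 Ga / (4 K) on a strip of measure 2 Cs d, to sum
   to at most T0 whatever d *)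
pose K : R := Cs * e0 * (Ga + 1) / T0.
have K0 : 0 < K by rewrite divr_gt0 // mulr_gt0 ?mulr_gt0 //; lra.
pose p := corrector K rho.
have Cp : Ck 2 setT p := Ck_corrector K Cr.
have p0 x : 0 < p x by exact: expR_gt0.
have [pm pm0 Hpm] : exists2 m : R, 0 < m & forall x, `|x| <= L -> m <= p x.
  exact: compact_lower_bound (compact_ball L)
    (fun x _ => Ck_continuous Cp (I : setT x)) (fun x _ => p0 x).
have [H H0 HH] : exists2 H : R, 0 <= H & forall x, D x ->
    `|elliptic_op A B c p x - l * p x| <= H.
  have [H H0 HH] := bounded_byD (bounded_by_elliptic L a0 oO HA HB Hc Cp)
    (bounded_byN (bounded_by_smooth L Om (Ck_scale l openT (Ck_pred (Ck_pred Cp))))).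
  by exists H.
pose a2 : R := e0 * Ps ^+ 2 * (H + 1).
have a20 : 0 < a2 by rewrite mulr_gt0 ?mulr_gt0 ?exprn_gt0 //; lra.
have [dp dp0 Hdp] : exists2 e : R, 0 < e & forall kt, kt \in [:: (1, d0); (a2 * Cs, T0 * pm)] ->
    e * kt.1 <= kt.2.
  apply: small_pos => kt; rewrite !inE => /orP[/eqP ->|/eqP ->]; first by split.
  by split; rewrite mulr_gt0.
have dpd0 : dp <= d0 by have := Hdp (1, d0) (mem_head _ _); rewrite mulr1.
have dpT : dp * (a2 * Cs) <= T0 * pm.
  by apply: (Hdp (a2 * Cs, T0 * pm)); rewrite !inE eqxx orbT.
clear Hdp.
have [cf cf0 Hcf] : exists2 m : R, 0 < m & forall x, core Om rho L dp x -> m <= phi x.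
  apply: compact_lower_bound (compact_core Om L dp Cr0) _ _ => x /(core_sub dp0 rzero) Ox.
    exact: Ck_continuous Cphi Ox.
  exact: phi0.
have [cb' cb0 Hcb] : exists2 m : R, 0 < m & forall x, b x -> m <= phi x.
  by apply: compact_lower_bound cb _ _ => x /bO Ox; [exact: Ck_continuous Cphi Ox|exact: phi0].
have [pb pb0 Hpb] : exists2 m : R, 0 < m & forall x, b x -> p x <= m.
  by apply: compact_upper_bound cb _ => x _; exact: Ck_continuous Cp I.
pose Y y := p y *: grad psi y - psi y *: grad p y.
have [My My0 HMy] : exists2 m : R, 0 < m & forall x, b x -> dot (Y x) (mxact (A x) (Y x)) <= m.
  have CpO := Ck_sub (@subsetT _ Om) Cp.
  have CY i : Ck 0 Om (fun y => Y y 0 i).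
    have h1 := Ck_mul oO (Ck_pred (Ck_pred CpO)) (Ck_pred (Ck_partial i Cpsi)).
    have h2 := Ck_mul oO (Ck_pred (Ck_pred Cpsi)) (Ck_pred (Ck_partial i CpO)).
    by apply: (Ck_eq oO _ (Ck_sub_fun oO h1 h2)) => y _; rewrite !mxE.
  have CqY := Ck_quadratic oO (fun i j => Ck_pred (CA i j)) CY.
  by apply: compact_upper_bound cb _ => x /bO Ox; exact: Ck_continuous CqY Ox.
pose V : R := (2 * L + 2) ^+ n.
have V0 : 0 < V by rewrite exprn_gt0 //; lra.
have [eps ep0 Heps] : exists2 e : R, 0 < e & forall kt, kt \in
    [:: (1, 1); (pb, cb'); (4 * My, cb' ^+ 2 * c0); (a2 * V, T0 * cf)] -> e * kt.1 <= kt.2.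
  apply: small_pos => kt; rewrite !inE => /or4P[] /eqP ->; split => //=.
  - by rewrite mulr_gt0.
  - by rewrite mulr_gt0 // exprn_gt0.
  - by rewrite mulr_gt0.
  - by rewrite mulr_gt0.
have eps1 : eps <= 1 by have := Heps (1, 1) (mem_head _ _); rewrite mulr1.
have epsp : eps * pb <= cb' by apply: (Heps (pb, cb')); rewrite !inE eqxx ?orbT.
have epsM : eps * (4 * My) <= cb' ^+ 2 * c0.
  by apply: (Heps (4 * My, cb' ^+ 2 * c0)); rewrite !inE eqxx ?orbT.
have epsV : eps * (a2 * V) <= T0 * cf.
  by apply: (Heps (a2 * V, T0 * cf)); rewrite !inE eqxx ?orbT.
clear Heps.
pose tau : R := T0 * eps * pm / (4 * Cs * e0 * Ps).
have tau0 : 0 < tau.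
  by apply: divr_gt0 (mulr_gt0 (mulr_gt0 T00 ep0) pm0) _; rewrite !mulr_gt0.
pose w y := phi y * dot (grad rho y) (mxact (A y) (grad psi y)) -
  psi y * dot (grad rho y) (mxact (A y) (grad phi y)).
have [d1 d10 Hd1] : exists2 d : R, 0 < d & forall x,
    (closure Om `&` [set x : 'rV[R]_n | `|x| <= L]) x -> Om x -> rho x <= d -> `|w x| <= tau.
  apply: near_zero_set; first exact: compact_closure_ball.
    by move=> x _; exact: Ck_continuous Cr I.
  move=> x [cx xL']; have [Ox|bdx] := closure_cases cx; first by left; exact: rpos.
  right; apply: (boundary_flux_vanishes n0 a0 sm HA Hphi Hpsi bdx (bphi x bdx) (bpsi x bdx) Cr1 _ tau0).
  by move=> s Cs' ds gs; exact: rgrad.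
have [rb rb0 Hrb] : exists2 m : R, 0 < m & forall x, b x -> m <= rho x.
  apply: compact_lower_bound cb _ _ => x bx'; first exact: Ck_continuous Cr I.
  by apply: rpos; [exact: bO|apply: QL; exact: ltW (bQ x bx')].
have [d dd0 Hd] : exists2 e : R, 0 < e & forall kt, kt \in
    [:: (2, d1); (2, d0); (2, rb)] -> e * kt.1 <= kt.2.
  by apply: small_pos => kt; rewrite !inE => /or3P[] /eqP ->; split.
have dd1 : d * 2 <= d1 by apply: (Hd (2, d1)); rewrite !inE eqxx ?orbT.
have ddd0 : d * 2 <= d0 by apply: (Hd (2, d0)); rewrite !inE eqxx ?orbT.
have ddrb : d * 2 <= rb by apply: (Hd (2, rb)); rewrite !inE eqxx ?orbT.
clear Hd.
pose u y := phi y + eps * p y.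
have up y : Om y -> 0 < u y by move=> Oy; rewrite addr_gt0 ?phi0 // mulr_gt0.
pose Z := cutoff2 d rho zeta.
have CZ : Ck 1 setT Z := Ck_cutoff2 d Cr1 Cz.
pose F := picone_field A eta psi u Z.
have CF i : Ck 1 Om (F i).
  apply: (Ck_picone_field i oO CA Ce Cpsi _ (Ck_sub (@subsetT _ Om) CZ)).
    exact: (Ck_add oO Cphi (Ck_scale eps oO (Ck_sub (@subsetT _ Om) Cp))).
  by move=> y /up; exact: lt0r_neq0.
pose K1 := core Om rho L d.
have Z0 x : Om x -> ~ K1 x -> Z x = 0.
  move=> Ox nK; rewrite /Z /cutoff2; have [h|h] := lerP `|x| L; last first.
    by rewrite zQ ?mul0r ?mulr0 //; exact: xL.
  have [_ bd0 _ _] := bdcut_facts rho x dd0.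
  rewrite bd0 ?mul0r // ltNge; apply/negP => hd; apply: nK.
  by split=> //; split=> //; exact: subset_closure.
have F0 i x : Om x -> ~ K1 x -> F i x = 0.
  by move=> Ox nK; rewrite /F /picone_field Z0 // mul0r.
have K1O : K1 `<=` Om := core_sub dd0 rzero.
have Hdiv := gsum_divergence oO (compact_core Om L d Cr0) K1O CF F0 T00.
pose BL := [set x : 'rV[R]_n | `|x| <= L].
pose S (e : R) := [set x | Om x /\ dot x x <= Q /\ d <= rho x <= e].
pose a3 : R := e0 * (Ps / (eps * pm) * tau + (4 * K)^-1 * Ga).
have a30 : 0 <= a3.
  apply: mulr_ge0; first exact: ltW.
  apply: addr_ge0; apply: mulr_ge0 => //; [|exact: ltW|].
    by rewrite divr_ge0 ?ltW // mulr_gt0.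
  by rewrite invr_ge0 mulr_ge0 // ltW.
have ind1 (E : set 'rV[R]_n) x : E x -> \1_E x = 1 :> R.
  by move=> Ex; rewrite indicE mem_set.
have ind0 (E : set 'rV[R]_n) x : ~ E x -> \1_E x = 0 :> R.
  by move=> Ex; rewrite indicE memNset.
have ind_ge0 (E : set 'rV[R]_n) x : 0 <= \1_E x :> R by rewrite indicE ler0n.
(* the three errors of the Picone estimate, the second one split at rho = dp *)
have key x : c1 * \1_bx x <= \1_Om x * (\sum_i partial i (F i) x) +
    (a1 * (\1_K1 x * dot (grad zeta x) (grad zeta x)) + (a2 * (eps / cf) * \1_BL x +
    (a2 / pm * \1_(S dp) x + 2 / d * a3 * \1_(S (2 * d)) x))).
  have E1p : 0 <= a1 * (\1_K1 x * dot (grad zeta x) (grad zeta x)).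
    by rewrite mulr_ge0 ?(ltW a10) // mulr_ge0 // dot_ge0.
  have E2p : 0 <= a2 * (eps / cf) * \1_BL x.
    by rewrite mulr_ge0 // mulr_ge0 ?(ltW a20) // divr_ge0 // ltW.
  have E3p : 0 <= a2 / pm * \1_(S dp) x.
    by rewrite mulr_ge0 // divr_ge0 // ltW.
  have E4p : 0 <= 2 / d * a3 * \1_(S (2 * d)) x.
    by rewrite mulr_ge0 // mulr_ge0 // divr_ge0 // ltW.
  have [Ox|nOx] := pselect (Om x); last first.
    rewrite (ind0 Om) // (ind0 bx) ?mulr0 ?mul0r ?add0r; last first.
      by move=> /bxb /bO.
    by do 3!(apply: addr_ge0 => //).
  rewrite (ind1 Om) // mul1r.
  have [X [dc [uX /andP[dcl dcu] dcz hP]]] := picone_pointwise oO Ox CA Ce Cphi Cpsi Cr Cz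
    phi0 ep0 K0 dd0 (Asym x Ox) (Apos x Ox) (Aun x Ox) (ge x Ox) (Ephi x Ox) (Epsi x Ox).
  have e0x := eub x Ox; have ex0 := expR_ge0 (- eta x).
  have ux := up x Ox.
  have px := p0 x.
  have psx := HPs x Ox.
  have psi2 : psi x ^+ 2 <= Ps ^+ 2 by rewrite -(real_normK (num_real (psi x))) ler_pXn2r // nnegrE // ltW.
  have [/andP[chi0 chi1] chid chi2d _] := bdcut_facts rho x dd0.
  have /andP[zx0 zx1] := z01 x.
  have zz0 : 0 <= zeta x ^+ 2 by rewrite exprn_ge0.
  have zz1 : zeta x ^+ 2 <= 1 by rewrite exprn_ile1.
  have ZxE : Z x = bdcut d rho x * zeta x ^+ 2 by rewrite expr2.
  have Zx0 : 0 <= Z x by rewrite ZxE mulr_ge0.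
  have Zx1 : Z x <= 1 by rewrite ZxE mulr_ile1.
  have zin : zeta x != 0 -> dot x x <= Q /\ `|x| <= L.
    move=> z0; have h : dot x x <= Q.
      by rewrite leNgt; apply/negP => /ltW /zQ /eqP; rewrite (negbTE z0).
    by split => //; exact: QL.
  apply: (@le_trans _ _ (1 / 2 * expR (- eta x) * (Z x * dot X (mxact (A x) X)))).
    have [bxx|nbx] := pselect (bx x); last first.
      rewrite (ind0 bx) // mulr0; apply: mulr_ge0; last exact: mulr_ge0 Zx0 (Apos x Ox X).
      by apply: mulr_ge0 ex0; rewrite divr_ge0.
    have bx' := bxb x bxx; rewrite (ind1 bx) // mulr1.
    have Z1 : Z x = 1.
      by rewrite /Z /cutoff2 zb // chi2d ?mulr1 // mulrC; apply: le_trans ddrb (Hrb x bx').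
    rewrite Z1 [1 * dot _ _]mul1r.
    have qX : c0 / 16 <= dot X (mxact (A x) X).
      have uXE : u x *: X = phi x *: X0 x + eps *: Y x := uX.
      have hs := psd_split_scale (Asym x Ox) (Apos x Ox) uXE.
      have ep1 : eps * p x <= cb' by apply: le_trans epsp; rewrite ler_pM2l // Hpb.
      exact: absorbed_lower c00 cb0 ep0 My0 (Hcb x bx') (mulr_ge0 (ltW ep0) (ltW px)) ep1
        eps1 epsM (qb x bx') (HMy x bx') (Apos x Ox X) (erefl (u x)) hs.
    apply: (@le_trans _ _ (1 / 2 * e0^-1 * (c0 / 16))); first by rewrite /c1; clear; lra.
    have h2 : 0 <= 1 / 2 :> R by rewrite divr_ge0.
    have h3 : 0 <= 1 / 2 * e0^-1 by rewrite mulr_ge0 // invr_ge0 ltW.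
    have h4 : 0 <= c0 / 16 by rewrite divr_ge0 // ltW.
    have h5 : 1 / 2 * e0^-1 <= 1 / 2 * expR (- eta x) by rewrite ler_wpM2l ?elb.
    exact: (ler_pM h3 h4 h5 qX).
  apply: le_trans hP _; rewrite lerD2l.
  rewrite [expR _ * (_ + _)]mulrDr [expR _ * (_ + _)]mulrDr.
  rewrite [X in _ <= _ + X]addrA [leRHS]addrA.
  have ee : 0 <= expR (- eta x) <= e0 by rewrite ex0.
  have Axg := Apos x Ox.
  apply: lerD; first apply: lerD.
  - have [K1x|nK1] := pselect (K1 x).
      rewrite (ind1 K1) // mul1r; apply: cutoff_term => //; first by rewrite chi0.
      by rewrite Axg HLa.
    apply: le_trans E1p; have [h|h] := lerP `|x| L; last first.
      have -> : grad zeta x = 0 by apply: gzQ; exact: xL.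
      rewrite (_ : dot 0 _ = 0) ?mulr0 // /dot big1 // => i _; by rewrite mxE mul0r.
    rewrite chid ?mulr0 ?mul0r ?mulr0 // ltNge; apply/negP => hd; apply: nK1.
    by split=> //; split=> //; exact: subset_closure.
  - have [z0|z0] := eqVneq (zeta x) 0.
      rewrite -/(Z x) ZxE z0 expr0n mulr0 mul0r mulr0; exact: addr_ge0 E2p E3p.
    have [xQ xL'] := zin z0.
    have [rd|rd] := ltP (rho x) d.
      rewrite -/(Z x) ZxE chid // !mul0r mulr0; exact: addr_ge0 E2p E3p.
    have Dx : D x by [].
    have Z01 : 0 <= Z x <= 1 by rewrite Zx0.
    apply: le_trans (corrector_term ee Z01 psi2 ep0 ux (HH x Dx)) _.
    have [rdp|rdp] := leP (rho x) dp.
      have Sx : S dp x by split=> //; split=> //; apply/andP.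
      apply: ler_wpDl => //; rewrite (ind1 _ _ Sx) mulr1 -/a2 ler_pM2l //.
      rewrite ler_pdivrMr // mulrC ler_pdivlMr //.
      apply: (@le_trans _ _ (eps * p x)); first by rewrite ler_pM2l // Hpm.
      by rewrite /u lerDr ltW // phi0.
    apply: ler_wpDr => //; rewrite (ind1 BL) // mulr1 -/a2 ler_pM2l // ler_pM2l //.
    rewrite lef_pV2 ?posrE //; apply: (@le_trans _ _ (phi x)).
      by apply: Hcf; split; [split=> //; exact: subset_closure|exact: ltW].
    by rewrite /u lerDl mulr_ge0 // ltW.
  - have [dc0|dc0] := eqVneq dc 0; first by rewrite dc0 mulr0 mul0r mulr0.
    have [z0|z0] := eqVneq (zeta x) 0; first by rewrite z0 expr0n !mul0r mulr0.
    have [xQ xL'] := zin z0.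
    have rd : d <= rho x.
      by rewrite leNgt; apply/negP => h; move: dc0; rewrite dcz ?eqxx //; left.
    have rd2 : rho x <= 2 * d.
      by rewrite leNgt; apply/negP => h; move: dc0; rewrite dcz ?eqxx //; right.
    have Sx : S (2 * d) x by split=> //; split=> //; apply/andP.
    rewrite (ind1 _ _ Sx) mulr1 /a3; apply: flux_term => //.
    + by rewrite zz0.
    + by rewrite dcl.
    + by rewrite invr_ge0 mulr_ge0 // ltW.
    + rewrite mulr_gt0 //=; apply: (@le_trans _ _ (eps * p x)); first by rewrite ler_pM2l // Hpm.
      by rewrite /u lerDr ltW // phi0.
    + apply: Hd1 => //; first by split=> //; exact: subset_closure.
      by apply: le_trans rd2 _; rewrite mulrC.
    + by rewrite Axg HGa.
have d20 : 0 < 2 * d by rewrite mulr_gt0.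
have d2d0 : 2 * d <= d0 by rewrite mulrC.
have d2d : 0 <= 2 / d by rewrite divr_ge0 // ltW.
have aV : a2 * (eps / cf) * V <= T0.
  by rewrite (_ : _ * V = eps * (a2 * V) / cf) ?ler_pdivrMr //; ring.
have aS : a2 / pm * (Cs * dp) <= T0.
  by rewrite (_ : _ * _ = dp * (a2 * Cs) / pm) ?ler_pdivrMr //; ring.
have aF : 2 / d * a3 * (Cs * (2 * d)) <= 2 * T0.
  have E1 : 4 * Cs * e0 * (Ps / (eps * pm) * tau) = T0.
    by rewrite /tau; field; rewrite !lt0r_neq0.
  have E2 : 4 * Cs * e0 * ((4 * K)^-1 * Ga) <= T0.
    rewrite (_ : _ * _ = Cs * e0 * Ga / K); last by field; rewrite lt0r_neq0.
    rewrite ler_pdivrMr // /K mulrCA divff ?lt0r_neq0 // mulr1.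
    by rewrite ler_pM2l ?mulr_gt0 // lerDl.
  rewrite (_ : 2 / d * a3 * _ = 4 * Cs * e0 * (Ps / (eps * pm) * tau) + 4 * Cs * e0 * ((4 * K)^-1 * Ga)).
    by rewrite E1 [leRHS]mulr_natl mulr2n lerD2l.
  by rewrite /a3; field; rewrite !lt0r_neq0.
have [m [h1 [h2 [h3 [h4 h5]]]]] := filter_ex (filterI Hvb (filterI Hdiv
  (filterI (Hen K1 (compact_core Om L d Cr0) K1O)
  (filterI (Hstrip d dp dd0 dp0 dpd0) (Hstrip d (2 * d) dd0 d20 d2d0))))).
have h6 : gsum m \1_BL <= V := gsum_normball m L0.
have := ler_gsum m key.
rewrite gsumZ !gsumD !gsumZ => hkey.
have j1 : c1 * vb <= c1 * gsum m \1_bx by rewrite ler_pM2l.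
have j2 := le_trans (ler_norm _) h2.
have j3 := h3; rewrite ler_pdivlMr // mulrC in j3.
have j4 := le_trans (ler_wpM2l (ltW (mulr_gt0 a20 (divr_gt0 ep0 cf0))) h6) aV.
have j5 := le_trans (ler_wpM2l (ltW (divr_gt0 a20 pm0)) h4) aS.
have j6 := le_trans (ler_wpM2l (mulr_ge0 d2d a30) h5) aF.
have T8 : c1 * vb = 8 * T0 by rewrite /T0; field.
have := le_trans j1 (le_trans hkey (lerD j2 (lerD j3 (lerD j4 (lerD j5 j6))))).
by rewrite T8; clear -T00; move: T0 T00 => t t0; lra.
Qed.

(** By quotient_gradient_zero the quotient psi / phi has zero gradient, and Om is
    connected. *)
Lemma bounded_solution_proportional (a : R) Om A B c (bc : boundary_condition R n) eta phi psi (l C : R) :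
  (0 < n)%N -> standing_assumptions a Om A B c bc ->
  Ck 1 Om eta -> [bounded eta x | x in Om] ->
  (forall x, Om x -> grad eta x = - mxact (invmx (A x)) (B x)) ->
  (\forall r \near +oo,
    (lebesgue_n (Om `&` [set x | (enorm x <= r)%R]) <= (C * r ^+ 2)%:E)%E) ->
  Cka 2 a Om phi -> Cka 2 a Om psi -> (forall x, Om x -> 0 < phi x) ->
  [bounded psi x | x in Om] ->
  (forall x, Om x -> elliptic_op A B c phi x = l * phi x) ->
  (forall x, Om x -> elliptic_op A B c psi x = l * psi x) ->
  (forall x, boundary Om x -> boundary_op Om A bc phi x = 0) ->
  (forall x, boundary Om x -> boundary_op Om A bc psi x = 0) ->
  exists k : R, forall x, Om x -> psi x = k * phi x.
Proof.
move=> n0 sa Ce eb ge hvol Hphi Hpsi phi0 Pbnd Ephi Epsi bphi bpsi.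
have G := quotient_gradient_zero n0 sa Ce eb ge hvol Hphi Hpsi phi0 Pbnd Ephi Epsi bphi bpsi.
have [/andP[a0 _] [oO conn [x0 Ox0] _] _ _ _ _ _ _ _ _ _] := sa.
have Cphi := Ck_pred (Cka_Ck a0 oO Hphi); have Cpsi := Ck_pred (Cka_Ck a0 oO Hpsi).
have fn0 x : Om x -> phi x != 0 by move=> /phi0; exact: lt0r_neq0.
have Cf := Ck_mul oO Cpsi (Ck1_inv oO Cphi fn0).
exists (psi x0 / phi x0) => x Ox; rewrite -[LHS](divfK (fn0 x Ox)); congr (_ * _).
apply: (connected_constant oO conn Cf) => // y i Oy.
have dphi := Ck_derivable i Cphi Oy.
rewrite (partialM (Ck_derivable i Cpsi Oy) (Ck_derivable i (Ck1_inv oO Cphi fn0) Oy)).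
rewrite (partialV (fn0 y Oy) dphi).
have /rowP /(_ i) := G y Oy; rewrite !mxE => E.
transitivity ((phi y)^-1 * (partial i psi y - psi y / phi y * partial i phi y)).
  by field; exact: fn0.
by rewrite E mulr0.
Qed.

End Liouville.

(** * Simplicity of the principal eigenvalue *)

Theorem proposition2 (R : realType) (n : nat) (hn : (0 < n)%N) (alpha : R)
    (Omega : set 'rV[R]_n) (A : 'rV[R]_n -> 'M[R]_n)
    (B : 'rV[R]_n -> 'rV[R]_n) (c : 'rV[R]_n -> R)
    (bc : boundary_condition R n)
    (hstd : standing_assumptions alpha Omega A B c bc)
    (heta : exists eta : 'rV[R]_n -> R,
      [/\ Ck 1 Omega eta, [bounded eta x | x in Omega] &
          forall x, Omega x -> grad eta x = - mxact (invmx (A x)) (B x)])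
    (hvol : exists C : R, \forall r \near +oo,
      (lebesgue_n (Omega `&` [set x | (enorm x <= r)%R]) <= (C * r ^+ 2)%:E)%E)
    (hbnd : exists phi0 : 'rV[R]_n -> R,
      principal_eigenfunction alpha Omega (elliptic_op A B c)
        (boundary_op Omega A bc) phi0 /\
      [bounded phi0 x | x in Omega]) :
  forall phi psi : 'rV[R]_n -> R,
    principal_eigenfunction alpha Omega (elliptic_op A B c)
      (boundary_op Omega A bc) phi ->
    lambda1_solution alpha Omega (elliptic_op A B c)
      (boundary_op Omega A bc) psi ->
    (positive_on Omega psi \/ [bounded psi x | x in Omega]) ->
    exists k : R, forall x, Omega x -> psi x = k * phi x.
Proof.
have [eta [Ce eb ge]] := heta; have [C hv] := hvol.
have [phi0 [[phi00 [l0 [L0 H0 E0 B0]]] phi0b]] := hbnd.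
move=> phi psi [phip [l1 [L1 H1 E1 B1]]] [l2 [L2 H2 E2 B2]] alt.
have l10 : l1 = l0 by apply: EFin_inj; rewrite -L0 -L1.
have l20 : l2 = l0 by apply: EFin_inj; rewrite -L0 -L2.
rewrite l10 in E1; rewrite l20 in E2.
have prop := bounded_solution_proportional hn hstd Ce eb ge hv.
have [psip|psib] := alt; last exact: prop H1 H2 phip psib E1 E2 B1 B2.
have [k1 Hk1] := prop _ _ _ H1 H0 phip phi0b E1 E0 B1 B0.
have [k2 Hk2] := prop _ _ _ H2 H0 psip phi0b E2 E0 B2 B0.
have [x0 Ox0] : Omega !=set0 by case: hstd => _ [].
have k20 : k2 != 0.
  apply/negP => /eqP k0; have := phi00 x0 Ox0.
  by rewrite Hk2 // k0 mul0r ltxx.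
exists (k1 / k2) => x Ox; apply: (mulfI k20).
by rewrite mulrA mulrCA divff // mulr1 -Hk1 // Hk2.
Qed.
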